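(* Let $n\ge2$. (1) Let $a\in\mathbb{N}$ and $0\le i\le n-1$. For $$I(i,i)_i\xrightarrow{\ d\ }I(i+1,i+1)_{i+1}\xrightarrow{\ \widetilde{\mathcal{D}}^{i+1\to i}_{0,a}\ }J(i,i+a+1)_i,$$ the following two conditions on $(i,a,n)$ are equivalent: (i) $\widetilde{\mathcal{D}}^{i+1\to i}_{0,a}\circ d=0$; (ii) $n$ is even, $0\le i<\frac{n-2}{2}$, and $a=n-2i-2$. Moreover, for $n$ even, $\widetilde{\mathcal{D}}^{\frac n2\to\frac{n-2}2}_{0,0}\circ d=\widetilde{\mathcal{D}}^{\frac{n-2}2\to\frac{n-2}2}_{0,1}$. (2) Let $a\in\mathbb{N}$ and $0\le i\le n-2$. For $$I(i,i)_i\xrightarrow{\ d\ }I(i+1,i+1)_{i+1}\xrightarrow{\ \widetilde{\mathcal{D}}^{i+1\to i+1}_{0,a}\ }J(i+1,i+a+1)_{i+1},$$ the following two conditions on $(i,a,n)$ are equivalent: (i) $\widetilde{\mathcal{D}}^{i+1\to i+1}_{0,a}\circ d=0$; (ii) $a\in\mathbb{N}_+$. Moreover, $\widetilde{\mathcal{D}}^{i+1\to i+1}_{0,0}\circ d=\widetilde{\mathcal{D}}^{i\to i+1}_{0,1}$ for $0\le i\le n-2$. (3) Let $a\in\mathbb{N}$ and $1\le i\le n$. For $$I(i,n-i)_i\xrightarrow{\ d^*\ }I(i-1,n-i+1)_{i-1}\xrightarrow{\ \widetilde{\mathcal{D}}^{i-1\to i-1}_{n-2i+2,a}\ }J(i-1,n-i+a+1)_{i-1},$$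 the following two conditions on $(i,a,n)$ are equivalent: (i) $\widetilde{\mathcal{D}}^{i-1\to i-1}_{n-2i+2,a}\circ d^*=0$; (ii) $n$ is even, $\frac{n+2}{2}<i\le n$, and $a=2i-n-2$. Moreover, for $n$ even, $\widetilde{\mathcal{D}}^{\frac n2\to\frac n2}_{0,0}\circ d^*=-\widetilde{\mathcal{D}}^{\frac{n+2}2\to\frac n2}_{-2,1}$. (4) Let $a\in\mathbb{N}$ and $2\le i\le n$. For $$I(i,n-i)_i\xrightarrow{\ d^*\ }I(i-1,n-i+1)_{i-1}\xrightarrow{\ \widetilde{\mathcal{D}}^{i-1\to i-2}_{n-2i+2,a}\ }J(i-2,n-i+a+1)_{i-2},$$ the following two conditions on $(i,a,n)$ are equivalent: (i) $\widetilde{\mathcal{D}}^{i-1\to i-2}_{n-2i+2,a}\circ d^*=0$; (ii) $a\in\mathbb{N}_+$. Moreover, $\widetilde{\mathcal{D}}^{i-1\to i-2}_{n-2i+2,0}\circ d^*=\widetilde{\mathcal{D}}^{i\to i-2}_{n-2i,1}$ for $2\le i\le n$. (5) Let $a\in\mathbb{N}$ and $1\le i\le n-1$. For $$I(i,i-a-1)_i\xrightarrow{\ \widetilde{\mathcal{D}}^{i\to i-1}_{-a-1,a}\ }J(i-1,i-1)_{i-1}\xrightarrow{\ d\ }J(i,i)_i,$$ the following two conditions on $(i,a,n)$ are equivalent: (i) $d\circ\widetilde{\mathcal{D}}^{i\to i-1}_{-a-1,a}=0$; (ii) $n$ is odd, $\frac{n+1}{2}<i\le n-1$, $a=2i-n-1$.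 Moreover, for $n$ odd, $d\circ\widetilde{\mathcal{D}}^{\frac{n+1}2\to\frac{n-1}2}_{-1,0}=-\widetilde{\mathcal{D}}^{\frac{n+1}2\to\frac{n+1}2}_{-1,1}$. (6) Let $a\in\mathbb{N}$ and $0\le i\le n-2$. For $$I(i,i-a)_i\xrightarrow{\ \widetilde{\mathcal{D}}^{i\to i}_{-a,a}\ }J(i,i)_i\xrightarrow{\ d\ }J(i+1,i+1)_{i+1},$$ the following two conditions on $(i,a,n)$ are equivalent: (i) $d\circ\widetilde{\mathcal{D}}^{i\to i}_{-a,a}=0$; (ii) $a\in\mathbb{N}_+$ and $1\le i\le n-2$. Moreover, $d\circ\widetilde{\mathcal{D}}^{i\to i}_{-a,a}=\widetilde{\mathcal{D}}^{i\to i+1}_{-a,a+1}$ if $a=0$ or $i=0$. (7) Let $a\in\mathbb{N}$ and $0\le i\le n-1$. For $$I(i,n-i-a-1)_i\xrightarrow{\ \widetilde{\mathcal{D}}^{i\to i}_{n-2i-a-1,a}\ }J(i,n-i-1)_i\xrightarrow{\ d^*\ }J(i-1,n-i)_{i-1},$$ the following two conditions on $(i,a,n)$ are equivalent: (i) $d^*\circ\widetilde{\mathcal{D}}^{i\to i}_{n-2i-a-1,a}=0$; (ii) $n$ is odd, $0\le i<\frac{n-1}{2}$, and $a=n-2i-1$. Moreover, for $n$ odd, $d^*\circ\widetilde{\mathcal{D}}^{\frac{n-1}2\to\frac{n-1}2}_{0,0}=-\widetilde{\mathcal{D}}^{\frac{n-1}2\to\frac{n-3}2}_{0,1}$. (8)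 Let $a\in\mathbb{N}$ and $2\le i\le n$. For $$I(i,n-i-a)_i\xrightarrow{\ \widetilde{\mathcal{D}}^{i\to i-1}_{n-2i-a,a}\ }J(i-1,n-i)_{i-1}\xrightarrow{\ d^*\ }J(i-2,n-i+1)_{i-2},$$ the following two conditions on $(i,a,n)$ are equivalent: (i) $d^*\circ\widetilde{\mathcal{D}}^{i\to i-1}_{n-2i-a,a}=0$; (ii) $a\in\mathbb{N}_+$ and $2\le i\le n-1$. Moreover, $d^*\circ\widetilde{\mathcal{D}}^{i\to i-1}_{n-2i-a,a}=-\widetilde{\mathcal{D}}^{i\to i-2}_{n-2i-a,a+1}$ if $a=0$ or $i=n$.
   Context: $\mathbb{N}=\{0,1,2,\dots\}$, $\mathbb{N}_+=\{1,2,\dots\}$. Principal series. $G=O(n+1,1)$ preserves the form $x_0^2+\dots+x_n^2-x_{n+1}^2$ on $\mathbb{R}^{n+2}$, and $G'=O(n,1)\subset G$ is the stabilizer of the coordinate vector $e_n={}^t(0,\dots,0,1,0)$. Let $P=MAN_+$ be the (minimal) parabolic subgroup of $G$ stabilizing the line through ${}^t(1,0,\dots,0,1)$, with $M\simeq O(n)\times O(1)$, $A=\exp(\mathbb{R}H_0)$, $H_0=E_{0,n+1}+E_{n+1,0}$, and $N_+$ the unipotent radical (Lie algebra the $+1$-eigenspace of $\mathrm{ad}(H_0)$). For $0\le i\le n$, $\lambda\in\mathbb{C}$, $\alpha\in\mathbb{Z}/2\mathbb{Z}$, $I(i,\lambda)_\alpha$ is the unnormalized induced representation $\mathrm{Ind}_P^G(\bigwedge^i(\mathbb{C}^n)\boxtimes(-1)^\alpha\boxtimes\mathbb{C}_\lambda)$,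 where $N_+$ acts trivially and $e^{tH_0}$ acts on $\mathbb{C}_\lambda$ by $e^{\lambda t}$; that is, smooth $f$ on $G$ with $f(gman)=\sigma(m)^{-1}a^{-\lambda}f(g)$. $J(j,\nu)_\beta$ ($0\le j\le n-1$) is the analogous representation of $G'$ induced from $\bigwedge^j(\mathbb{C}^{n-1})\boxtimes(-1)^\beta\boxtimes\mathbb{C}_\nu$ of $P'=P\cap G'$. Integer subscripts are read modulo 2. Restricting to the open Bruhat cell, $I(i,\lambda)_\alpha\hookrightarrow\mathcal{E}^i(\mathbb{R}^n)$ and $J(j,\nu)_\beta\hookrightarrow\mathcal{E}^j(\mathbb{R}^{n-1})$ (flat picture), where $\mathcal{E}^i$ denotes smooth complex-valued $i$-forms; all operators are given in the flat picture. (For $j=-1$ the space of forms is zero.) $d$ is the exterior derivative and $d^*$ its formal adjoint (codifferential) for the flat metric, on $\mathbb{R}^n$ when applied first and on $\mathbb{R}^{n-1}$ when applied last. $\mathbb{R}^{n-1}=\{x_n=0\}\subset\mathbb{R}^n$, $\mathrm{Rest}_{x_n=0}$ is pull-back of forms, $\iota_{\partial/\partial x_n}$ is interior multiplication, $\Delta_{\mathbb{R}^{n-1}}=\sum_{j=1}^{n-1}\partial^2/\partial x_j^2$. For $\mu\in\mathbb{C}$, $\ell\in\mathbb{N}$, $$\mathcal{D}^\mu_\ell=\sum_{k=0}^{[\ell/2]}\frac{2^{\ell-2k}}{k!(\ell-2k)!}\Big(\prod_{m=[(\ell+1)/2]}^{\ell-k-1}(\mu+m)\Big)\Delta_{\mathbb{R}^{n-1}}^k\Big(\frac{\partial}{\partial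 x_n}\Big)^{\ell-2k}$$ (empty product $=1$), acting coefficientwise, and $\mathcal{D}^\mu_\ell=0$ for $\ell<0$. $\gamma(\mu,a)=1$ for $a$ odd, $=\mu+\frac a2$ for $a$ even. For $u\in\mathbb{C}$, $a\in\mathbb{N}$, $\mu:=u+i-\frac{n-1}2$: $$\mathcal{D}^{i\to i-1}_{u,a}=\mathrm{Rest}_{x_n=0}\circ\Big(-\mathcal{D}^{\mu+1}_{a-2}d_{\mathbb{R}^n}d_{\mathbb{R}^n}^*\iota_{\frac{\partial}{\partial x_n}}-\gamma(\mu,a)\mathcal{D}^{\mu+1}_{a-1}d_{\mathbb{R}^n}^*+\tfrac12(u+2i-n)\mathcal{D}^\mu_a\iota_{\frac{\partial}{\partial x_n}}\Big)\ (1\le i\le n),$$ $$\mathcal{D}^{i\to i}_{u,a}=\mathrm{Rest}_{x_n=0}\circ\Big(\mathcal{D}^{\mu+1}_{a-2}d_{\mathbb{R}^n}d_{\mathbb{R}^n}^*-\gamma(\mu-\tfrac12,a)\mathcal{D}^{\mu}_{a-1}d_{\mathbb{R}^n}\iota_{\frac{\partial}{\partial x_n}}+\tfrac12(u+a)\mathcal{D}^\mu_a\Big)\ (0\le i\le n-1).$$ Renormalized operators: $\widetilde{\mathcal{D}}^{i\to i-1}_{u,a}=\mathrm{Rest}_{x_n=0}\circ\iota_{\frac{\partial}{\partial x_n}}$ if $a=0$; $=\mathrm{Rest}_{x_n=0}\circ\mathcal{D}_a^{u+\frac{n+1}2}\circ\iota_{\frac{\partial}{\partial x_n}}$ if $i=n$;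 $=\mathcal{D}^{i\to i-1}_{u,a}$ otherwise. $\widetilde{\mathcal{D}}^{i\to i}_{u,a}=\mathrm{Rest}_{x_n=0}$ if $a=0$; $=\mathrm{Rest}_{x_n=0}\circ\mathcal{D}_a^{u-\frac{n-1}2}$ if $i=0$; $=\mathcal{D}^{i\to i}_{u,a}$ otherwise. $\widetilde{\mathcal{D}}^{i\to i+1}_{u,a}=\mathrm{Rest}_{x_n=0}\circ\mathcal{D}^{u-\frac{n-1}2}_{-u}\circ d_{\mathbb{R}^n}$, defined only for $a=1-u$, with $u=0$ if $1\le i\le n-2$ and $u\in-\mathbb{N}$ if $i=0$. $\widetilde{\mathcal{D}}^{i\to i-2}_{u,a}=\mathrm{Rest}_{x_n=0}\circ\mathcal{D}^{u+\frac{n+1}2}_{-u+n-2i}\circ\iota_{\frac{\partial}{\partial x_n}}\circ d^*_{\mathbb{R}^n}$, defined only for $a=1+n-2i-u$, with $u=n-2i$ if $2\le i\le n-1$ and $u\in-n-\mathbb{N}$ if $i=n$.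
   Formalization: In (7), for i=0 the implication (i)⇒(ii) is dropped, since d^* then maps to (−1)-forms, i.e. to 0, and (i) always holds; the ''Moreover'' identities of (1) and (3) are stated only for even n≠2, since for n=2 the two sides differ by a factor 2. *)

(* Defs.v *)
From mathcomp Require Import all_boot all_order all_algebra.
From mathcomp Require Import all_classical all_reals all_analysis.
From mathcomp Require Import complex.
Import Order.TTheory GRing.Theory Num.Theory numFieldNormedType.Exports.

Set Implicit Arguments.
Unset Strict Implicit.
Unset Printing Implicit Defensive.

Local Open Scope classical_set_scope.
Local Open Scope ring_scope.

Section SmoothFunctions.
Variables (R : realType) (V : normedModType R).
Implicit Types (f : V -> complex R) (U : set V).

Definition re_fun f : V -> R := fun x => complex.Re (f x).
Definition im_fun f : V -> R := fun x => complex.Im (f x).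

Definition cderive (v : V) f : V -> complex R :=
  fun x => Complex ('D_v (re_fun f) x) ('D_v (im_fun f) x).

Definition ccontinuous_on U f :=
  forall x, U x -> {for x, continuous (re_fun f)} /\
                   {for x, continuous (im_fun f)}.

Definition cderivable_on U (v : V) f :=
  forall x, U x -> derivable (re_fun f) x v /\ derivable (im_fun f) x v.

(* Meant for U open (and V finite-dimensional). *)
Fixpoint Ck_on (k : nat) U f : Prop :=
  ccontinuous_on U f /\
  if k is k'.+1
  then forall v : V, cderivable_on U v f /\ Ck_on k' U (cderive v f)
  else True.

Definition smooth_on U f : Prop := forall k, Ck_on k U f.

End SmoothFunctions.

(* An element of Lambda^i (over C) is an alternating R-multilinear map from
   (R^N)^i to C.  Arguments are passed as a list, so that forms of all degrees
   live in one type: a form of degree i vanishes on lists of length <> i.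
   In particular the only form of negative degree is 0.  *)
Section DifferentialForms.
Variable R : realType.
Local Notation C := (complex R).

Definition alternating_form (N i : nat) (w : seq 'rV[R]_N -> C) : Prop :=
  [/\ forall s, size s != i -> w s = 0,
      forall s, ~~ uniq s -> w s = 0 &
      forall s1 s2 (c : R) (u v : 'rV[R]_N),
        w (s1 ++ (c *: u + v) :: s2)
        = Complex c 0 * w (s1 ++ u :: s2) + w (s1 ++ v :: s2)].

Definition dform (N : nat) := 'rV[R]_N -> seq 'rV[R]_N -> C.

(* E^i(R^N) *)
Definition smooth_forms (N i : nat) : set (dform N) :=
  [set w | (forall x, alternating_form i (w x)) /\
           (forall s, smooth_on setT (fun x => w x s))].

Definition basis_vec (N : nat) (j : 'I_N) : 'rV[R]_N := delta_mx 0 j.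

(* (d w)(v_0, .., v_i) = sum_k (-1)^k D_{v_k} (w(v_0, .., ^v_k, .., v_i))
   for constant vector fields v_0, .., v_i. *)
Definition ext_d (N : nat) (w : dform N) : dform N :=
  fun x s => \sum_(k < size s)
    (-1) ^+ k * cderive (nth 0 s k) (fun y => w y (take k s ++ drop k.+1 s)) x.

(* The formal adjoint of [ext_d] for the flat metric:
   d^* = - sum_j iota_{e_j} o d/dx_j. *)
Definition codiff (N : nat) (w : dform N) : dform N :=
  fun x s => - \sum_(j < N)
    cderive (basis_vec j) (fun y => w y (basis_vec j :: s)) x.

Definition contract (N : nat) (v : 'rV[R]_N) (w : dform N) : dform N :=
  fun x s => w x (v :: s).

(* Action of an operator on functions, coefficient by coefficient. *)
Definition coefwise (N : nat) (D : ('rV[R]_N -> C) -> 'rV[R]_N -> C)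
    (w : dform N) : dform N :=
  fun x s => D (fun y => w y s) x.

Definition hyperplane_incl (n : nat) (x : 'rV[R]_n.-1) : 'rV[R]_n :=
  \row_(j < n) oapp (x 0) 0 (insub (val j)).

(* The vector d/dx_n. *)
Definition normal_vec (n : nat) : 'rV[R]_n := \row_(j < n) (val j == n.-1)%:R.

Definition Rest (n : nat) (w : dform n) : dform n.-1 :=
  fun x s => w (hyperplane_incl x) [seq hyperplane_incl v | v <- s].

End DifferentialForms.

Section Operators.
Variables (R : realType) (n : nat).
Local Notation C := (complex R).
Local Notation iota_n := (contract (normal_vec R n)).

(* The Laplacian of R^(n-1), acting on functions on R^n. *)
Definition tangential_lap (f : 'rV[R]_n -> C) : 'rV[R]_n -> C :=
  fun x => \sum_(j < n.-1)
    let e := hyperplane_incl (basis_vec R j) in cderive e (cderive e f) x.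

Definition normal_deriv : ('rV[R]_n -> C) -> 'rV[R]_n -> C :=
  cderive (normal_vec R n).

Definition calD_coef (mu : C) (l k : nat) : C :=
  2%:R ^+ (l - k.*2) / (k`! * (l - k.*2)`!)%:R
  * \prod_(l.+1./2 <= m < l - k) (mu + m%:R).

Definition calD (mu : C) (l : int) (f : 'rV[R]_n -> C) : 'rV[R]_n -> C :=
  if l is Posz p then
    fun x => \sum_(k < p./2.+1)
      calD_coef mu p k
      * iter k tangential_lap (iter (p - k.*2) normal_deriv f) x
  else fun=> 0.

Definition gamma (mu : C) (a : nat) : C :=
  if odd a then 1 else mu + a%:R / 2%:R.

Definition D_down (i : nat) (u : C) (a : nat) (w : dform R n) : dform R n.-1 :=
  let mu : C := u + i%:R - (n%:R - 1) / 2%:R in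
  Rest (fun x s =>
    - coefwise (calD (mu + 1) (a%:Z - 2)) (ext_d (codiff (iota_n w))) x s
    - gamma mu a * coefwise (calD (mu + 1) (a%:Z - 1)) (codiff w) x s
    + (u + 2%:R * i%:R - n%:R) / 2%:R * coefwise (calD mu a) (iota_n w) x s).

Definition D_same (i : nat) (u : C) (a : nat) (w : dform R n) : dform R n.-1 :=
  let mu : C := u + i%:R - (n%:R - 1) / 2%:R in
  Rest (fun x s =>
    coefwise (calD (mu + 1) (a%:Z - 2)) (ext_d (codiff w)) x s
    - gamma (mu - 1 / 2%:R) a
      * coefwise (calD mu (a%:Z - 1)) (ext_d (iota_n w)) x s
    + (u + a%:R) / 2%:R * coefwise (calD mu a) w x s).

Definition Dt_down (i : nat) (u : C) (a : nat) (w : dform R n) : dform R n.-1 :=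
  if a == 0%N then Rest (iota_n w)
  else if i == n then
    Rest (coefwise (calD (u + (n%:R + 1) / 2%:R) a) (iota_n w))
  else D_down i u a w.

Definition Dt_same (i : nat) (u : C) (a : nat) (w : dform R n) : dform R n.-1 :=
  if a == 0%N then Rest w
  else if i == 0%N then Rest (coefwise (calD (u - (n%:R - 1) / 2%:R) a) w)
  else D_same i u a w.

(* The operator i -> i+1 with parameters (u, a).  It is considered only for
   a = 1 - u, where u is an integer, u = 0 if 1 <= i <= n - 2 and u <= 0 if
   i = 0; its formula involves neither i nor a. *)
Definition Dt_up (u : int) (w : dform R n) : dform R n.-1 :=
  Rest (coefwise (calD (u%:~R - (n%:R - 1) / 2%:R) (- u)) (ext_d w)).

(* The operator i -> i-2 with parameters (u, a).  It is considered only for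
   a = 1 + n - 2i - u, where u is an integer, u = n - 2i if 2 <= i <= n - 1 and
   u <= - n if i = n; its formula does not involve a. *)
Definition Dt_down2 (i : nat) (u : int) (w : dform R n) : dform R n.-1 :=
  Rest (coefwise
    (calD (u%:~R + (n%:R + 1) / 2%:R) (- u + n%:Z - 2 * i%:Z))
    (iota_n (codiff w))).

End Operators.

Section PrincipalSeries.
Variables (R : realType) (n : nat).
Local Notation C := (complex R).

(* R^(n+2) has coordinates x_0, .., x_(n+1); those of R^n are x_1, .., x_n. *)
Definition mid (j : 'I_n) : 'I_n.+2 := lift ord0 (lift ord_max j).

Definition Jform : 'M[R]_n.+2 :=
  diag_mx (\row_j (if j == ord_max then -1 else 1)).

(* The group G = O(n+1, 1). *)
Definition inG : set 'M[R]_n.+2 := [set g | g^T *m Jform *m g = Jform].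

Definition H0 : 'M[R]_n.+2 := delta_mx ord0 ord_max + delta_mx ord_max ord0.

(* exp (t H_0), using that H_0^3 = H_0. *)
Definition expH0 (t : R) : 'M[R]_n.+2 :=
  1%:M + ((expR t - expR (- t)) / 2%:R) *: H0
       + ((expR t + expR (- t)) / 2%:R - 1) *: (H0 *m H0).

(* The block diagonal matrix diag (eps, B, eps); H_0^2 is the projection to the
   plane spanned by e_0 and e_(n+1). *)
Definition Melt (eps : R) (B : 'M[R]_n) : 'M[R]_n.+2 :=
  eps *: (H0 *m H0)
  + \sum_(j < n) \sum_(k < n) B j k *: delta_mx (mid j) (mid k).

(* The Lie algebra of N_+. *)
Definition in_nplus (X : 'M[R]_n.+2) : Prop :=
  X^T *m Jform + Jform *m X = 0 /\ H0 *m X - X *m H0 = X.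

(* The exponential of X in the Lie algebra of N_+ or N_-, where X^3 = 0. *)
Definition expN (X : 'M[R]_n.+2) : 'M[R]_n.+2 :=
  1%:M + X + 2%:R^-1 *: (X *m X).

Definition nminus_alg (x : 'rV[R]_n) : 'M[R]_n.+2 :=
  \sum_(j < n) x 0 j *:
    (- delta_mx ord0 (mid j) + delta_mx (mid j) ord0
     + delta_mx (mid j) ord_max + delta_mx ord_max (mid j)).

(* Coordinates of the open Bruhat cell:
   nminus x (1, 0, 1) = (1 - |x|^2, 2 x, 1 + |x|^2). *)
Definition nminus (x : 'rV[R]_n) : 'M[R]_n.+2 := expN (nminus_alg x).

(* G is a closed submanifold of the space of matrices. *)
Definition smooth_on_G (f : 'M[R]_n.+2 -> C) : Prop :=
  forall g, inG g -> exists (U : set 'M[R]_n.+2) (F : 'M[R]_n.+2 -> C),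
    [/\ open U, U g, smooth_on U F & forall h, inG h -> U h -> f h = F h].

Definition cexp (z : C) : C :=
  Complex (expR (complex.Re z) * cos (complex.Im z))
          (expR (complex.Re z) * sin (complex.Im z)).

(* I(i, lam)_alpha.  The element m = diag (eps, B, eps) of M acts on
   w in Lambda^i by (m w)(v_1, .., v_i) = eps^alpha w(B^-1 v_1, .., B^-1 v_i);
   vectors of R^n are rows here, so that B v is written v *m B^T.  Only the
   values of f on G matter. *)
Definition principal_series (i : nat) (lam : C) (alpha : nat) :
    set ('M[R]_n.+2 -> seq 'rV[R]_n -> C) :=
  [set f |
    [/\ forall g, inG g -> alternating_form i (f g),
        forall s, smooth_on_G (fun g => f g s) &
        forall g (eps : R) (B : 'M[R]_n) (t : R) (X : 'M[R]_n.+2),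
          inG g -> eps ^+ 2 = 1 -> B^T *m B = 1%:M -> in_nplus X ->
          forall s,
            f (g *m Melt eps B *m expH0 t *m expN X) s
            = Complex (eps ^+ alpha) 0 * cexp (- (lam * Complex t 0))
              * f g [seq v *m B^T | v <- s]]].

(* The flat picture of I(i, lam)_alpha, a subspace of E^i(R^n). *)
Definition flatI (i : nat) (lam : C) (alpha : nat) : set (dform R n) :=
  [set w | smooth_forms i w /\
    exists2 f, principal_series i lam alpha f &
               forall x s, w x s = f (nminus x) s].

End PrincipalSeries.

Section OperatorEquations.
Variables (R : realType) (n m : nat).

Definition vanishes_on (E : set (dform R n))
    (A : dform R n -> dform R m) : Prop :=
  forall w, E w -> forall x s, A w x s = 0.

Definition agree_on (E : set (dform R n))
    (A B : dform R n -> dform R m) : Prop :=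
  forall w, E w -> forall x s, A w x s = B w x s.

Definition opp_op (A : dform R n -> dform R m) : dform R n -> dform R m :=
  fun w x s => - A w x s.

End OperatorEquations.

(* Main.v *)
Require Import Defs.
From HB Require Import structures.
From mathcomp Require Import all_boot all_order all_algebra.
From mathcomp Require Import all_classical all_reals all_analysis.
From mathcomp Require Import complex perm.
From mathcomp Require Import ring lra zify.
Import Order.TTheory GRing.Theory Num.Theory numFieldNormedType.Exports.
Set Implicit Arguments.
Unset Strict Implicit.
Unset Printing Implicit Defensive.
Local Open Scope classical_set_scope.
Local Open Scope ring_scope.

(** Smooth forms on [R^n] are functions of their vector arguments with values in
    smooth functions, on which constant coefficient derivatives commute.  The
    vanishing results and the coincidences follow from this and from the
    antisymmetry of forms, and hold for all smooth forms: with [N] the normal derivative, [L] the tangential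
    Laplacian and [iota] the contraction with the normal vector, [d], the
    codifferentials [cdb] of [R^n] and [cdt] of the hyperplane and [iota]
    satisfy [d d = 0], [cdb cdb = 0], [cdb d + d cdb = - (L + N^2)],
    [iota d + d iota = N], [cdb = cdt - N iota], [cdt iota = - iota cdt].  Hence
    each composition becomes a combination of the scalar operators [geg mu l],
    the Gegenbauer polynomials in [L] and [N] that define the symmetry breaking
    operators, and it is decided by two three-term relations between them
    ([geg_tangential] and [geg_full]) together with two values of [mu] at which
    [geg mu (a - 1)] is [2 N] times an operator of degree [a - 2]
    ([geg_sum_half] and [geg_sum_int]).

    In the converse direction a nonzero value has to be found inside the
    principal series.  A form [x_t^p x_n^q (1 + |x|^2)^-K dx_I] with constant
    coefficient form [dx_I] belongs to the flat picture when [K] is chosen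
    according to [lambda]: up to a sign character it is the restriction to the open
    cell of a homogeneous function on the light cone, since [x_j] and
    [1 + |x|^2] are ratios of coordinates of the null vector [g (1, 0, 1)]
    ([test_form_flatI]).  An operator of order at most [p + q] evaluated at 0
    does not see the factor [(1 + |x|^2)^-K], so that vanishing on the principal
    series forces vanishing at 0 on [x_t^p x_n^q dx_I] ([vanishes_on_mono]).
    For a suitable [I], [t], [p] and [q] at most two terms of the composition
    survive, and their sum is a nonzero number, possibly times an affine function
    of [(a, i, n)] which vanishes under the stated condition only. *)

(** * Symmetry of mixed directional derivatives *)

Lemma dist_le_of_halves (R : realType) (a b c e : R) :
  `|a - b| < e / 2 -> `|c - b| < e / 2 -> `|a - c| <= e.
Proof. by rewrite (distrC c b) => ab bc; have := ler_distD b a c; lra. Qed.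

Section MixedPartials.
Variables (R : realType) (V : normedModType R).
Implicit Types (f : V -> R) (x u v : V).

Lemma is_derive_line f x v (t : R) :
  derivable f (x + t *: v) v ->
  is_derive t 1 (fun s : R => f (x + s *: v)) ('D_v f (x + t *: v)).
Proof.
move=> df.
have E : (fun h : R => h^-1 *: (((fun s => f (x + s *: v)) \o shift t) (h *: 1)
           - f (x + t *: v)))
   = (fun h => h^-1 *: ((f \o shift (x + t *: v)) (h *: v) - f (x + t *: v))).
  apply/funext => h /=; congr (_ *: (f _ - _)).
  by rewrite [_%:A]mulr1 scalerDl addrCA.
by apply: DeriveDef; rewrite /derivable/derive E.
Qed.

Lemma mvt_line f x v (h : R) : 0 < h ->
  (forall t, derivable f (x + t *: v) v) ->
  exists2 t, 0 < t < h & f (x + h *: v) - f x = h * 'D_v f (x + t *: v).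
Proof.
move=> h0 df.
have df1 (t : R) : is_derive t 1 (fun s : R => f (x + s *: v)) ('D_v f (x + t *: v)).
  exact: is_derive_line.
have [|c] := @MVT R (fun s => f (x + s *: v)) _ _ _ h0 (fun t _ => df1 t).
  by apply: derivable_within_continuous => t _; have [] := df1 t.
rewrite in_itv/= => ch; rewrite scale0r addr0 subr0 mulrC => ->.
by exists c.
Qed.

Lemma derive_shift_arg f x v w : 'D_v (fun y => f (y + w)) x = 'D_v f (x + w).
Proof.
rewrite /derive.
suff -> : (fun h => h^-1 *: (((fun y => f (y + w)) \o shift x) (h *: v)
  - f (x + w))) = (fun h => h^-1 *: ((f \o shift (x + w)) (h *: v) - f (x + w))) by [].
by apply/funext => h /=; rewrite addrA.
Qed.

Lemma derivable_shift_arg f x v w :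
  derivable f (x + w) v -> derivable (fun y => f (y + w)) x v.
Proof.
rewrite /derivable; suff -> : (fun h => h^-1 *: (((fun y => f (y + w)) \o shift x) (h *: v)
  - f (x + w))) = (fun h => h^-1 *: ((f \o shift (x + w)) (h *: v) - f (x + w))) by [].
by apply/funext => h /=; rewrite addrA.
Qed.

(** The mean value theorem along [u] for [f (_ + h v) - f], then along [v] for
    ['D_u f].  As the left-hand side is symmetric in [u] and [v], both mixed
    derivatives take a common value near [x]. *)
Lemma second_difference f x u v (h : R) : 0 < h ->
  (forall y, derivable f y u) -> (forall y, derivable ('D_u f) y v) ->
  exists s t, [/\ 0 < s < h, 0 < t < h &
    f (x + h *: v + h *: u) - f (x + h *: u) - (f (x + h *: v) - f x)
      = h * (h * 'D_v ('D_u f) (x + s *: u + t *: v))].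
Proof.
move=> h0 df ddf.
have dg y : derivable (fun y => f (y + h *: v) - f y) y u.
  by apply: derivableB => //; apply: derivable_shift_arg.
have [s sh Es] := mvt_line (x := x) (v := u) h0 (fun t => dg _).
have [t th Et] := mvt_line (x := x + s *: u) (v := v) h0 (fun t => ddf _).
exists s, t; split => //; rewrite -Et.
move: Es; rewrite (deriveB (derivable_shift_arg (df _)) (df _)).
by rewrite derive_shift_arg [x + h *: v + _]addrAC => <-.
Qed.

Lemma derive_comm f x u v :
  (forall y, derivable f y u) -> (forall y, derivable f y v) ->
  (forall y, derivable ('D_u f) y v) -> (forall y, derivable ('D_v f) y u) ->
  {for x, continuous ('D_v ('D_u f))} -> {for x, continuous ('D_u ('D_v f))} ->
  'D_v ('D_u f) x = 'D_u ('D_v f) x.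
Proof.
move=> du dv duv dvu cuv cvu.
apply/eqP; rewrite -subr_eq0 -normr_le0; apply/ler_addgt0Pr => e e0.
rewrite add0r; have e2 : 0 < e / 2 by lra.
move/cvgrPdist_lt: cuv => /(_ _ e2)/nbhs_ballP[d1 /= d10 B1].
move/cvgrPdist_lt: cvu => /(_ _ e2)/nbhs_ballP[d2 /= d20 B2].
set M := 1 + `|u| + `|v|.
have M0 : 0 < M by rewrite /M -addrA ltr_pwDl ?addr_ge0.
pose d := Num.min d1 d2; have d0 : 0 < d by rewrite lt_min d10 d20.
(* [M] bounds the distance to [x], in units of [h], of the points given by
   [second_difference], whichever the order of [u] and [v]. *)
pose h := d / M; have h0 : 0 < h by rewrite divr_gt0.
have small w w' s t : (w = u /\ w' = v) \/ (w = v /\ w' = u) ->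
    0 < s < h -> 0 < t < h -> `|x - (x + s *: w + t *: w')| < d.
  move=> ww /andP[s0 sh] /andP[t0 th].
  rewrite -addrA opprD addrA subrr sub0r normrN (le_lt_trans (ler_normD _ _))//.
  rewrite !normrZ !gtr0_norm//.
  have -> : d = h + h * `|u| + h * `|v| by rewrite /h /M; field; rewrite gt_eqF.
  have : s * `|w| <= h * `|w| by rewrite ler_wpM2r// ltW.
  have : t * `|w'| <= h * `|w'| by rewrite ler_wpM2r// ltW.
  by case: ww => -[-> ->]; lra.
have [s [t [sh th E1]]] := second_difference x h0 du duv.
have [t' [s' [sh' th' E2]]] := second_difference x h0 dv dvu.
have {E1 E2} E : 'D_v ('D_u f) (x + s *: u + t *: v)
    = 'D_u ('D_v f) (x + t' *: v + s' *: u).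
  have h_neq0 : h != 0 by rewrite gt_eqF.
  move: E1 E2; set A := 'D_v _ _; set B := 'D_u _ _ => E1 E2.
  suff : h * (h * A) = h * (h * B) by move/(mulfI h_neq0)/(mulfI h_neq0).
  refine (etrans (esym E1) (etrans _ E2)).
  by rewrite [x + h *: v + _]addrAC; ring.
have D1 := small u v s t (or_introl (conj erefl erefl)) sh th.
have D2 := small v u t' s' (or_intror (conj erefl erefl)) sh' th'.
move: D1 D2; rewrite !lt_min => /andP[D1 _] /andP[_ D2].
rewrite -ball_normE /= in B1; rewrite -ball_normE /= in B2.
have {}D1 := B1 _ D1; have {}D2 := B2 _ D2; rewrite /= in D1 D2.
rewrite E in D1; move: D1 D2.
exact: dist_le_of_halves.
Qed.

End MixedPartials.

(** * The module of smooth complex functions *)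

Section SmoothFunctionSpace.
Variables (R : realType) (V : normedModType R).
Local Notation C := (complex R).
Implicit Types (f g : V -> C) (v : V).

Lemma re_funD f g : re_fun (f \+ g) = re_fun f \+ re_fun g.
Proof. by apply/funext => x; rewrite /re_fun /=; case: (f x) (g x) => [? ?] []. Qed.

Lemma im_funD f g : im_fun (f \+ g) = im_fun f \+ im_fun g.
Proof. by apply/funext => x; rewrite /im_fun /=; case: (f x) (g x) => [? ?] []. Qed.

Lemma re_funZ (c : C) f : re_fun (fun x => c * f x)
  = complex.Re c *: re_fun f - complex.Im c *: im_fun f.
Proof.
by case: c => a b; apply/funext => x; rewrite /re_fun /im_fun !fctE /=; case: (f x).
Qed.

Lemma im_funZ (c : C) f : im_fun (fun x => c * f x)
  = complex.Re c *: im_fun f + complex.Im c *: re_fun f.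
Proof.
by case: c => a b; apply/funext => x; rewrite /re_fun /im_fun !fctE /=; case: (f x).
Qed.

Definition cderivable f v := cderivable_on setT v f.

Lemma cderiveD f g v : cderivable f v -> cderivable g v ->
  cderive v (f \+ g) = cderive v f \+ cderive v g.
Proof.
move=> df dg; apply/funext => x; have [df1 df2] := df x I; have [dg1 dg2] := dg x I.
by rewrite /cderive re_funD im_funD !deriveD.
Qed.

Lemma cderivableD f g v : cderivable f v -> cderivable g v -> cderivable (f \+ g) v.
Proof.
move=> df dg x _; have [df1 df2] := df x I; have [dg1 dg2] := dg x I.
by rewrite re_funD im_funD; split; apply: derivableD.
Qed.

Lemma cderiveZ (c : C) f v : cderivable f v ->
  cderive v (fun x => c * f x) = (fun x => c * cderive v f x).
Proof.
move=> df; apply/funext => x; have [df1 df2] := df x I.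
have dre a : derivable (a *: re_fun f) x v by apply: derivableZ.
have dim a : derivable (a *: im_fun f) x v by apply: derivableZ.
rewrite /cderive re_funZ im_funZ (deriveB (dre _) (dim _)) (deriveD (dim _) (dre _)).
rewrite !(deriveZ _ df1) !(deriveZ _ df2).
by case: c {dre dim}.
Qed.

Lemma cderivableZ (c : C) f v : cderivable f v -> cderivable (fun x => c * f x) v.
Proof.
move=> df x _; have [df1 df2] := df x I.
rewrite re_funZ im_funZ; split; first by apply: derivableB; apply: derivableZ.
by apply: derivableD; apply: derivableZ.
Qed.

Lemma Ck_onD k f g : Ck_on k setT f -> Ck_on k setT g -> Ck_on k setT (f \+ g).
Proof.
elim: k f g => [|k IHk] f g [cf df] [cg dg]; split.
- move=> x _; have [? ?] := cf x I; have [? ?] := cg x I.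
  by rewrite re_funD im_funD; split; apply: continuousD.
- by [].
- move=> x _; have [? ?] := cf x I; have [? ?] := cg x I.
  by rewrite re_funD im_funD; split; apply: continuousD.
- move=> v; have [df1 df2] := df v; have [dg1 dg2] := dg v; split.
    exact: (cderivableD df1 dg1).
  by rewrite (cderiveD df1 dg1); apply: IHk.
Qed.

Lemma Ck_onZ k (c : C) f : Ck_on k setT f -> Ck_on k setT (fun x => c * f x).
Proof.
elim: k f => [|k IHk] f [cf df]; split.
- move=> x _; have [? ?] := cf x I; rewrite re_funZ im_funZ; split.
    by apply: continuousB; apply: continuousZr.
  by apply: continuousD; apply: continuousZr.
- by [].
- move=> x _; have [? ?] := cf x I; rewrite re_funZ im_funZ; split.
    by apply: continuousB; apply: continuousZr.
  by apply: continuousD; apply: continuousZr.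
- move=> v; have [df1 df2] := df v; split; first exact: (cderivableZ c df1).
  by rewrite (cderiveZ c df1); apply: IHk.
Qed.

Lemma Ck_on_pred k f : @Ck_on R V k.+1 setT f -> @Ck_on R V k setT f.
Proof.
elim: k f => [|k IHk] f [cf df]; split=> // v; have [dvf Ckf] := df v.
by split=> //; apply: IHk.
Qed.

Lemma Ck_on0 k : @Ck_on R V k setT (fun=> 0).
Proof.
have E (v : V) : cderive v (fun=> 0 : C) = (fun=> 0).
  apply/funext => x; rewrite /cderive.
  rewrite [re_fun _](_ : _ = cst 0)// [im_fun _](_ : _ = cst 0)//.
  by rewrite !derive_cst.
elim: k => [|k IHk]; split.
- by move=> x _; split; apply: cst_continuous.
- by [].
- by move=> x _; split; apply: cst_continuous.
- move=> v; split; first by move=> x _; split; apply: derivable_cst.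
  by rewrite E.
Qed.

(** A subtype, so that the operators become linear endomaps of one module and
    their identities can be proved by algebra. *)
Record smoothfun := SmoothFun { sfun :> V -> C; sfunP : smooth_on setT sfun }.

Lemma sfunI (F G : smoothfun) : sfun F = sfun G -> F = G.
Proof.
case: F G => [f pf] [g pg] /= E; subst g; congr SmoothFun.
exact: Prop_irrelevance.
Qed.

HB.instance Definition _ := gen_eqMixin smoothfun.
HB.instance Definition _ := gen_choiceMixin smoothfun.

Lemma smoothD (F G : smoothfun) : smooth_on setT (F \+ G).
Proof. by move=> k; apply: Ck_onD; apply: sfunP. Qed.

Lemma smoothZ (c : C) (F : smoothfun) : smooth_on setT (fun x => c * F x).
Proof. by move=> k; apply: Ck_onZ; apply: sfunP. Qed.

Definition sf0 := SmoothFun (fun k => @Ck_on0 k).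
Definition sfD F G := SmoothFun (smoothD F G).
Definition sfZ c F := SmoothFun (smoothZ c F).

Fact sfDA : associative sfD.
Proof. by move=> F G H; apply: sfunI; apply/funext => x /=; rewrite addrA. Qed.
Fact sfDC : commutative sfD.
Proof. by move=> F G; apply: sfunI; apply/funext => x /=; rewrite addrC. Qed.
Fact sf0D : left_id sf0 sfD.
Proof. by move=> F; apply: sfunI; apply/funext => x /=; rewrite add0r. Qed.
Fact sfND : left_inverse sf0 (sfZ (-1)) sfD.
Proof.
by move=> F; apply: sfunI; apply/funext => x /=; rewrite mulN1r addNr.
Qed.

HB.instance Definition _ := GRing.isZmodule.Build smoothfun sfDA sfDC sf0D sfND.

Fact sfZA (a b : C) F : sfZ a (sfZ b F) = sfZ (a * b) F.
Proof. by apply: sfunI; apply/funext => x /=; rewrite mulrA. Qed.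
Fact sf1Z : left_id 1 sfZ.
Proof. by move=> F; apply: sfunI; apply/funext => x /=; rewrite mul1r. Qed.
Fact sfZDr : right_distributive sfZ +%R.
Proof. by move=> c F G; apply: sfunI; apply/funext => x /=; rewrite mulrDr. Qed.
Fact sfZDl F : {morph sfZ^~ F : a b / a + b}.
Proof. by move=> a b; apply: sfunI; apply/funext => x /=; rewrite mulrDl. Qed.

HB.instance Definition _ :=
  GRing.Zmodule_isLmodule.Build C smoothfun sfZA sf1Z sfZDr sfZDl.

Lemma sfunD (F G : smoothfun) x : (F + G) x = F x + G x. Proof. by []. Qed.
Lemma sfunZ (c : C) (F : smoothfun) x : (c *: F) x = c * F x. Proof. by []. Qed.
Lemma sfunN (F : smoothfun) x : (- F) x = - F x.
Proof. exact: mulN1r. Qed.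
Lemma sfun_sum (J : Type) (r : seq J) (P : pred J) (F : J -> smoothfun) x :
  (\sum_(j <- r | P j) F j) x = \sum_(j <- r | P j) F j x.
Proof. by elim/big_rec2: _ => // j y1 y2 _ <-. Qed.

Lemma sfun_cderivable (F : smoothfun) v : cderivable F v.
Proof. by have [_ /(_ v) []] := sfunP F 1%N. Qed.

Lemma smooth_cderive (F : smoothfun) v : smooth_on setT (cderive v F).
Proof. by move=> k; have [_ /(_ v) []] := sfunP F k.+1. Qed.

Definition sderive v (F : smoothfun) := SmoothFun (smooth_cderive F v).

Fact sderive_is_linear v : linear (sderive v).
Proof.
move=> c F G; apply: sfunI => /=; rewrite (cderiveD (f := sfun (c *: F))).
- by congr (_ \+ _); rewrite /= cderiveZ//; apply: sfun_cderivable.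
- exact: (sfun_cderivable (c *: F)).
- exact: sfun_cderivable.
Qed.

HB.instance Definition _ v :=
  GRing.isLinear.Build C smoothfun smoothfun _ (sderive v) (sderive_is_linear v).

(** The bundled linear map, for families of operators indexed by vectors. *)
Definition sderive_lin v : {linear smoothfun -> smoothfun} := sderive v.

Lemma sderiveC u v (F : smoothfun) :
  sderive_lin u (sderive_lin v F) = sderive_lin v (sderive_lin u F).
Proof.
have c u' v' x : {for x, continuous ('D_u' ('D_v' (re_fun F)))} /\
                {for x, continuous ('D_u' ('D_v' (im_fun F)))}.
  have [+ _] := sfunP (sderive u' (sderive v' F)) 0%N.
  by move=> /(_ x I).
have d1 w y : derivable (re_fun F) y w /\ derivable (im_fun F) y w.
  exact: sfun_cderivable.
have d2 w w' y : derivable ('D_w (re_fun F)) y w' /\ derivable ('D_w (im_fun F)) y w'.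
  exact: (sfun_cderivable (sderive w F) w' I).
have Ere x : 'D_u ('D_v (re_fun F)) x = 'D_v ('D_u (re_fun F)) x.
  apply: (@derive_comm R V (re_fun F) x v u).
  - by move=> y; exact: (d1 v y).1.
  - by move=> y; exact: (d1 u y).1.
  - by move=> y; exact: (d2 v u y).1.
  - by move=> y; exact: (d2 u v y).1.
  - exact: (c u v x).1.
  - exact: (c v u x).1.
have Eim x : 'D_u ('D_v (im_fun F)) x = 'D_v ('D_u (im_fun F)) x.
  apply: (@derive_comm R V (im_fun F) x v u).
  - by move=> y; exact: (d1 v y).2.
  - by move=> y; exact: (d1 u y).2.
  - by move=> y; exact: (d2 v u y).2.
  - by move=> y; exact: (d2 u v y).2.
  - exact: (c u v x).2.
  - exact: (c v u x).2.
apply: sfunI; apply/funext => x.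
exact: (congr2 (@Complex R) (Ere x) (Eim x)).
Qed.

End SmoothFunctionSpace.

(** * Coefficients of the Gegenbauer polynomials *)

Section GegenbauerCoefficients.
Variable R : realType.
Local Notation C := (complex R).
Implicit Types (mu x : C) (k q p a b : nat).

(** The product in the coefficients, as a function of the degree [q] in the
    normal derivative: the other degree [k] only shifts the argument. *)
Definition half_prod x q : C := \prod_(uphalf q <= m < q) (x + m%:R).

Definition geg_coef mu k q : C :=
  2%:R ^+ q / (k`! * q`!)%:R * half_prod (mu + k%:R) q.

Lemma calD_coefE mu p k : (k.*2 <= p)%N ->
  calD_coef mu p k = geg_coef mu k (p - k.*2).
Proof.
move=> kp; rewrite /calD_coef /geg_coef /half_prod; congr (_ * _).
have -> : p.+1./2 = (uphalf (p - k.*2) + k)%N by lia.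
have -> : (p - k = p - k.*2 + k)%N by lia.
rewrite -{2}[k]add0n -[in RHS](addnK k (p - k.*2)%N) big_addn.
rewrite addnK; apply: eq_bigr => m _.
by rewrite natrD addrA addrAC.
Qed.

Lemma half_prod0 x : half_prod x 0 = 1.
Proof. by rewrite /half_prod big_geq. Qed.

Lemma half_prod1 x : half_prod x 1 = 1.
Proof. by rewrite /half_prod big_geq. Qed.

Lemma half_prod_even x b :
  half_prod x b.*2.+2 = half_prod (x + 1) b.*2 * (x + b.*2.+1%:R).
Proof.
rewrite /half_prod; have -> : uphalf b.*2.+2 = b.+1 by lia.
have -> : uphalf b.*2 = b by lia.
rewrite big_nat_recr /=; last by lia.
congr (_ * _); rewrite big_add1 /=; apply: eq_bigr => m _.
by rewrite -addrA -natr1 [m%:R + 1]addrC.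
Qed.

Lemma half_prod_odd_even x b :
  half_prod x b.*2.+2 = half_prod x b.*2.+1 * (x + b.*2.+1%:R).
Proof.
rewrite /half_prod; have -> : uphalf b.*2.+2 = b.+1 by lia.
have -> : uphalf b.*2.+1 = b.+1 by lia.
by rewrite big_nat_recr //=; lia.
Qed.

Lemma half_prod_odd x b : half_prod x b.*2.+1 = half_prod (x + 1) b.*2.
Proof.
rewrite /half_prod; have -> : uphalf b.*2.+1 = b.+1 by lia.
have -> : uphalf b.*2 = b by lia.
rewrite big_add1 /=; apply: eq_bigr => m _.
by rewrite -addrA -natr1 [m%:R + 1]addrC.
Qed.

Lemma half_prod_even_low x b :
  half_prod x b.*2.+2 = (x + b.+1%:R) * half_prod (x + 1) b.*2.+1.
Proof.
rewrite /half_prod; have -> : uphalf b.*2.+2 = b.+1 by lia.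
have -> : uphalf b.*2.+1 = b.+1 by lia.
rewrite big_ltn; last by lia.
congr (_ * _); rewrite big_add1 /=; apply: eq_bigr => m _.
by rewrite -addrA -natr1 [m%:R + 1]addrC.
Qed.

Lemma gamma_shift mu k q : gamma mu (k.*2 + q) = gamma (mu + k%:R) q.
Proof.
rewrite /gamma oddD odd_double /=; case: ifP => // _.
by rewrite natrD -mul2n natrM; field.
Qed.

Lemma geg_coef_pred mu k q :
  geg_coef (mu + 1) k q = k.+1%:R * geg_coef mu k.+1 q.
Proof.
have E : mu + k.+1%:R = mu + 1 + k%:R by rewrite -nat1r addrA.
rewrite /geg_coef factS E.
have k0 : k.+1%:R != 0 :> C by rewrite pnatr_eq0.
have f0 : k`!%:R != 0 :> C by rewrite pnatr_eq0 -lt0n fact_gt0.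
have g0 : q`!%:R != 0 :> C by rewrite pnatr_eq0 -lt0n fact_gt0.
rewrite !natrM; field.
by rewrite f0 g0 nat1r k0.
Qed.

Lemma half_prod_gamma x q : half_prod x q.+1 = gamma x q.+1 * half_prod (x + 1) q.
Proof.
have [b] : exists b, q = b.*2.+1 \/ q = b.*2.
  by exists q./2; lia.
case=> ->; rewrite /gamma /= odd_double /=.
  rewrite half_prod_even_low; congr (_ * _); congr (_ + _).
  by rewrite -[b.*2.+2]/(b.+1.*2) -mul2n natrM; field.
by rewrite half_prod_odd mul1r.
Qed.

Lemma geg_coef_succ mu k q :
  gamma (mu + k%:R) q.+1 * geg_coef (mu + 1) k q = q.+1%:R / 2%:R * geg_coef mu k q.+1.
Proof.
have k0 : q.+1%:R != 0 :> C by rewrite pnatr_eq0.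
have f0 : k`!%:R != 0 :> C by rewrite pnatr_eq0 -lt0n fact_gt0.
have g0 : q`!%:R != 0 :> C by rewrite pnatr_eq0 -lt0n fact_gt0.
rewrite /geg_coef half_prod_gamma [mu + 1 + _]addrAC factS !natrM exprS; field.
by rewrite f0 g0 nat1r k0.
Qed.

(** Both parities of [q] are needed: the product gains a factor only when [q]
    becomes even, and [gamma] compensates for this. *)
Lemma half_prod_rec x q : half_prod x q.+2 =
  q.+1%:R / 2%:R * half_prod (x + 1) q + gamma (x - 1 / 2%:R) q.+2 * half_prod x q.+1.
Proof.
have [b] : exists b, q = b.*2 \/ q = b.*2.+1.
  by exists q./2; lia.
case=> ->; rewrite /gamma /= odd_double /=.
  rewrite half_prod_even half_prod_odd.
  by rewrite -![b.*2.+2%:R]natr1 -![b.*2.+1%:R]natr1 -mul2n natrM; field.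
rewrite -doubleS half_prod_odd doubleS half_prod_odd_even half_prod_even_low.
by rewrite -![b.*2.+2%:R]natr1 -![b.*2.+1%:R]natr1 -![b.+1%:R]natr1 -mul2n natrM; field.
Qed.

Lemma geg_coef_rec mu k q :
  geg_coef (mu + 1) k q + gamma (mu + k%:R - 1 / 2%:R) q.+2 * geg_coef mu k q.+1
  = q.+2%:R / 2%:R * geg_coef mu k q.+2.
Proof.
have k0 : q.+1%:R != 0 :> C by rewrite pnatr_eq0.
have k1 : q.+2%:R != 0 :> C by rewrite pnatr_eq0.
have f0 : k`!%:R != 0 :> C by rewrite pnatr_eq0 -lt0n fact_gt0.
have g0 : q`!%:R != 0 :> C by rewrite pnatr_eq0 -lt0n fact_gt0.
rewrite /geg_coef half_prod_rec [mu + 1 + _]addrAC !factS !natrM !exprS; field.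
by rewrite f0 g0 nat1r -natrD add2n k0 k1.
Qed.

Lemma geg_coef_rec1 mu k : geg_coef mu k 0 = 1 / 2%:R * geg_coef mu k 1.
Proof.
have f0 : k`!%:R != 0 :> C by rewrite pnatr_eq0 -lt0n fact_gt0.
rewrite /geg_coef half_prod0 half_prod1 !fact0 factS fact0 !muln1 expr0 expr1.
by field.
Qed.

(** [3/2 - (k + b + 1) + k] and [1/2 - b] agree, and at [1/2 - b] consecutive
    half products differ by the factor [2 b + 1] that the factorials need. *)
Lemma geg_coef_half k b :
  geg_coef (3%:R / 2%:R - (k + b.+1)%:R : C) k b.*2.+1
  = 2%:R * geg_coef (3%:R / 2%:R - (k + b.+1)%:R) k b.*2.
Proof.
have f0 : k`!%:R != 0 :> C by rewrite pnatr_eq0 -lt0n fact_gt0.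
have g0 : (b.*2)`!%:R != 0 :> C by rewrite pnatr_eq0 -lt0n fact_gt0.
have k0 : b.*2.+1%:R != 0 :> C by rewrite pnatr_eq0.
have E : half_prod (1 / 2%:R - b%:R : C) b.*2.+1
    = b.*2.+1%:R * half_prod (1 / 2%:R - b%:R) b.*2.
  case: b {f0 g0 k0} => [|b]; first by rewrite half_prod0 half_prod1 mulr1.
  rewrite half_prod_odd doubleS half_prod_odd_even half_prod_even_low.
  by rewrite -!natr1 -mul2n natrM; field.
rewrite /geg_coef (_ : _ - _ + _ = 1 / 2%:R - b%:R); last first.
  by rewrite natrD -natr1; field.
rewrite E factS !natrM exprS; field.
by rewrite f0 g0 nat1r k0.
Qed.

(** Both sides vanish unless [b = 0]: there is a zero factor in the half products
    at nonpositive integers. *)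
Lemma geg_coef_int k b :
  geg_coef (- (k + b.+1)%:R : C) k b.*2.+1
  = 2%:R * geg_coef (- (k + b.+1)%:R + 1) k b.*2.
Proof.
have f0 : k`!%:R != 0 :> C by rewrite pnatr_eq0 -lt0n fact_gt0.
have g0 : (b.*2)`!%:R != 0 :> C by rewrite pnatr_eq0 -lt0n fact_gt0.
have k0 : b.*2.+1%:R != 0 :> C by rewrite pnatr_eq0.
have E : half_prod (- b.+1%:R : C) b.*2.+1 = b.*2.+1%:R * half_prod (- b%:R) b.*2.
  rewrite half_prod_odd -[b.+1%:R]natr1 opprD addrNK.
  case: b {f0 g0 k0} => [|b]; first by rewrite mul1r.
  by rewrite doubleS half_prod_even_low addNr !mul0r mulr0.
rewrite /geg_coef (_ : - _ + k%:R = - b.+1%:R); last first.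
  by rewrite natrD; ring.
rewrite (_ : - _ + 1 + k%:R = - b%:R); last by rewrite natrD -natr1; ring.
rewrite E factS !natrM exprS; field.
by rewrite f0 g0 nat1r k0.
Qed.

End GegenbauerCoefficients.

(** * Gegenbauer sums with arbitrary coefficients *)

Section GegenbauerSums.
Variables (R : realType).
Local Notation C := (complex R).
Variable S : lmodType C.
Implicit Types (mu : C) (k q p : nat) (f : nat -> nat -> S).

(** The values [f k q] stand for [L^k N^q F].  Keeping them arbitrary makes
    multiplication by [L] or [N] a shift of an index. *)
Definition geg_sum mu p f : S :=
  \sum_(k < p./2.+1) geg_coef mu k (p - k.*2) *: f k (p - k.*2)%N.

(** Euler's relation for the weight [p / 2 = k + (p - 2 k) / 2] splits the sum
    into a part divisible by [L] and a part divisible by [N]. *)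
Let tangential_part mu p f : S := \sum_(k < p./2.+1)
  (k%:R * geg_coef mu k (p - k.*2)) *: f k (p - k.*2)%N.

Let normal_part mu p f : S := \sum_(k < p./2.+1)
  ((p - k.*2)%:R / 2%:R * geg_coef mu k (p - k.*2)) *: f k (p - k.*2)%N.

Let geg_sum_split mu p f :
  (p%:R / 2%:R) *: geg_sum mu p f = tangential_part mu p f + normal_part mu p f.
Proof.
rewrite /geg_sum scaler_sumr -big_split; apply: eq_bigr => k _ /=.
rewrite scalerA -scalerDl; congr (_ *: _).
have kp : (k.*2 <= p)%N by have := ltn_ord k; lia.
by rewrite natrB// -mul2n natrM; field.
Qed.

Let tangential_partE mu p f :
  tangential_part mu p.+2 f = geg_sum (mu + 1) p (fun k q => f k.+1 q).
Proof.
rewrite /tangential_part big_ord_recl mul0r scale0r add0r; apply: eq_bigr => k _.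
by rewrite geg_coef_pred lift0 doubleS subSS.
Qed.

Let normal_partE mu p f :
  normal_part mu p.+1 f = gamma mu p.+1 *: geg_sum (mu + 1) p (fun k q => f k q.+1).
Proof.
have E k : (k.*2 <= p)%N ->
    ((p.+1 - k.*2)%:R / 2%:R * geg_coef mu k (p.+1 - k.*2)) *: f k (p.+1 - k.*2)%N
    = gamma mu p.+1 *: (geg_coef (mu + 1) k (p - k.*2) *: f k (p - k.*2).+1).
  move=> kp; rewrite scalerA !subSn//; congr (_ *: _).
  by rewrite -geg_coef_succ -gamma_shift; congr (gamma _ _ * _); lia.
rewrite /geg_sum scaler_sumr /normal_part.
have [b pb] : exists b, p = b.*2 \/ p = b.*2.+1 by exists p./2; lia.
case: pb => pb; subst p.
  have -> : b.*2.+1./2 = b.*2./2 by lia.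
  by apply: eq_bigr => k _; apply: E; have := ltn_ord k; lia.
have -> : b.*2.+2./2 = b.*2.+1./2.+1 by lia.
rewrite big_ord_recr /= [X in (X)%:R / _](_ : _ = 0%N); last by lia.
rewrite mul0r mul0r scale0r addr0.
by apply: eq_bigr => k _; apply: E; have := ltn_ord k; lia.
Qed.

Let normal_part_rec mu p f :
  normal_part mu p.+2 f = geg_sum (mu + 1) p (fun k q => f k q.+2)
    + gamma (mu - 1 / 2%:R) p.+2 *: geg_sum mu p.+1 (fun k q => f k q.+1).
Proof.
have E k : (k.*2 <= p)%N ->
    ((p.+2 - k.*2)%:R / 2%:R * geg_coef mu k (p.+2 - k.*2)) *: f k (p.+2 - k.*2)%N
    = geg_coef (mu + 1) k (p - k.*2) *: f k (p - k.*2).+2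
      + gamma (mu - 1 / 2%:R) p.+2
        *: (geg_coef mu k (p.+1 - k.*2) *: f k (p.+1 - k.*2).+1).
  move=> kp; rewrite scalerA !subSn//; last by rewrite leqW.
  rewrite -scalerDl; congr (_ *: _).
  rewrite -geg_coef_rec; congr (_ + _ * _).
  rewrite [mu + _]addrC -addrA [_%:R + _]addrC -gamma_shift.
  by congr (gamma _ _); lia.
rewrite /geg_sum scaler_sumr /normal_part.
have [b pb] : exists b, p = b.*2 \/ p = b.*2.+1 by exists p./2; lia.
case: pb => pb; subst p.
  have -> : b.*2.+2./2 = b.*2./2.+1 by lia.
  rewrite big_ord_recr /= [X in (X)%:R / _](_ : _ = 0%N); last by lia.
  rewrite mul0r mul0r scale0r addr0.
  have -> : uphalf b.*2 = b.*2./2 by lia.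
  rewrite -big_split.
  by apply: eq_bigr => k _; apply: E; have := ltn_ord k; lia.
have -> : b.*2.+3./2 = b.*2.+1./2.+1 by lia.
have -> : b.*2.+2./2 = b.*2.+1./2.+1 by lia.
rewrite !(big_ord_recr b.*2.+1./2.+1) /= addrA -big_split; congr (_ + _).
  by apply: eq_bigr => k _; apply: E; have := ltn_ord k; lia.
rewrite scalerA.
have -> : (b.*2.+3 - (uphalf b.*2).+1.*2 = 1)%N by lia.
have -> : (b.*2.+2 - (uphalf b.*2).+1.*2 = 0)%N by lia.
by rewrite -geg_coef_rec1 /gamma /= odd_double /= mul1r.
Qed.

(** The two three-term relations only differ in the way in which the part
    divisible by [N] is written with [geg_sum]s of lower degree. *)
Lemma geg_sum_tangential mu p f :
  geg_sum (mu + 1) p (fun k q => f k.+1 q)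
  + gamma mu p.+2 *: geg_sum (mu + 1) p.+1 (fun k q => f k q.+1)
  = (p.+2%:R / 2%:R) *: geg_sum mu p.+2 f.
Proof. by rewrite geg_sum_split tangential_partE normal_partE. Qed.

Lemma geg_sum_full mu p f :
  geg_sum (mu + 1) p (fun k q => f k.+1 q) + geg_sum (mu + 1) p (fun k q => f k q.+2)
  + gamma (mu - 1 / 2%:R) p.+2 *: geg_sum mu p.+1 (fun k q => f k q.+1)
  = (p.+2%:R / 2%:R) *: geg_sum mu p.+2 f.
Proof. by rewrite geg_sum_split tangential_partE normal_part_rec addrA. Qed.

Lemma geg_sum0 mu f : geg_sum mu 0 f = f 0%N 0%N.
Proof.
rewrite /geg_sum big_ord1 /= /geg_coef half_prod0 !fact0 expr0.
by rewrite muln1 divr1 mulr1 scale1r.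
Qed.

Lemma geg_sum1 mu f : geg_sum mu 1 f = 2%:R *: f 0%N 1%N.
Proof.
rewrite /geg_sum big_ord1 /= /geg_coef half_prod1 !fact0 expr1.
by rewrite muln1 divr1 mulr1.
Qed.

Lemma geg_sum_half c f :
  geg_sum (3%:R / 2%:R - c.+1%:R) c.*2.+1 f
  = 2%:R *: geg_sum (3%:R / 2%:R - c.+1%:R) c.*2 (fun k q => f k q.+1).
Proof.
rewrite /geg_sum scaler_sumr.
have -> : c.*2.+1./2 = c.*2./2 by lia.
apply: eq_bigr => k _; rewrite scalerA.
have kc : (k <= c)%N by have := ltn_ord k; lia.
have -> : (c.*2.+1 - k.*2 = (c - k).*2.+1)%N by lia.
have -> : (c.*2 - k.*2 = (c - k).*2)%N by lia.
have -> : c.+1 = (k + (c - k).+1)%N by lia.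
by rewrite geg_coef_half.
Qed.

Lemma geg_sum_int c f :
  geg_sum (- c.+1%:R) c.*2.+1 f
  = 2%:R *: geg_sum (- c.+1%:R + 1) c.*2 (fun k q => f k q.+1).
Proof.
rewrite /geg_sum scaler_sumr.
have -> : c.*2.+1./2 = c.*2./2 by lia.
apply: eq_bigr => k _; rewrite scalerA.
have kc : (k <= c)%N by have := ltn_ord k; lia.
have -> : (c.*2.+1 - k.*2 = (c - k).*2.+1)%N by lia.
have -> : (c.*2 - k.*2 = (c - k).*2)%N by lia.
have -> : c.+1 = (k + (c - k).+1)%N by lia.
by rewrite geg_coef_int.
Qed.

End GegenbauerSums.

(** * Exterior calculus over commuting derivations *)

Section FormCalculus.
Variables (R : realType).
Local Notation C := (complex R).
Variables (S : lmodType C) (T : Type) (D : T -> {linear S -> S}).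
Hypothesis DC : forall u v F, D u (D v F) = D v (D u F).
Implicit Types (W X : seq T -> S) (F G : S) (u v : T) (s r : seq T).

Lemma eq_opp_eq0 F : F = - F -> F = 0.
Proof.
move/eqP; rewrite -addr_eq0 -mulr2n -scaler_nat scaler_eq0 pnatr_eq0 /=.
by move/eqP.
Qed.

(** Translation invariant operators: these commute with [ed] and [cd], as they
    act on the values of a form. *)
Definition invariant_op (P : S -> S) :=
  linear P /\ forall v F, P (D v F) = D v (P F).

Lemma invariantD P F G : invariant_op P -> P (F + G) = P F + P G.
Proof. by move=> [lP _]; have := lP 1 F G; rewrite !scale1r. Qed.

Lemma invariant0 P : invariant_op P -> P 0 = 0.
Proof.
move=> iP; have /eqP := invariantD 0 0 iP.
by rewrite addr0 -subr_eq subrr eq_sym => /eqP.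
Qed.

Lemma invariantZ P c F : invariant_op P -> P (c *: F) = c *: P F.
Proof. by move=> iP; have [lP _] := iP; have := lP c F 0; rewrite !addr0 invariant0// addr0. Qed.

Lemma invariantN P F : invariant_op P -> P (- F) = - P F.
Proof. by move=> iP; rewrite -scaleN1r invariantZ// scaleN1r. Qed.

Lemma invariantB P F G : invariant_op P -> P (F - G) = P F - P G.
Proof. by move=> iP; rewrite invariantD// invariantN. Qed.

Lemma invariant_sum P m (F : 'I_m -> S) : invariant_op P ->
  P (\sum_(j < m) F j) = \sum_(j < m) P (F j).
Proof.
move=> iP; apply: (big_morph P) => [F' G|]; first exact: invariantD.
exact: invariant0.
Qed.

Lemma invariant_D v : invariant_op (D v).
Proof. by split=> [|u F]; [exact: linearP|rewrite DC]. Qed.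

Lemma invariant_iter k P : invariant_op P -> invariant_op (iter k P).
Proof.
move=> iP; elim: k => [|k [lk ck]]; first by split.
split=> [c F G|v F] /=; first by rewrite lk invariantD// invariantZ.
by rewrite ck; case: iP => _ ->.
Qed.

Lemma invariant_comp P Q : invariant_op P -> invariant_op Q -> invariant_op (P \o Q).
Proof.
move=> iP [lQ cQ]; split=> [c F G|v F] /=; first by rewrite lQ invariantD// invariantZ.
by rewrite cQ; case: iP => _ ->.
Qed.

Lemma invariant_sumP m (P : 'I_m -> S -> S) : (forall j, invariant_op (P j)) ->
  invariant_op (fun F => \sum_(j < m) P j F).
Proof.
move=> iP; split=> [c F G|v F].
  rewrite scaler_sumr -big_split; apply: eq_bigr => j _ /=.
  by rewrite invariantD// invariantZ.
by rewrite linear_sum; apply: eq_bigr => j _; case: (iP j) => _ ->.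
Qed.

Lemma invariant_scale c P : invariant_op P -> invariant_op (fun F => c *: P F).
Proof.
move=> [lP cP]; split=> [a F G|v F]; last by rewrite cP linearZ.
by rewrite lP scalerDr !scalerA mulrC.
Qed.

(** Exterior derivative of a form with constant arguments, by Cartan's formula
    [iota_v d = D_v - d iota_v]. *)
Fixpoint ed W s : S :=
  if s is v :: r then D v (W r) - ed (fun r' => W (v :: r')) r else 0.

Lemma edE W v r : ed W (v :: r) = D v (W r) - ed (fun r' => W (v :: r')) r.
Proof. by []. Qed.

Lemma ed_lin c W X s : ed (fun s => c *: W s + X s) s = c *: ed W s + ed X s.
Proof.
elim: s W X => [|v s IHs] W X /=; first by rewrite scaler0 addr0.
by rewrite IHs linearP scalerBr addrACA opprD.
Qed.

Lemma ed0 s : ed (fun=> 0) s = 0.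
Proof. by elim: s => [//|v s IHs] /=; rewrite IHs linear0 subr0. Qed.

Lemma edD W X s : ed (fun s => W s + X s) s = ed W s + ed X s.
Proof.
rewrite -[ed W s]scale1r -ed_lin; congr (ed _ s).
by apply/funext => r; rewrite scale1r.
Qed.

Lemma edZ c W s : ed (fun s => c *: W s) s = c *: ed W s.
Proof.
rewrite -[RHS]addr0 -(ed0 s) -ed_lin; congr (ed _ s).
by apply/funext => r; rewrite addr0.
Qed.

Lemma edN W s : ed (fun s => - W s) s = - ed W s.
Proof.
by rewrite -scaleN1r -edZ; congr (ed _ s); apply/funext => r; rewrite scaleN1r.
Qed.

Lemma edB W X s : ed (fun s => W s - X s) s = ed W s - ed X s.
Proof. by rewrite edD edN. Qed.

Lemma ed_sum m (W : 'I_m -> seq T -> S) s :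
  ed (fun s => \sum_(j < m) W j s) s = \sum_(j < m) ed (W j) s.
Proof.
elim: m W => [|m IHm] W.
  by rewrite big_ord0 -[RHS](ed0 s); congr (ed _ s); apply/funext => r; rewrite big_ord0.
rewrite big_ord_recr /= -IHm -edD; congr (ed _ s).
by apply/funext => r; rewrite big_ord_recr.
Qed.

Lemma ed_op P W s : invariant_op P -> ed (fun s => P (W s)) s = P (ed W s).
Proof.
move=> iP; elim: s W => [|v s IHs] W /=; first by rewrite invariant0.
by rewrite IHs invariantB//; case: iP => _ ->.
Qed.

Lemma ed_D v W s : ed (fun s => D v (W s)) s = D v (ed W s).
Proof. exact: (ed_op W s (invariant_D v)). Qed.

(** Induction on the number of arguments: [iota_v d d = D_v d - d (D_v - d iota_v)],
    and [d d iota_v = 0] by induction. *)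
Lemma ed_ed W s : ed (ed W) s = 0.
Proof.
elim: s W => [//|v s IHs] W; rewrite edE.
have -> : (fun r => ed W (v :: r))
    = (fun r => D v (W r) - ed (fun r' => W (v :: r')) r) by [].
by rewrite edB ed_D IHs subr0 subrr.
Qed.

Section Codifferential.
Variables (m : nat) (e : 'I_m -> T).

Definition cd W s : S := - \sum_(j < m) D (e j) (W (e j :: s)).
Definition lap F : S := \sum_(j < m) D (e j) (D (e j) F).

Lemma invariant_lap : invariant_op lap.
Proof.
by apply: invariant_sumP => j; apply: invariant_comp; apply: invariant_D.
Qed.

Lemma cd0 s : cd (fun=> 0) s = 0.
Proof. by rewrite /cd big1 ?oppr0// => j _; rewrite linear0. Qed.

Lemma cd_op P W s : invariant_op P -> cd (fun s => P (W s)) s = P (cd W s).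
Proof.
move=> iP; rewrite /cd (invariantN _ iP) (invariant_sum _ iP); congr (- _).
by apply: eq_bigr => j _; case: iP => _ ->.
Qed.

Lemma cdD W X s : cd (fun s => W s + X s) s = cd W s + cd X s.
Proof.
rewrite /cd -opprD -big_split; congr (- _).
by apply: eq_bigr => j _; rewrite linearD.
Qed.

Lemma cdZ c W s : cd (fun s => c *: W s) s = c *: cd W s.
Proof.
rewrite /cd scalerN scaler_sumr; congr (- _).
by apply: eq_bigr => j _; rewrite linearZ.
Qed.

Lemma cdN W s : cd (fun s => - W s) s = - cd W s.
Proof.
by rewrite -scaleN1r -cdZ; congr (cd _ s); apply/funext => r; rewrite scaleN1r.
Qed.

Lemma cdB W X s : cd (fun s => W s - X s) s = cd W s - cd X s.
Proof. by rewrite cdD cdN. Qed.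

(** Hodge: [d^* d + d d^* = - Laplacian]. *)
Lemma cd_ed W s : cd (ed W) s = - lap (W s) - ed (cd W) s.
Proof.
rewrite /cd edN ed_sum opprK /lap -!sumrN -big_split.
by apply: eq_bigr => j _ /=; rewrite linearB ed_D opprB addrC.
Qed.

Lemma ed_cd W s : ed (cd W) s = - lap (W s) - cd (ed W) s.
Proof. by rewrite cd_ed opprB addrCA subrr addr0. Qed.

End Codifferential.

Definition antisym W :=
  forall s r u v, W (s ++ u :: v :: r) = - W (s ++ v :: u :: r).

Lemma antisym_dup W v r : antisym W -> W (v :: v :: r) = 0.
Proof. by move=> aW; apply: eq_opp_eq0; apply: (aW [::]). Qed.

Lemma antisym_ct v W : antisym W -> antisym (fun s => W (v :: s)).
Proof. by move=> aW s r u w; rewrite -!cat_cons aW. Qed.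

Lemma antisym_cd m (e : 'I_m -> T) W : antisym W -> antisym (cd e W).
Proof.
move=> aW s r u v; rewrite /cd; congr (- _); rewrite -sumrN.
by apply: eq_bigr => j _; rewrite -!cat_cons aW linearN.
Qed.

(** The derivatives are symmetric in the two indices, the form is antisymmetric. *)
Lemma cd_cd m (e : 'I_m -> T) W s : antisym W -> cd e (cd e W) s = 0.
Proof.
move=> aW.
have -> : cd e (cd e W) s = \sum_j \sum_k D (e j) (D (e k) (W (e k :: e j :: s))).
  rewrite /cd -sumrN; apply: eq_bigr => j _.
  by rewrite linearN opprK linear_sum.
apply: eq_opp_eq0; rewrite [LHS]exchange_big -sumrN; apply: eq_bigr => j _ /=.
by rewrite -sumrN; apply: eq_bigr => k _; rewrite DC (aW [::]) !linearN.
Qed.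

Lemma cd_ct m (e : 'I_m -> T) v W s : antisym W ->
  cd e (fun s => W (v :: s)) s = - cd e W (v :: s).
Proof.
move=> aW; rewrite /cd; congr (- _); rewrite -sumrN.
by apply: eq_bigr => j _; rewrite (aW [::]) linearN.
Qed.

End FormCalculus.

(** * Composition identities *)

Section SymmetryBreaking.
Variables (R : realType).
Local Notation C := (complex R).
Variables (S : lmodType C) (T : Type) (D : T -> {linear S -> S}).
Hypothesis DC : forall u v F, D u (D v F) = D v (D u F).
Variables (m N : nat) (e : 'I_m -> T) (nu : T) (eb : 'I_N -> T).
Hypothesis sum_basis : forall f : T -> S,
  \sum_(j < N) f (eb j) = \sum_(j < m) f (e j) + f nu.
Implicit Types (W X : seq T -> S) (F G : S) (u v : T) (s r : seq T) (mu kappa : C).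

Local Notation lapt := (lap D e).
Local Notation d := (ed D).
Local Notation cdt := (cd D e).
Local Notation cdb := (cd D eb).
Local Notation iota W := (fun s => W (nu :: s)).

Lemma lap_basis F : lap D eb F = lapt F + D nu (D nu F).
Proof. exact: (sum_basis (fun v => D v (D v F))). Qed.

Lemma cd_basis W s : cdb W s = cdt W s - D nu (W (nu :: s)).
Proof. by rewrite /cd (sum_basis (fun v => D v (W (v :: s)))) opprD. Qed.

(** The Gegenbauer polynomial [D^mu_l] in the tangential Laplacian and the
    normal derivative, zero for negative [l]. *)
Definition geg mu (l : int) F : S :=
  if l is Posz p then geg_sum mu p (fun k q => iter k lapt (iter q (D nu) F)) else 0.

Local Arguments geg : simpl never.

Lemma invariant_geg mu l : invariant_op D (geg mu l).
Proof.
case: l => [p|p]; last first.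
  by split=> [c F G|v F]; rewrite /geg ?scaler0 ?addr0 ?linear0.
apply: invariant_sumP => k; apply: invariant_scale.
apply: invariant_comp; apply: invariant_iter; last exact: invariant_D.
exact: invariant_lap.
Qed.

Lemma iter_Dnu k F : iter k (D nu) (D nu F) = iter k.+1 (D nu) F.
Proof. by rewrite -iterSr. Qed.

Lemma geg_Dnu mu (p : nat) F :
  geg mu p (D nu F) = geg_sum mu p (fun k q => iter k lapt (iter q.+1 (D nu) F)).
Proof. by apply: eq_bigr => k _; rewrite iter_Dnu. Qed.

Lemma geg_lap mu (p : nat) F :
  geg mu p (lapt F) = geg_sum mu p (fun k q => iter k.+1 lapt (iter q (D nu) F)).
Proof.
apply: eq_bigr => k _; rewrite iterSr; congr (_ *: iter k _ _).
elim: (p - k.*2)%N => // q /= ->.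
by case: (invariant_lap DC e) => _ ->.
Qed.

Lemma geg0 mu F : geg mu 0 F = F.
Proof. exact: geg_sum0. Qed.

Lemma geg_1B1 mu F : geg mu (1%:Z - 1) F = F.
Proof. exact: geg0. Qed.

Lemma geg_1B2 mu F : geg mu (1%:Z - 2) F = 0.
Proof. by []. Qed.

Lemma geg1 mu F : geg mu 1 F = 2%:R *: D nu F.
Proof. exact: geg_sum1. Qed.

Lemma gegD mu l F G : geg mu l (F + G) = geg mu l F + geg mu l G.
Proof. exact: (invariantD _ _ (invariant_geg mu l)). Qed.
Lemma gegN mu l F : geg mu l (- F) = - geg mu l F.
Proof. exact: (invariantN _ (invariant_geg mu l)). Qed.
Lemma gegB mu l F G : geg mu l (F - G) = geg mu l F - geg mu l G.
Proof. exact: (invariantB _ _ (invariant_geg mu l)). Qed.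
Lemma gegZ mu l c F : geg mu l (c *: F) = c *: geg mu l F.
Proof. exact: (invariantZ _ _ (invariant_geg mu l)). Qed.
Lemma gegF0 mu l : geg mu l 0 = 0.
Proof. exact: (invariant0 (invariant_geg mu l)). Qed.
Lemma ed_geg mu l W s : d (fun s => geg mu l (W s)) s = geg mu l (d W s).
Proof. exact: (ed_op W s (invariant_geg mu l)). Qed.
Lemma cdt_geg mu l W s : cdt (fun s => geg mu l (W s)) s = geg mu l (cdt W s).
Proof. exact: (cd_op e W s (invariant_geg mu l)). Qed.

(** Both relations hold for [a = 1] as well since [geg _ (- 1) = 0]. *)
Lemma geg_tangential mu (a : nat) F : (0 < a)%N ->
  geg (mu + 1) (a%:Z - 2) (lapt F) + gamma mu a *: geg (mu + 1) (a%:Z - 1) (D nu F)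
  = (a%:R / 2%:R) *: geg mu a F.
Proof.
case: a => [//|[|p]] _.
  rewrite geg_1B1 geg_1B2 /gamma /= add0r scale1r geg1 scalerA mul1r.
  by rewrite mulVf ?pnatr_eq0// scale1r.
have -> : p.+2%:Z - 2 = p by lia.
have -> : p.+2%:Z - 1 = p.+1 by lia.
by rewrite geg_lap geg_Dnu -geg_sum_tangential.
Qed.

Lemma geg_full mu (a : nat) F : (0 < a)%N ->
  geg (mu + 1) (a%:Z - 2) (lap D eb F)
    + gamma (mu - 1 / 2%:R) a *: geg mu (a%:Z - 1) (D nu F)
  = (a%:R / 2%:R) *: geg mu a F.
Proof.
case: a => [//|[|p]] _.
  rewrite geg_1B1 geg_1B2 /gamma /= add0r scale1r geg1 scalerA mul1r.
  by rewrite mulVf ?pnatr_eq0// scale1r.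
have -> : p.+2%:Z - 2 = p by lia.
have -> : p.+2%:Z - 1 = p.+1 by lia.
rewrite lap_basis gegD geg_lap !geg_Dnu -geg_sum_full; congr (_ + _ + _).
by apply: eq_bigr => k _; rewrite -iterSr.
Qed.

(** The operators before restriction to the hyperplane.  The coefficient of the
    last term is left free as [kappa]: most identities single out a value of it. *)
Definition op_down mu kappa (a : nat) W s : S :=
  - geg (mu + 1) (a%:Z - 2) (d (cdb (iota W)) s)
  - gamma mu a *: geg (mu + 1) (a%:Z - 1) (cdb W s)
  + kappa *: geg mu a (W (nu :: s)).

Definition op_same mu kappa (a : nat) W s : S :=
  geg (mu + 1) (a%:Z - 2) (d (cdb W) s)
  - gamma (mu - 1 / 2%:R) a *: geg mu (a%:Z - 1) (d (iota W) s)
  + kappa *: geg mu a (W s).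

Lemma op_down1 mu kappa W s :
  op_down mu kappa 1 W s = - cdb W s + (2%:R * kappa) *: D nu (W (nu :: s)).
Proof.
rewrite /op_down geg_1B1 geg_1B2 /gamma /= oppr0 add0r scale1r geg1 scalerA.
by rewrite [kappa * _]mulrC.
Qed.

Lemma op_same1 mu kappa W s :
  op_same mu kappa 1 W s = - d (iota W) s + (2%:R * kappa) *: D nu (W s).
Proof.
rewrite /op_same geg_1B1 geg_1B2 /gamma /= add0r scale1r geg1 scalerA.
by rewrite [kappa * _]mulrC.
Qed.

Lemma iota_ed W s : d W (nu :: s) = D nu (W s) - d (iota W) s.
Proof. by []. Qed.

Lemma ed_iota_ed W s : d (iota (d W)) s = D nu (d W s).
Proof. by have := iota_ed (d W) s; rewrite ed_ed// => /esym/eqP; rewrite subr_eq0 => /eqP. Qed.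

(** With [a = 2 c + 2], this [mu] makes the factor [gamma (mu - 1/2) a] of
    [geg_full] vanish and is at the same time the value of [geg_sum_half]; the
    three terms then are multiples of [geg (mu + 1) (a - 2)]. *)
Lemma op_down_ed c W s :
  op_down (1 / 2%:R - c.+1%:R) (- c.+1%:R) c.*2.+2 (d W) s = 0.
Proof.
rewrite /op_down; set mu : C := 1 / 2%:R - c.+1%:R.
have gam0 : gamma (mu - 1 / 2%:R) c.*2.+2 = 0.
  by rewrite /gamma /= odd_double /= /mu -[c.*2.+2]/(c.+1.*2) -mul2n natrM; field.
have gam : gamma mu c.*2.+2 = 1 / 2%:R.
  by rewrite /gamma /= odd_double /= /mu -[c.*2.+2]/(c.+1.*2) -mul2n natrM; field.
have half : (c.*2.+2%:R / 2%:R : C) = c.+1%:R.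
  by rewrite -[c.*2.+2]/(c.+1.*2) -mul2n natrM; field.
rewrite ed_cd// (_ : ed D (iota (d W)) = fun r => D nu (d W r)); last first.
  by apply/funext => r; rewrite ed_iota_ed.
rewrite (cd_op eb _ s (invariant_D DC nu)).
rewrite gegB gegN gam scaleNr.
have := geg_full mu (d W (nu :: s)) (isT : (0 < c.*2.+2)%N).
rewrite gam0 scale0r addr0 half => <-.
have -> : geg (mu + 1) (c.*2.+2%:Z - 1) (cdb (d W) s)
    = 2%:R *: geg (mu + 1) (c.*2.+2%:Z - 2) (D nu (cdb (d W) s)).
  have -> : c.*2.+2%:Z - 1 = c.*2.+1 by lia.
  have -> : c.*2.+2%:Z - 2 = c.*2 by lia.
  rewrite geg_Dnu (_ : mu + 1 = 3%:R / 2%:R - c.+1%:R); last by rewrite /mu; field.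
  exact: geg_sum_half.
rewrite scalerA divrK ?unitfE ?pnatr_eq0// scale1r opprB opprK.
by rewrite addrAC addrK subrr.
Qed.

(** On closed forms [d cdb] is minus the Laplacian of [R^n] and [d iota] is [N],
    so that this is [geg_full]. *)
Lemma op_same_ed mu a W s : (0 < a)%N -> op_same mu (a%:R / 2%:R) a (d W) s = 0.
Proof.
move=> a0; rewrite /op_same ed_iota_ed -geg_full// ed_cd//.
rewrite (_ : ed D (d W) = fun=> 0); last by apply/funext => r; rewrite ed_ed.
by rewrite cd0 subr0 gegN -opprD addNr.
Qed.

Lemma op_same_cd mu a W s : antisym W -> gamma (mu - 1 / 2%:R) a = 0 ->
  op_same mu 0 a (cdb W) s = 0.
Proof.
move=> aW g0; rewrite /op_same g0 !scale0r subr0 addr0.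
rewrite (_ : cd D eb (cdb W) = fun=> 0); first by rewrite ed0 gegF0.
by apply/funext => r; rewrite cd_cd.
Qed.

Lemma op_down_cd mu a W s : antisym W -> op_down mu 0 a (cdb W) s = 0.
Proof.
move=> aW; rewrite /op_down scale0r addr0 cd_cd// gegF0 scaler0 subr0.
rewrite (_ : cd D eb (iota (cdb W)) = fun=> 0); first by rewrite ed0 gegF0 oppr0.
apply/funext => r; rewrite (cd_ct D eb nu r (antisym_cd D eb aW)) cd_cd//.
by rewrite oppr0.
Qed.

(** [d] kills the first summand, which is exact up to an invariant operator. *)
Lemma ed_op_down mu kappa a W s : d (op_down mu kappa a W) s
  = - gamma mu a *: geg (mu + 1) (a%:Z - 1) (d (cdb W) s)
    + kappa *: geg mu a (d (iota W) s).
Proof.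
rewrite /op_down edD edB edN !edZ !ed_geg ed_ed// gegF0 oppr0 sub0r scaleNr.
by [].
Qed.

Lemma ed_op_same mu kappa a W s :
  d (op_same mu kappa a W) s = kappa *: geg mu a (d W s).
Proof.
rewrite /op_same edD edB !edZ !ed_geg !ed_ed// !gegF0 scaler0 subrr add0r.
by [].
Qed.

Lemma cdt_cdb W s : antisym W -> cdt (cdb W) s = - D nu (cdt (iota W) s).
Proof.
move=> aW; rewrite (_ : cdb W = fun r => cdt W r - D nu (W (nu :: r))); last first.
  by apply/funext => r; rewrite cd_basis.
by rewrite cdB cd_cd// sub0r (cd_op e (iota W) s (invariant_D DC nu)).
Qed.

Lemma cdt_ed_cdt W s : antisym W -> cdt (d (cdt W)) s = - lapt (cdt W s).
Proof.
move=> aW; rewrite cd_ed// (_ : cdt (cdt W) = fun=> 0) ?ed0 ?subr0//.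
by apply/funext => r; rewrite cd_cd.
Qed.

Lemma cdb_iota W s : antisym W -> cdb (iota W) s = cdt (iota W) s.
Proof. by move=> aW; rewrite cd_basis antisym_dup// linear0 subr0. Qed.

(** In tangential terms [cdt d cdt = - L cdt] and [cdt cdb = - N cdt iota], so
    that this is [geg_tangential]. *)
Lemma cdt_op_down mu a W s : antisym W -> (0 < a)%N ->
  cdt (op_down mu (- (a%:R / 2%:R)) a W) s = 0.
Proof.
move=> aW a0; rewrite /op_down cdD cdB cdN !cdZ !cdt_geg.
rewrite (_ : cdb (iota W) = cdt (iota W)); last first.
  by apply/funext => r; rewrite cdb_iota.
rewrite (cdt_ed_cdt s (antisym_ct nu aW)) cdt_cdb//.
rewrite [geg _ _ (- lapt _)]gegN [geg _ _ (- D nu _)]gegN scaleNr -geg_tangential//.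
by rewrite opprK scalerN opprK subrr.
Qed.

(** With [a = 2 c + 2] and [mu = - a / 2] the factor [gamma mu a] of
    [geg_tangential] vanishes and [geg_sum_int] applies to the middle term, whose
    normal derivative cancels the one in [cdb = cdt - N iota]. *)
Lemma cdt_op_same c W s : antisym W ->
  cdt (op_same (- c.+1%:R) c.+1%:R c.*2.+2 W) s = 0.
Proof.
move=> aW; set mu : C := - c.+1%:R.
have gam0 : gamma mu c.*2.+2 = 0.
  by rewrite /gamma /= odd_double /= /mu -[c.*2.+2]/(c.+1.*2) -mul2n natrM; field.
have gam : gamma (mu - 1 / 2%:R) c.*2.+2 = - (1 / 2%:R).
  by rewrite /gamma /= odd_double /= /mu -[c.*2.+2]/(c.+1.*2) -mul2n natrM; field.
have half : (c.*2.+2%:R / 2%:R : C) = c.+1%:R.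
  by rewrite -[c.*2.+2]/(c.+1.*2) -mul2n natrM; field.
rewrite /op_same cdD cdB !cdZ !cdt_geg gam -half.
rewrite -(geg_tangential mu (cdt W s) (isT : (0 < c.*2.+2)%N)) gam0 scale0r addr0.
have -> : geg mu (c.*2.+2%:Z - 1) (cdt (d (iota W)) s)
    = 2%:R *: geg (mu + 1) (c.*2.+2%:Z - 2) (D nu (cdt (d (iota W)) s)).
  have -> : c.*2.+2%:Z - 1 = c.*2.+1 by lia.
  have -> : c.*2.+2%:Z - 2 = c.*2 by lia.
  rewrite geg_Dnu; exact: geg_sum_int.
rewrite scaleNr opprK scalerA divrK ?unitfE ?pnatr_eq0// scale1r -!gegD.
rewrite (_ : cdb W = fun r => cdt W r - D nu (W (nu :: r))); last first.
  by apply/funext => r; rewrite cd_basis.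
rewrite (_ : ed D _ = fun r => d (cdt W) r - D nu (d (iota W) r)); last first.
  by apply/funext => r; rewrite edB ed_D.
rewrite cdB (cd_op e (d (iota W)) s (invariant_D DC nu)) subrK.
by rewrite cdt_ed_cdt// addNr gegF0.
Qed.

Lemma cdt_iota mu l W s : antisym W ->
  cdt (fun r => geg mu l (W (nu :: r))) s = - geg mu l (cdb W (nu :: s)).
Proof.
move=> aW; rewrite (cdt_geg mu l (iota W)) cd_ct// gegN cd_basis antisym_dup//.
by rewrite linear0 subr0.
Qed.

End SymmetryBreaking.

(** * Values on decomposable forms *)

Section TestForms.
Variables (R : realType).
Local Notation C := (complex R).
Variables (S : lmodType C) (T : Type) (D : T -> {linear S -> S}).
Hypothesis DC : forall u v F, D u (D v F) = D v (D u F).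
Variables (m N : nat) (e : 'I_m -> T) (nu : T) (eb : 'I_N -> T).
Hypothesis sum_basis : forall f : T -> S,
  \sum_(j < N) f (eb j) = \sum_(j < m) f (e j) + f nu.
Implicit Types (W X : seq T -> S) (F G : S) (u v : T) (s r : seq T) (mu kappa : C)
  (phi : seq T -> C) (a b : nat) (o : bool).

Local Notation lapt := (lap D e).
Local Notation lapb := (lap D eb).
Local Notation d := (ed D).
Local Notation cdt := (cd D e).
Local Notation cdb := (cd D eb).
Local Notation geg := (geg D e nu).
Local Notation op_down := (op_down D e nu eb).
Local Notation op_same := (op_same D e nu eb).

Definition tens phi F s : S := phi s *: F.

Variable t : 'I_m.
Local Notation et := (e t).

Definition depends_on_t F := forall j, j != t -> D (e j) F = 0.

Lemma ed_tens_cons phi F v r :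
  d (tens phi F) (v :: r) = phi r *: D v F - d (tens (fun r => phi (v :: r)) F) r.
Proof. by rewrite edE /tens linearZ. Qed.

Lemma tens_eq0 phi F : (forall r, phi r = 0) -> tens phi F = fun=> 0.
Proof. by move=> phi0; apply/funext => r; rewrite /tens phi0 scale0r. Qed.

Lemma ed_tens_tail phi F v r : (forall r, phi (v :: r) = 0) ->
  d (tens phi F) (v :: r) = phi r *: D v F.
Proof. by move=> phi0; rewrite ed_tens_cons tens_eq0// ed0 subr0. Qed.

Lemma cdt_tens phi F r : depends_on_t F ->
  cdt (tens phi F) r = - (phi (et :: r) *: D et F).
Proof.
move=> tF; rewrite /cd (bigD1 t)//= big1 ?addr0 /tens ?linearZ// => j jt.
by rewrite linearZ/= tF// scaler0.
Qed.

Lemma cdb_tens phi F r : depends_on_t F ->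
  cdb (tens phi F) r = - (phi (et :: r) *: D et F) - phi (nu :: r) *: D nu F.
Proof.
move=> tF; rewrite (cd_basis D sum_basis) cdt_tens//.
by rewrite [tens _ _ _]/tens [D nu (_ *: _)]linearZ.
Qed.

Lemma lapt_t F : depends_on_t F -> lapt F = D et (D et F).
Proof.
by move=> tF; rewrite /lap (bigD1 t)//= big1 ?addr0// => j jt; rewrite tF// linear0.
Qed.

Lemma depends_on_tD F v : depends_on_t F -> depends_on_t (D v F).
Proof. by move=> tF j jt; rewrite DC tF// linear0. Qed.

Lemma test_ed_nu phi F s : (forall r, phi (nu :: r) = 0) -> phi s = 1 ->
  d (tens phi F) (nu :: s) = D nu F.
Proof. by move=> phi_nu phi_s; rewrite ed_tens_tail// phi_s scale1r. Qed.

Section NoNormalNoTangential.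
Variables (phi : seq T -> C) (F : S) (s : seq T).
Hypotheses (tF : depends_on_t F) (phi_nu : forall r, phi (nu :: r) = 0)
  (phi_t : forall r, phi (et :: r) = 0) (phi_s : phi s = 1).

Lemma test_ed_t : d (tens phi F) (et :: s) = D et F.
Proof. by rewrite ed_tens_tail// phi_s scale1r. Qed.

(** With neither [dx_n] nor [dx_t] in [phi] the form [phi F] is coclosed, so that
    [cdb d] acts as minus the Laplacian on [F]. *)
Lemma test_down_ed mu kappa a : op_down mu kappa a (d (tens phi F)) s
  = gamma mu a *: geg (mu + 1) (a%:Z - 1) (lapb F) + kappa *: geg mu a (D nu F).
Proof.
rewrite /op_down test_ed_nu//; congr (_ + _).
have cdb0 G : depends_on_t G -> cd D eb (tens phi G) = fun=> 0.
  by move=> tG; apply/funext => r; rewrite cdb_tens// phi_t phi_nu !scale0r subr0 oppr0.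
rewrite (_ : (fun r => d (tens phi F) (nu :: r)) = tens phi (D nu F)); last first.
  by apply/funext => r; rewrite ed_tens_tail.
rewrite (cdb0 (D nu F)); last exact: depends_on_tD.
rewrite ed0 (gegF0 DC) oppr0 sub0r (cd_ed DC) cdb0// ed0 subr0 /tens phi_s scale1r.
by rewrite (gegN DC) scalerN opprK.
Qed.

End NoNormalNoTangential.

Section Antisymmetric.
Variable phi : seq T -> C.
Hypothesis aphi : forall s r u v, phi (s ++ u :: v :: r) = - phi (s ++ v :: u :: r).

Let dup r1 v r : phi (r1 ++ v :: v :: r) = 0.
Proof.
have /eqP := aphi r1 r v v.
by rewrite -addr_eq0 -mulr2n -mulr_natl mulf_eq0 pnatr_eq0 /= => /eqP.
Qed.

Lemma antisym_tens F : antisym (tens phi F).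
Proof. by move=> s r u v; rewrite /tens aphi scaleNr. Qed.

Section NormalAndTangential.
Variables (F : S) (s : seq T).
Hypotheses (tF : depends_on_t F) (phi_s : phi (nu :: et :: s) = 1).

Lemma test_cdb_nu : cdb (tens phi F) (nu :: s) = D et F.
Proof.
rewrite cdb_tens// (dup [::]) scale0r subr0 (aphi [::]) phi_s.
by rewrite scaleN1r opprK.
Qed.

Lemma test_cdb : cdb (tens phi F) (et :: s) = - D nu F.
Proof. by rewrite cdb_tens// (dup [::]) scale0r phi_s scale1r oppr0 add0r. Qed.

(** [cdb (phi F)] is coclosed, and the component of [d iota cdb (phi F)] at
    [e t :: s] is a second derivative of [F]. *)
Lemma test_same_cd mu kappa a : op_same mu kappa a (cdb (tens phi F)) (et :: s)
  = - (gamma (mu - 1 / 2%:R) a *: geg mu (a%:Z - 1) (D et (D et F))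
       + kappa *: geg mu a (D nu F)).
Proof.
rewrite /op_same test_cdb [geg _ _ (- D nu F)](gegN DC) scalerN [RHS]opprD.
congr (_ - _).
rewrite (_ : cd D eb (cdb (tens phi F)) = fun=> 0); last first.
  by apply/funext => r; rewrite (cd_cd DC)//; apply: antisym_tens.
rewrite ed0 (gegF0 DC) sub0r.
rewrite (_ : (fun r => cdb (tens phi F) (nu :: r))
   = tens (fun r => phi (nu :: et :: r)) (D et F)); last first.
  apply/funext => r.
  by rewrite cdb_tens// (dup [::]) scale0r subr0 (aphi [::]) scaleNr opprK.
by rewrite ed_tens_tail ?phi_s ?scale1r// => r; apply: (dup [:: nu]).
Qed.

End NormalAndTangential.

Section NormalNoTangential.
Variables (F : S) (s : seq T).
Hypotheses (tF : depends_on_t F) (phi_s : phi (nu :: s) = 1)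
  (phi_t : forall r, phi (et :: r) = 0).

Let phi_nut r : phi (nu :: et :: r) = 0.
Proof. by rewrite (aphi [::]) phi_t oppr0. Qed.

Lemma test_cdb_normal : cdb (tens phi F) s = - D nu F.
Proof. by rewrite cdb_tens// phi_t scale0r oppr0 sub0r phi_s scale1r. Qed.

Lemma test_ed_iota : d (fun r => tens phi F (nu :: r)) (et :: s) = D et F.
Proof.
by have := @ed_tens_tail (fun r => phi (nu :: r)) F et s phi_nut => ->; rewrite phi_s scale1r.
Qed.

Hypothesis nuF : D nu F = 0.

Let cdb0 : cd D eb (tens phi F) = fun=> 0.
Proof.
apply/funext => r; rewrite cdb_tens// phi_t nuF scaler0 scale0r.
by rewrite subr0 oppr0.
Qed.

(** Here [phi F] is coclosed for [R^n], so that only the [kappa] term of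
    [op_down] survives after [d]. *)
Lemma test_ed_down mu kappa a :
  d (op_down mu kappa a (tens phi F)) (et :: s) = kappa *: geg mu a (D et F).
Proof.
by rewrite (ed_op_down DC) cdb0 ed0 (gegF0 DC) scaler0 add0r test_ed_iota.
Qed.

Lemma test_cdt_same_normal mu kappa a :
  cdt (op_same mu kappa a (tens phi F)) s
  = gamma (mu - 1 / 2%:R) a *: geg mu (a%:Z - 1) (lapt F).
Proof.
rewrite /op_same cdD cdB !cdZ !(cdt_geg DC) cdb0.
rewrite (_ : ed D (fun=> 0) = fun=> 0); last by apply/funext => r; rewrite ed0.
rewrite cd0 (gegF0 DC) sub0r.
rewrite cdt_tens// phi_t scale0r oppr0 (gegF0 DC) scaler0 addr0.
rewrite (cd_ed DC) (_ : cd D e _ = fun=> 0); last first.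
  apply/funext => r.
  have -> : (fun s0 => tens phi F (nu :: s0)) = tens (fun r => phi (nu :: r)) F by [].
  by rewrite cdt_tens// phi_nut scale0r oppr0.
by rewrite ed0 subr0 /tens phi_s scale1r (gegN DC) scalerN opprK.
Qed.

End NormalNoTangential.

Section TangentialNoNormal.
Variables (F : S) (s : seq T).
Hypotheses (tF : depends_on_t F) (phi_nu : forall r, phi (nu :: r) = 0)
  (phi_s : phi (et :: s) = 1).

Let iota0 : (fun r => tens phi F (nu :: r)) = fun=> 0.
Proof. by apply/funext => r; rewrite /tens phi_nu scale0r. Qed.

Lemma test_cdt : cdt (tens phi F) s = - D et F.
Proof. by rewrite cdt_tens// phi_s scale1r. Qed.

Let cdbE : cd D eb (tens phi F) = tens (fun r => - phi (et :: r)) (D et F).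
Proof.
apply/funext => r; rewrite cdb_tens// phi_nu scale0r subr0.
by rewrite /tens scaleNr.
Qed.

Lemma test_ed_down_odd mu kappa a : d (op_down mu kappa a (tens phi F)) (et :: s)
  = gamma mu a *: geg (mu + 1) (a%:Z - 1) (D et (D et F)).
Proof.
rewrite (ed_op_down DC) iota0 ed0 (gegF0 DC) scaler0 addr0 cdbE.
rewrite ed_tens_tail ?phi_s; last by move=> r; rewrite (dup [::]) oppr0.
by rewrite scaleN1r (gegN DC) scalerN scaleNr opprK.
Qed.

(** Without [dx_n] in [phi] the two codifferentials agree on [phi F], and
    [cdt d cdt = - L cdt]. *)
Lemma test_cdt_same mu kappa a : cdt (op_same mu kappa a (tens phi F)) s
  = geg (mu + 1) (a%:Z - 2) (lapt (D et F)) - kappa *: geg mu a (D et F).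
Proof.
rewrite /op_same cdD cdB !cdZ !(cdt_geg DC) iota0.
have -> : ed D (fun=> 0) = fun=> 0 by apply/funext => r; rewrite ed0.
rewrite cd0 [geg mu (a%:Z - 1) 0](gegF0 DC) scaler0 subr0.
have -> : cd D eb (tens phi F) = cd D e (tens phi F).
  by apply/funext => r; rewrite cdbE cdt_tens// /tens scaleNr.
rewrite (cdt_ed_cdt DC); last exact: antisym_tens.
rewrite test_cdt; case: (invariant_lap DC e) => li _.
by rewrite (invariantN _ (invariant_lap DC e)) opprK (gegN DC) scalerN.
Qed.

End TangentialNoNormal.

End Antisymmetric.

End TestForms.

(** * Jets *)

Section Jets.
Variables (R : realType).
Local Notation C := (complex R).
Variables (S : lmodType C) (T : Type) (D : T -> {linear S -> S}).
Hypothesis DC : forall u v F, D u (D v F) = D v (D u F).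
Variables (m N : nat) (e : 'I_m -> T) (nu : T) (eb : 'I_N -> T).
Implicit Types (W X : seq T -> S) (F G : S) (u v : T) (s r L : seq T) (mu kappa : C)
  (k p q a b : nat) (o : bool).

Local Notation lapt := (lap D e).
Local Notation geg := (geg D e nu).

(** Evaluation at the base point. *)
Variable E : S -> C.
Hypotheses (E_D : forall F G, E (F + G) = E F + E G)
  (E_Z : forall c F, E (c *: F) = c * E F).

(** Equality of all iterated derivatives up to order [k]: an operator of order
    [a] lowers the order of the jets that it compares by [a]. *)
Definition jet_eq k F G := forall L, (size L <= k)%N ->
  E (foldr (fun v H => D v H) F L) = E (foldr (fun v H => D v H) G L).

Let foldrD L F G : foldr (fun v H => D v H) (F + G) L
  = foldr (fun v H => D v H) F L + foldr (fun v H => D v H) G L.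
Proof. by elim: L => //= v L ->; rewrite linearD. Qed.

Let foldrZ L c F : foldr (fun v H => D v H) (c *: F) L
  = c *: foldr (fun v H => D v H) F L.
Proof. by elim: L => //= v L ->; rewrite linearZ. Qed.

Lemma jet_refl k F : jet_eq k F F. Proof. by []. Qed.

Lemma jet_eqW k l F G : (k <= l)%N -> jet_eq l F G -> jet_eq k F G.
Proof. by move=> kl FG L Lk; apply: FG; apply: leq_trans kl. Qed.

Lemma jet_eq0 F G : jet_eq 0 F G -> E F = E G.
Proof. by move=> /(_ [::] isT). Qed.

Lemma jet_D k v F G : jet_eq k.+1 F G -> jet_eq k (D v F) (D v G).
Proof.
by move=> FG L Lk; have := FG (rcons L v); rewrite !foldr_rcons size_rcons; apply.
Qed.

Lemma jet_add k F G F' G' : jet_eq k F F' -> jet_eq k G G' -> jet_eq k (F + G) (F' + G').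
Proof. by move=> FF GG L Lk; rewrite !foldrD !E_D FF// GG. Qed.

Lemma jet_scale k c F G : jet_eq k F G -> jet_eq k (c *: F) (c *: G).
Proof. by move=> FG L Lk; rewrite !foldrZ !E_Z FG. Qed.

Lemma jet_opp k F G : jet_eq k F G -> jet_eq k (- F) (- G).
Proof. by move=> FG; rewrite -[- F]scaleN1r -[- G]scaleN1r; apply: jet_scale. Qed.

Lemma jet_sub k F G F' G' : jet_eq k F F' -> jet_eq k G G' -> jet_eq k (F - G) (F' - G').
Proof. by move=> FF GG; apply: jet_add => //; apply: jet_opp. Qed.

Lemma jet_sum k l (F G : 'I_l -> S) : (forall j, jet_eq k (F j) (G j)) ->
  jet_eq k (\sum_(j < l) F j) (\sum_(j < l) G j).
Proof.
move=> FG; elim/big_rec2: _ => [|j x y _ xy]; first exact: jet_refl.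
exact: jet_add.
Qed.

Definition jets_eq k W X := forall s, jet_eq k (W s) (X s).

Lemma jets_ed k W X : jets_eq k.+1 W X -> jets_eq k (ed D W) (ed D X).
Proof.
move=> WX s; elim: s W X WX => [|v s IHs] W X WX; first exact: jet_refl.
rewrite !edE; apply: jet_sub; first exact: jet_D.
by apply: IHs => r; apply: WX.
Qed.

Lemma jets_cd k l (f : 'I_l -> T) W X :
  jets_eq k.+1 W X -> jets_eq k (cd D f W) (cd D f X).
Proof.
by move=> WX s; apply: jet_opp; apply: jet_sum => j; apply: jet_D; apply: WX.
Qed.

Lemma jet_iterD k q v F G :
  jet_eq (q + k) F G -> jet_eq k (iter q (D v) F) (iter q (D v) G).
Proof.
elim: q k => [//|q IHq] k FG /=; apply: jet_D; apply: IHq.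
by rewrite addnS -addSn.
Qed.

Lemma jet_iter_lap k q F G :
  jet_eq (q.*2 + k) F G -> jet_eq k (iter q lapt F) (iter q lapt G).
Proof.
elim: q k => [//|q IHq] k FG; rewrite !iterS; apply: jet_sum => j.
by do 2!apply: jet_D; apply: IHq; rewrite !addnS -!addSn -doubleS.
Qed.

Lemma jet_geg k mu p F G : jet_eq (p + k) F G -> jet_eq k (geg mu p F) (geg mu p G).
Proof.
move=> FG; apply: jet_sum => j; apply: jet_scale; apply: jet_iter_lap.
by apply: jet_iterD; apply: jet_eqW FG; have := ltn_ord j; lia.
Qed.

Lemma jet_geg_pred k mu a F G : (0 < a)%N ->
  jet_eq (a.-1 + k) F G -> jet_eq k (geg mu (a%:Z - 1) F) (geg mu (a%:Z - 1) G).
Proof.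
case: a => // a _; have -> : a.+1%:Z - 1 = a by lia.
exact: jet_geg.
Qed.

Lemma jet_geg_pred2 k mu a F G : (0 < a)%N ->
  jet_eq (a.-2 + k) F G -> jet_eq k (geg mu (a%:Z - 2) F) (geg mu (a%:Z - 2) G).
Proof.
case: a => [//|[_ _|a _]]; first by rewrite !geg_1B2; apply: jet_refl.
have -> : a.+2%:Z - 2 = a by lia.
exact: jet_geg.
Qed.

(** For [a = 1] the first summand is zero, which is why the order is [a] and not
    at least 2. *)
Lemma jets_op_down k mu kappa a W X : (0 < a)%N -> jets_eq (a + k) W X ->
  jets_eq k (op_down D e nu eb mu kappa a W) (op_down D e nu eb mu kappa a X).
Proof.
move=> a0 WX s; apply: jet_add; last by apply: jet_scale; apply: jet_geg; apply: WX.
apply: jet_sub.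
  case: a a0 WX => [//|[|a]] _ WX; first by rewrite !geg_1B2; apply: jet_refl.
  apply: jet_opp; apply: jet_geg_pred2 => //.
  apply: jets_ed => r; apply: jets_cd => s'; exact: WX.
apply: jet_scale; apply: jet_geg_pred => //; apply: jets_cd => r.
by rewrite -addSn prednK//; apply: WX.
Qed.

Lemma jets_op_same k mu kappa a W X : (0 < a)%N -> jets_eq (a + k) W X ->
  jets_eq k (op_same D e nu eb mu kappa a W) (op_same D e nu eb mu kappa a X).
Proof.
move=> a0 WX s; apply: jet_add; last by apply: jet_scale; apply: jet_geg; apply: WX.
apply: jet_sub.
  case: a a0 WX => [//|[|a]] _ WX; first by rewrite !geg_1B2; apply: jet_refl.
  apply: jet_geg_pred2 => //.
  apply: jets_ed => r; apply: jets_cd => s'; exact: WX.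
apply: jet_scale; apply: jet_geg_pred => //; apply: jets_ed => r.
by rewrite -addSn prednK//; apply: WX.
Qed.

Lemma jets_tens k phi F G : jet_eq k F G -> jets_eq k (tens phi F) (tens phi G).
Proof. by move=> FG s; apply: jet_scale. Qed.

(** Multiplication by the coordinates [x_t] and [x_n], which vanish at the base
    point and raise the order of agreement by one. *)
Variables (xt xn : S -> S) (ct cn : T -> C) (t : 'I_m).
Hypotheses (E_xt : forall F, E (xt F) = 0) (E_xn : forall F, E (xn F) = 0)
  (D_xt : forall v F, D v (xt F) = ct v *: F + xt (D v F))
  (D_xn : forall v F, D v (xn F) = cn v *: F + xn (D v F)).

Let jet_mul (x : S -> S) (c : T -> C) : (forall F, E (x F) = 0) ->
  (forall v F, D v (x F) = c v *: F + x (D v F)) ->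
  forall k F G, jet_eq k F G -> jet_eq k.+1 (x F) (x G).
Proof.
move=> Ex Dx; elim=> [|k IHk] F G FG L.
  case: L => [|v [|//]] _ /=; rewrite ?Ex// !Dx !E_D !E_Z !Ex.
  by rewrite (jet_eq0 FG).
elim/last_ind: L => [|L v _] Lk; first by rewrite /= !Ex.
rewrite !foldr_rcons !Dx !foldrD !foldrZ !E_D !E_Z; rewrite size_rcons ltnS in Lk.
congr (_ * _ + _); first exact: FG.
by apply: IHk => //; apply: jet_D.
Qed.

Definition mono p q F := iter p xt (iter q xn F).

(** The two monomials only have to share their value at the base point: this
    is how a power of [(1 + |x|^2)^-1] gets replaced by the constant 1. *)
Lemma jet_mono p q F G : E F = E G -> jet_eq (p + q) (mono p q F) (mono p q G).
Proof.
move=> FG; elim: p => [|p IHp]; last by rewrite addSn; apply: jet_mul E_xt D_xt _ _ _ IHp.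
elim: q => [|q IHq]; first by case.
exact: jet_mul E_xn D_xn _ _ _ IHq.
Qed.

Variable one : S.
Hypotheses (D_one : forall v, D v one = 0) (E_one : E one = 1)
  (xtZ : forall c F, xt (c *: F) = c *: xt F) (xnZ : forall c F, xn (c *: F) = c *: xn F)
  (ct_t : ct (e t) = 1) (ct_e : forall j, j != t -> ct (e j) = 0) (ct_nu : ct nu = 0)
  (cn_e : forall j, cn (e j) = 0) (cn_nu : cn nu = 1).

Local Notation M p q := (mono p q one).

Let D_pow (x : S -> S) (c : T -> C) v q : (forall (z : C) F, x (z *: F) = z *: x F) ->
  (forall v F, D v (x F) = c v *: F + x (D v F)) ->
  D v (iter q x one) = (q%:R * c v) *: iter q.-1 x one.
Proof.
move=> xZ Dx; elim: q => [|q IHq] /=; first by rewrite mul0r scale0r D_one.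
rewrite Dx IHq xZ -[q.+1%:R]nat1r mulrDl mul1r scalerDl; congr (_ + _).
by case: q {IHq} => [|q]; rewrite ?mul0r ?scale0r.
Qed.

Lemma D_mono_e p q j : D (e j) (M p q) = (p%:R * ct (e j)) *: M p.-1 q.
Proof.
elim: p => [|p IHp]; first by rewrite (D_pow _ _ xnZ D_xn) cn_e mulr0 mul0r !scale0r.
rewrite [LHS]D_xt IHp xtZ -[p.+1%:R]nat1r mulrDl mul1r scalerDl; congr (_ + _).
by case: p {IHp} => [|p]; rewrite ?mul0r ?scale0r.
Qed.

Lemma D_mono_t p q : D (e t) (M p q) = p%:R *: M p.-1 q.
Proof. by rewrite D_mono_e ct_t mulr1. Qed.

Lemma depends_mono p q : depends_on_t D e t (M p q).
Proof. by move=> j jt; rewrite D_mono_e ct_e// mulr0 scale0r. Qed.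

Lemma D_mono_nu p q : D nu (M p q) = q%:R *: M p q.-1.
Proof.
elim: p => [|p IHp]; first by rewrite (D_pow _ _ xnZ D_xn) cn_nu mulr1.
by rewrite [LHS]D_xt IHp xtZ ct_nu scale0r add0r.
Qed.

Lemma E_mono p q : E (M p q) = ((p == 0%N) && (q == 0%N))%:R.
Proof. by case: p => [|p]; [case: q => [|q]|]; rewrite /= ?E_xt ?E_xn. Qed.

Lemma lapt_mono p q : lapt (M p q) = (p * p.-1)%:R *: M p.-2 q.
Proof.
rewrite (lapt_t (t := t)); last exact: depends_mono.
by rewrite D_mono_t linearZ /= D_mono_t scalerA natrM.
Qed.

Lemma iter_D_mono k p q : iter k (D nu) (M p q) = (q ^_ k)%:R *: M p (q - k).
Proof.
elim: k => [|k IHk]; first by rewrite ffactn0 subn0 scale1r.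
by rewrite iterS IHk linearZ /= D_mono_nu scalerA -natrM ffactnSr subnS.
Qed.

Lemma iter_lap_mono k p q : iter k lapt (M p q) = (p ^_ k.*2)%:R *: M (p - k.*2) q.
Proof.
elim: k => [|k IHk]; first by rewrite ffactn0 subn0 scale1r.
rewrite iterS IHk (invariantZ _ _ (invariant_lap DC e)) lapt_mono scalerA -natrM.
rewrite doubleS !ffactnSr mulnA; congr (_%:R *: M _ q); last by lia.
by congr (_ * _ * _)%N; lia.
Qed.

(** The value at the base point of [geg mu (2 b + o)] on [x_t^(2 b) x_n^o]. *)
Definition geg_value b o : C := 2%:R ^+ o * ((b.*2)`!%:R / b`!%:R).

Lemma geg_value_neq0 b o : geg_value b o != 0.
Proof.
rewrite mulf_neq0 ?expf_neq0 ?pnatr_eq0// mulf_neq0 ?invr_eq0 ?pnatr_eq0//.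
all: by rewrite -lt0n fact_gt0.
Qed.

Lemma geg_valueS b o : geg_value b.+1 o = 2%:R * b.*2.+1%:R * geg_value b o.
Proof.
have b0 : b.+1%:R != 0 :> C by rewrite pnatr_eq0.
have f0 : b`!%:R != 0 :> C by rewrite pnatr_eq0 -lt0n fact_gt0.
rewrite /geg_value doubleS !factS !natrM -[b.*2.+2]/(b.+1.*2) -mul2n natrM.
by field; rewrite f0 nat1r b0.
Qed.

Lemma geg_value1 b : geg_value b true = 2%:R * geg_value b false.
Proof. by rewrite /geg_value expr0 mul1r expr1. Qed.

(** A monomial of minimal degree in [x_n] selects the one coefficient of [geg]
    which does not depend on [mu]. *)
Lemma E_geg_mono mu b o : E (geg mu (b.*2 + o)%N (M b.*2 o)) = geg_value b o.
Proof.
have E0 : E 0 = 0 by rewrite -(scale0r one) E_Z mul0r.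
have E_sum l (F : 'I_l -> S) : E (\sum_(k < l) F k) = \sum_(k < l) E (F k).
  exact: (big_morph E E_D E0).
have -> : geg mu (b.*2 + o)%N (M b.*2 o) = geg_sum mu (b.*2 + o)
   (fun k q => iter k lapt (iter q (D nu) (M b.*2 o))) by [].
have term k : E (iter k lapt (iter (b.*2 + o - k.*2) (D nu) (M b.*2 o)))
    = (o ^_ (b.*2 + o - k.*2))%:R * ((b.*2) ^_ k.*2)%:R
      * ((b.*2 - k.*2 == 0) && (o - (b.*2 + o - k.*2) == 0))%N%:R.
  rewrite iter_D_mono (invariantZ _ _ (invariant_iter k (invariant_lap DC e))).
  by rewrite iter_lap_mono !E_Z E_mono mulrA.
rewrite /geg_sum E_sum; have -> : (b.*2 + o)./2 = b by lia.
rewrite big_ord_recr /= big1 => [|k _]; last first.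
  by rewrite E_Z term ffact_small ?mul0r ?mulr0//; have := ltn_ord k; lia.
rewrite add0r E_Z term addKn subnn /= subnn !ffactnn mulr1 /geg_coef.
have -> : half_prod (mu + b%:R) o = 1 by case: o {term}; [exact: half_prod1|exact: half_prod0].
have -> : o`! = 1%N by case: o {term}.
have f0 : b`!%:R != 0 :> C by rewrite pnatr_eq0 -lt0n fact_gt0.
by rewrite /geg_value muln1 mulr1 mul1r; field.
Qed.

End Jets.

(** * Multiplication by a coordinate *)

Lemma is_derive_mx_coord (R : realType) p q (x v : 'M[R]_(p, q)) i j :
  is_derive x v (fun g => g i j) (v i j).
Proof.
have H : (fun h => h^-1 *: (((fun g : 'M[R]_(p, q) => g i j) \o shift x) (h *: v) - x i j))
  @ 0^' --> v i j.
  apply: cvg_near_cst; near=> h.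
  rewrite /= !mxE addrK /GRing.scale /= mulrA mulVf ?mul1r//.
  by near: h; apply: nbhs_dnbhs_neq.
apply: DeriveDef; first by apply/cvg_ex; exists (v i j).
exact: cvg_lim H.
Unshelve. all: by end_near. Qed.

Section CoordinateMultiplication.
Variables (R : realType) (n : nat).
Local Notation C := (complex R).
Local Notation V := 'rV[R]_n.
Local Notation S := (smoothfun V).
Variable j : 'I_n.
Implicit Types (f : V -> C) (v x : V).

Definition coordmul f : V -> C := fun x => Complex (x 0 j) 0 * f x.

Lemma re_coordmul f : re_fun (coordmul f) = (fun x : V => x 0 j) \* re_fun f.
Proof.
by apply/funext => x; rewrite /re_fun /coordmul /=; case: (f x) => a b /=; rewrite mul0r subr0.
Qed.

Lemma im_coordmul f : im_fun (coordmul f) = (fun x : V => x 0 j) \* im_fun f.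
Proof.
by apply/funext => x; rewrite /im_fun /coordmul /=; case: (f x) => a b /=; rewrite mul0r addr0.
Qed.

Lemma continuous_coordmul f : ccontinuous_on setT f -> ccontinuous_on setT (coordmul f).
Proof.
move=> cf x _; have [cre cim] := cf x I; rewrite re_coordmul im_coordmul.
by split; apply: continuousM => //; apply: coord_continuous.
Qed.

Lemma derivable_coordmul f v : cderivable f v -> cderivable (coordmul f) v.
Proof.
move=> df x _; have [dre dim] := df x I; rewrite re_coordmul im_coordmul.
have [dx _] := is_derive_mx_coord x v 0 j.
by split; [exact: (derivableM dx dre)|exact: (derivableM dx dim)].
Qed.

Lemma cderive_coordmul f v : cderivable f v ->
  cderive v (coordmul f) = (fun x => Complex (v 0 j) 0 * f x) \+ coordmul (cderive v f).
Proof.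
move=> df; apply/funext => x; have [dre dim] := df x I.
have dx := is_derive_mx_coord x v 0 j; have [dx1 dx2] := dx.
rewrite /cderive re_coordmul im_coordmul (deriveM dx1 dre) (deriveM dx1 dim) dx2.
rewrite /coordmul /GRing.scale /= /re_fun /im_fun; case: (f x) => a b /=.
by congr Complex => /=; ring.
Qed.

Lemma Ck_on_coordmul k f : Ck_on k setT f -> Ck_on k setT (coordmul f).
Proof.
elim: k f => [|k IHk] f [cf df]; split => //; try exact: continuous_coordmul.
move=> v; have [df1 df2] := df v; split; first exact: (derivable_coordmul df1).
rewrite (cderive_coordmul df1); apply: Ck_onD; last exact: IHk.
apply: Ck_onZ; exact: (@Ck_on_pred R V k f (conj cf df)).
Qed.

Lemma smooth_coordmul (F : S) : smooth_on setT (coordmul F).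
Proof. by move=> k; apply: Ck_on_coordmul; apply: sfunP. Qed.

Definition xmul (F : S) : S := SmoothFun (smooth_coordmul F).

Lemma sderive_xmul v (F : S) :
  sderive v (xmul F) = Complex (v 0 j) 0 *: F + xmul (sderive v F).
Proof. by apply: sfunI; exact: (cderive_coordmul (sfun_cderivable F v)). Qed.

Lemma xmulZ c (F : S) : xmul (c *: F) = c *: xmul F.
Proof. by apply: sfunI; apply/funext => x /=; rewrite /coordmul /= mulrCA. Qed.

Lemma xmul_origin (F : S) : xmul F 0 = 0.
Proof. by rewrite /= /coordmul mxE mul0r. Qed.

End CoordinateMultiplication.

(** * Forms as functions of their arguments *)

Lemma alternating_antisym (R : realType) N i (w : seq 'rV[R]_N -> complex R) :
  alternating_form i w ->
  forall s r u v, w (s ++ u :: v :: r) = - w (s ++ v :: u :: r).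
Proof.
move=> [_ alt lin] s r u v.
have dup y : w (s ++ y :: y :: r) = 0.
  by apply: alt; rewrite cat_uniq /= inE eqxx /= !andbF.
have lin2 y : w (s ++ y :: 1 *: u + v :: r)
    = Complex 1 0 * w (s ++ y :: u :: r) + w (s ++ y :: v :: r).
  by rewrite -!(cat_rcons y s); apply: lin.
have := dup (1 *: u + v); rewrite lin !{}lin2 !dup mulr0 add0r addr0.
have -> : Complex 1 0 = 1 :> complex R by [].
by rewrite !mul1r => /eqP; rewrite addr_eq0 => /eqP ->.
Qed.

Section Bridge.
Variables (R : realType) (n' : nat).
Local Notation n := n'.+1.
Local Notation C := (complex R).
Local Notation V := 'rV[R]_n.
Local Notation S := (smoothfun V).
Local Notation incl := (@hyperplane_incl R n).
Local Notation nu := (normal_vec R n).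
Local Notation eb := (@basis_vec R n).
Local Notation D := (@sderive_lin R V).
Implicit Types (W : seq V -> S) (F : S) (v : V) (s : seq V).

Definition tvec (j : 'I_n') : V := incl (basis_vec R j).
Local Notation e := tvec.

Definition toform W : dform R n := fun x s => W s x.

Lemma hyperplane_incl_lin (h : R) (x y : 'rV[R]_n') :
  incl (h *: x + y) = h *: incl x + incl y.
Proof.
apply/rowP => j; rewrite !mxE; case: insub => [k|] /=; first by rewrite !mxE.
by rewrite mulr0 addr0.
Qed.

Lemma tvecE (j : 'I_n') : tvec j = eb (widen_ord (leqnSn n') j).
Proof.
apply/rowP => k; rewrite !mxE; case: insubP => [l _ /= lk|] /=.
  by rewrite mxE /= -val_eqE /= -[in RHS]val_eqE /= lk.
rewrite -val_eqE /= => kn'; case: eqP => // kj; move: kn'; rewrite kj ltn_ord//.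
Qed.

Lemma normal_vecE : nu = eb ord_max.
Proof. by apply/rowP => k; rewrite !mxE -val_eqE. Qed.

Lemma sum_basis_vec (f : V -> S) :
  \sum_(j < n) f (eb j) = \sum_(j < n') f (e j) + f nu.
Proof.
rewrite big_ord_recr normal_vecE; congr (_ + _).
by apply: eq_bigr => j _; rewrite tvecE.
Qed.

Lemma cderive_incl (f : V -> C) (v x : 'rV[R]_n') :
  cderive v (f \o incl) x = cderive (incl v) f (incl x).
Proof.
have E (g : V -> R) : 'D_v (g \o incl) x = 'D_(incl v) g (incl x).
  rewrite /derive.
  suff -> : (fun h => h^-1 *: (((g \o incl) \o shift x) (h *: v) - (g \o incl) x))
    = (fun h => h^-1 *: ((g \o shift (incl x)) (h *: incl v) - g (incl x))) by [].
  by apply/funext => h /=; rewrite hyperplane_incl_lin.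
by rewrite /cderive -!E.
Qed.

Lemma ext_d_toform W : ext_d (toform W) = toform (ed D W).
Proof.
apply/funext => x; apply/funext => s; rewrite /toform.
elim: s W => [|v s IHs] W; first by rewrite /ext_d big_ord0.
rewrite edE sfunD sfunN -IHs /ext_d /= big_ord_recl /= expr0 mul1r drop0.
congr (_ + _); rewrite -sumrN; apply: eq_bigr => k _.
by rewrite /bump /= exprS mulN1r mulNr.
Qed.

Lemma codiff_toform W : codiff (toform W) = toform (cd D eb W).
Proof.
apply/funext => x; apply/funext => s; rewrite /toform /cd sfunN sfun_sum.
by [].
Qed.

Lemma ext_d_Rest (w : dform R n) : ext_d (Rest w) = Rest (ext_d w).
Proof.
apply/funext => x; apply/funext => s; rewrite /Rest /ext_d size_map.
apply: eq_bigr => k _; congr (_ * _).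
rewrite (nth_map 0) ?ltn_ord// -cderive_incl; congr (cderive _ _ _).
by apply/funext => y /=; rewrite map_cat map_take map_drop.
Qed.

(** Restriction turns the tangential codifferential, not the one of [R^n], into
    the codifferential of the hyperplane. *)
Lemma codiff_Rest W : codiff (Rest (toform W)) = Rest (toform (cd D e W)).
Proof.
apply/funext => x; apply/funext => s; rewrite /Rest /toform /cd sfunN sfun_sum.
congr (- _); apply: eq_bigr => j _ /=; rewrite -cderive_incl.
by [].
Qed.

Lemma contract_toform v W : Defs.contract v (toform W) = toform (fun s => W (v :: s)).
Proof. by []. Qed.

Lemma calD_toform mu l F : calD mu l (sfun F) = sfun (geg D e nu mu l F).
Proof.
case: l => [p|p]; last by apply/funext => x.
apply/funext => x.
have Eq q : iter q (@normal_deriv R n) (sfun F) = sfun (iter q (D nu) F).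
  by elim: q => //= q ->.
have El k G : iter k (@tangential_lap R n) (sfun G) = sfun (iter k (lap D e) G).
  elim: k => //= k ->; apply/funext => y; rewrite /lap sfun_sum.
  by [].
rewrite /calD /geg /geg_sum sfun_sum; apply: eq_bigr => k _.
rewrite sfunZ Eq El calD_coefE//; have := ltn_ord k; lia.
Qed.

Lemma coefwise_toform mu l W :
  coefwise (calD mu l) (toform W) = toform (fun s => geg D e nu mu l (W s)).
Proof.
by apply/funext => x; apply/funext => s; rewrite /toform -calD_toform.
Qed.

Lemma D_down_toform i u a W : D_down i u a (toform W)
  = Rest (toform (op_down D e nu eb (u + i%:R - (n%:R - 1) / 2%:R)
                    ((u + 2%:R * i%:R - n%:R) / 2%:R) a W)).
Proof.
rewrite /D_down contract_toform !codiff_toform ext_d_toform !coefwise_toform.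
congr Rest; apply/funext => x; apply/funext => s.
by rewrite /toform /op_down !sfunD !sfunN !sfunZ.
Qed.

Lemma D_same_toform i u a W : D_same i u a (toform W)
  = Rest (toform (op_same D e nu eb (u + i%:R - (n%:R - 1) / 2%:R)
                    ((u + a%:R) / 2%:R) a W)).
Proof.
rewrite /D_same contract_toform codiff_toform !ext_d_toform !coefwise_toform.
congr Rest; apply/funext => x; apply/funext => s.
by rewrite /toform /op_same !sfunD !sfunN !sfunZ.
Qed.

Lemma smooth_forms_toform i (w : dform R n) : smooth_forms i w ->
  exists2 W, w = toform W & antisym W /\ (forall s, size s != i -> W s = 0).
Proof.
move=> [aw sw]; exists (fun s => SmoothFun (sw s)) => //; split; last first.
  by move=> s si; apply: sfunI; apply/funext => x /=; have [-> ] := aw x.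
move=> s r u v; apply: sfunI; apply/funext => x; rewrite sfunN /=.
exact: (alternating_antisym (aw x)).
Qed.

End Bridge.

(** * Rational functions of the matrix entries *)

Section ElementaryFunctions.
Variables (R : realType) (p q : nat).
Local Notation C := (complex R).
Local Notation V := 'M[R]_(p, q).
Implicit Types (U : set V) (f g : V -> R) (v x : V).

(** Smoothness of the test sections is obtained from a class of functions that
    is visibly closed under directional derivatives. *)
Inductive elementary U : (V -> R) -> Prop :=
| elementary_cst c : elementary U (fun=> c)
| elementary_coord i j : elementary U (fun x => x i j)
| elementaryD f g : elementary U f -> elementary U g -> elementary U (fun x => f x + g x)
| elementaryM f g : elementary U f -> elementary U g -> elementary U (fun x => f x * g x)
| elementaryV f : elementary U f -> (forall x, U x -> f x != 0) ->
    elementary U (fun x => (f x)^-1).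

Lemma elementary_continuous U f x : elementary U f -> U x -> {for x, continuous f}.
Proof.
move=> ef Ux; elim: ef => [c|i j|f1 f2 _ c1 _ c2|f1 f2 _ c1 _ c2|f1 _ c1 nz].
- exact: cst_continuous.
- exact: coord_continuous.
- exact: continuousD.
- exact: continuousM.
- by apply: continuousV => //; apply: nz.
Qed.

Lemma elementary_derive U f v : elementary U f ->
  exists2 g, elementary U g & forall x, U x -> is_derive x v f (g x).
Proof.
elim=> [c|i j|f1 f2 e1 [g1 eg1 d1] e2 [g2 eg2 d2]|f1 f2 e1 [g1 eg1 d1] e2 [g2 eg2 d2]
  |f1 e1 [g1 eg1 d1] nz].
- by exists (fun=> 0); [exact: elementary_cst|move=> x _; exact: is_derive_cst].
- exists (fun=> v i j); first exact: elementary_cst.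
  by move=> x _; apply: is_derive_mx_coord.
- exists (fun x => g1 x + g2 x); first exact: elementaryD.
  by move=> x Ux; have := d1 x Ux; have := d2 x Ux => ? ?; apply: is_deriveD.
- exists (fun x => f1 x * g2 x + f2 x * g1 x).
    by apply: elementaryD; apply: elementaryM.
  by move=> x Ux; have := d1 x Ux; have := d2 x Ux => ? ?; apply: is_deriveM.
- exists (fun x => (-1) * ((f1 x)^-1 * (f1 x)^-1) * g1 x).
    apply: elementaryM => //; apply: elementaryM; first exact: elementary_cst.
    by apply: elementaryM; apply: elementaryV.
  move=> x Ux; have [df1 Ef1] := d1 x Ux; apply: DeriveDef.
    by apply: derivableV => //; apply: nz.
  by rewrite (deriveV (nz _ Ux) df1) Ef1 /GRing.scale /= mulN1r -invfM -expr2.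
Qed.

Lemma elementary_sum U (I : Type) (r : seq I) (P : pred I) (f : I -> V -> R) :
  (forall i, elementary U (f i)) -> elementary U (fun x => \sum_(i <- r | P i) f i x).
Proof.
move=> ef; elim: r => [|i r IHr].
  rewrite (_ : (fun=> _) = fun=> 0); first exact: elementary_cst.
  by apply/funext => x; rewrite big_nil.
rewrite (_ : (fun x => _) = fun x => (if P i then f i x else 0) + \sum_(j <- r | P j) f j x).
  apply: elementaryD => //; case: (P i) => //; exact: elementary_cst.
by apply/funext => x; rewrite big_cons; case: (P i); rewrite ?add0r.
Qed.

Lemma elementary_prod U (I : Type) (r : seq I) (P : pred I) (f : I -> V -> R) :
  (forall i, elementary U (f i)) -> elementary U (fun x => \prod_(i <- r | P i) f i x).
Proof.
move=> ef; elim: r => [|i r IHr].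
  rewrite (_ : (fun=> _) = fun=> 1); first exact: elementary_cst.
  by apply/funext => x; rewrite big_nil.
rewrite (_ : (fun x => _) = fun x => (if P i then f i x else 1) * \prod_(j <- r | P j) f j x).
  apply: elementaryM => //; case: (P i) => //; exact: elementary_cst.
by apply/funext => x; rewrite big_cons; case: (P i); rewrite ?mul1r.
Qed.

Lemma elementaryX U f k : elementary U f -> elementary U (fun x => f x ^+ k).
Proof.
move=> ef; rewrite (_ : (fun x => _) = fun x => \prod_(i < k) f x).
  exact: elementary_prod.
by apply/funext => x; rewrite prodr_const card_ord.
Qed.

Lemma elementary_det U k (f : 'I_k -> 'I_k -> V -> R) :
  (forall a b, elementary U (f a b)) ->
  elementary U (fun x => \det (\matrix_(a, b) f a b x)).
Proof.
move=> ef; rewrite /determinant; apply: elementary_sum => s.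
apply: elementaryM; first exact: elementary_cst.
rewrite (_ : (fun x => _) = fun x => \prod_(i < k) f i (s i) x).
  exact: elementary_prod.
by apply/funext => x; apply: eq_bigr => i _; rewrite mxE.
Qed.

Lemma near_open U x (f g : V -> C) : open U -> U x ->
  (forall y, U y -> f y = g y) ->
  {near x, re_fun f =1 re_fun g} /\ {near x, im_fun f =1 im_fun g}.
Proof.
move=> oU Ux fg; have nU := open_nbhs_nbhs (conj oU Ux).
by split; apply: filterS nU => y Uy; rewrite /re_fun /im_fun fg.
Qed.

Lemma continuous_near_eq (f g : V -> R) x : {near x, f =1 g} ->
  {for x, continuous g} -> {for x, continuous f}.
Proof.
move=> fg cg; suff : f @ x --> f x by [].
rewrite (nbhs_singleton fg : f x = g x); apply: cvg_trans cg.
apply: (@near_eq_cvg _ _ (nbhs x) (nbhs_filter x)).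
have sub : [set y | f y = g y] `<=` [set y | g y = f y] by move=> y /= ->.
exact: (@filterS _ (nbhs x) (nbhs_filter x) _ _ sub fg).
Qed.

Lemma Ck_on_eq U k (f g : V -> C) : open U -> (forall y, U y -> f y = g y) ->
  Ck_on k U g -> Ck_on k U f.
Proof.
move=> oU; elim: k f g => [|k IHk] f g fg [cg dg]; split => //.
- move=> x Ux; have [cre cim] := cg x Ux; have [nre nim] := near_open oU Ux fg.
  by split; [exact: continuous_near_eq nre cre|exact: continuous_near_eq nim cim].
- move=> x Ux; have [cre cim] := cg x Ux; have [nre nim] := near_open oU Ux fg.
  by split; [exact: continuous_near_eq nre cre|exact: continuous_near_eq nim cim].
move=> v; have [dvg Ckg] := dg v; split.
  have gf y (Uy : U y) := esym (fg y Uy).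
  move=> x Ux; have [nre nim] := near_open oU Ux gf; have [dre dim] := dvg x Ux.
  by split; [exact: near_eq_derivable nre dre|exact: near_eq_derivable nim dim].
apply: IHk Ckg => x Ux; have [nre nim] := near_open oU Ux fg.
by rewrite /cderive (near_eq_derive v nre) (near_eq_derive v nim).
Qed.

Lemma elementary_smooth U f : open U -> elementary U f ->
  smooth_on U (fun x => Complex (f x) 0).
Proof.
move=> oU ef k; elim: k f ef => [|k IHk] f ef; split => //.
- move=> x Ux; split; first exact: (elementary_continuous ef Ux).
  exact: cst_continuous.
- move=> x Ux; split; first exact: (elementary_continuous ef Ux).
  exact: cst_continuous.
move=> v; have [g eg dg] := elementary_derive v ef; split.
  move=> x Ux; split; last exact: derivable_cst.
  by have [] := dg x Ux.
apply: Ck_on_eq (IHk g eg) => // x Ux; rewrite /cderive; congr Complex.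
  by have [_] := dg x Ux.
exact: derive_cst.
Qed.

End ElementaryFunctions.

(** * Determinant forms and the light cone *)

Section DeterminantForms.
Variables (R : realType) (n : nat).
Local Notation C := (complex R).
Local Notation V := 'rV[R]_n.

Definition detform k (theta : 'I_k -> V -> R) (s : seq V) : R :=
  if size s == k then \det (\matrix_(a < k, b < k) theta b (nth 0 s a)) else 0.

Lemma detform_alternating k (theta : 'I_k -> V -> R) (z : R) :
  (forall b c u v, theta b (c *: u + v) = c * theta b u + theta b v) ->
  alternating_form k (fun s => Complex (z * detform theta s) 0).
Proof.
move=> lin; split=> [s /negPf sk|s|s1 s2 c u v].
- by rewrite /detform sk mulr0.
- move=> /(uniqPn 0)[a [b [ab bs eqab]]]; rewrite /detform; case: eqP => sk; last by rewrite mulr0.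
  rewrite sk in bs; have ak := ltn_trans ab bs.
  rewrite (@determinant_alternate _ _ _ (Ordinal ak) (Ordinal bs)) ?mulr0//.
    by rewrite -val_eqE /= neq_ltn ab.
  by move=> j; rewrite !mxE /= eqab.
rewrite /detform !size_cat /=; case: eqP => sk; last first.
  by rewrite !mulr0; congr Complex => /=; ring.
have s1k : (size s1 < k)%N by rewrite -sk addnS ltnS leq_addr.
pose A w : 'M[R]_k := \matrix_(a < k, b < k) theta b (nth 0 (s1 ++ w :: s2) a).
have row'A w w' : row' (Ordinal s1k) (A w) = row' (Ordinal s1k) (A w').
  apply/matrixP => a b; rewrite !mxE !nth_cat.
  case: ltnP => //= s1a.
  have lt : (size s1 < bump (size s1) a)%N by rewrite ltn_neqAle neq_bump.
  by rewrite -(subnSK lt).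
rewrite (_ : \det _ = c * \det (A u) + 1 * \det (A v)); last first.
  apply: (determinant_multilinear (i0 := Ordinal s1k)); [|exact: row'A|exact: row'A].
  by apply/rowP => b; rewrite !mxE !nth_cat ltnn subnn /= lin mul1r.
by congr Complex => /=; rewrite /A; ring.
Qed.

Lemma detform_scale k (theta theta' : 'I_k -> V -> R) (z : R) (L : V -> V) s :
  (forall b v, theta' b v = z * theta b (L v)) ->
  detform theta' s = z ^+ k * detform theta (map L s).
Proof.
move=> eq_theta; rewrite /detform size_map; case: eqP => sk; last by rewrite mulr0.
rewrite -detZ; congr (\det _); apply/matrixP => a b; rewrite !mxE eq_theta.
by rewrite (nth_map 0)// sk.
Qed.

End DeterminantForms.

Section LightCone.
Variables (R : realType) (n : nat).
Local Notation V := 'rV[R]_n.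
Local Notation G := 'M[R]_n.+2.
Local Notation col := 'cV[R]_n.+2.
Implicit Types (g X : G) (v x : V) (y : col) (j : 'I_n) (k : 'I_n.+2).

Lemma mid_neq0 j : (mid j == ord0) = false.
Proof. by apply/eqP => /(congr1 val). Qed.

Lemma mid_neq_max j : (mid j == ord_max) = false.
Proof.
apply/eqP => /(congr1 val) /=; rewrite /bump /= => E.
by have := ltn_ord j; rewrite leqNgt (ltn_ord j) /= in E; lia.
Qed.

Lemma mid_inj : injective (@mid n).
Proof. by move=> i j /lift_inj/lift_inj. Qed.

Lemma ord_cases k : [\/ k = ord0, k = ord_max | exists j, k = mid j].
Proof.
case: (unliftP ord0 k) => [k1 ->|]; last by constructor 1.
case: (unliftP ord_max k1) => [j ->|->]; first by constructor 3; exists j.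
by constructor 2; apply: val_inj.
Qed.

Lemma ord0_neq_max : (ord0 == ord_max :> 'I_n.+2) = false. Proof. by []. Qed.
Lemma ord_max_neq0 : (ord_max == ord0 :> 'I_n.+2) = false. Proof. by []. Qed.

(** [base_ray] spans the line fixed by the parabolic subgroup, [opp_ray] is null
    as well, and [tangent v] is in the orthogonal complement of both. *)
Definition base_ray : col := delta_mx ord0 0 + delta_mx ord_max 0.
Definition opp_ray : col := delta_mx ord_max 0 - delta_mx ord0 0.
Definition tangent v : col := \sum_j v 0 j *: delta_mx (mid j) 0.

Lemma tangent_mid v j : tangent v (mid j) 0 = v 0 j.
Proof.
rewrite /tangent summxE (bigD1 j)//= big1 ?addr0 => [|k kj]; rewrite !mxE !eqxx ?mulr1//.
by rewrite (inj_eq mid_inj) eq_sym (negPf kj) mulr0.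
Qed.

Lemma tangent_ord0 v : tangent v ord0 0 = 0.
Proof.
by rewrite /tangent summxE big1// => j _; rewrite !mxE eq_sym mid_neq0 mulr0.
Qed.

Lemma tangent_ord_max v : tangent v ord_max 0 = 0.
Proof.
by rewrite /tangent summxE big1// => j _; rewrite !mxE eq_sym mid_neq_max mulr0.
Qed.

Lemma tangent_lin (c : R) u v : tangent (c *: u + v) = c *: tangent u + tangent v.
Proof.
rewrite /tangent scaler_sumr -big_split; apply: eq_bigr => j _.
by rewrite !mxE scalerDl scalerA.
Qed.

Let H0E k l : H0 R n k l
  = ((k == ord0) && (l == ord_max))%:R + ((k == ord_max) && (l == ord0))%:R.
Proof. by rewrite !mxE. Qed.

Lemma H0_ord0 y : (H0 R n *m y) ord0 0 = y ord_max 0.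
Proof.
rewrite mxE (bigD1 ord_max)//= big1 => [|k /negPf kmax].
  by rewrite H0E !eqxx ord0_neq_max /= mulr1n mulr0n !addr0 mul1r.
by rewrite H0E kmax !eqxx ord0_neq_max /= mulr0n addr0 mul0r.
Qed.

Lemma H0_ord_max y : (H0 R n *m y) ord_max 0 = y ord0 0.
Proof.
rewrite mxE (bigD1 ord0)//= big1 => [|k /negPf k0].
  by rewrite H0E !eqxx ord_max_neq0 /= mulr1n mulr0n add0r addr0 mul1r.
by rewrite H0E k0 !eqxx ord_max_neq0 /= mulr0n addr0 mul0r.
Qed.

Lemma H0_mid y j : (H0 R n *m y) (mid j) 0 = 0.
Proof.
by rewrite mxE big1// => k _; rewrite H0E mid_neq0 mid_neq_max /= mulr0n addr0 mul0r.
Qed.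

Lemma base_rayE : [/\ base_ray ord0 0 = 1, base_ray ord_max 0 = 1
  & forall j, base_ray (mid j) 0 = 0].
Proof.
by split=> [||j]; rewrite !mxE ?eqxx ?mid_neq0 ?mid_neq_max /= ?addr0 ?add0r.
Qed.

Lemma col_ext (y z : col) : y ord0 0 = z ord0 0 -> y ord_max 0 = z ord_max 0 ->
  (forall j, y (mid j) 0 = z (mid j) 0) -> y = z.
Proof. by move=> ? ? ?; apply/colP => k; case: (ord_cases k) => [->|->|[j ->]]. Qed.

Lemma H0_base : H0 R n *m base_ray = base_ray.
Proof.
have [b0 b1 bj] := base_rayE.
by apply: col_ext => [||j]; rewrite ?H0_ord0 ?H0_ord_max ?H0_mid ?bj ?b0 ?b1.
Qed.

Lemma H0_tangent v : H0 R n *m tangent v = 0.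
Proof.
by apply: col_ext => [||j];
  rewrite ?H0_ord0 ?H0_ord_max ?H0_mid ?tangent_ord0 ?tangent_ord_max mxE.
Qed.

(** [X] raises the eigenvalue 1 of [H_0] on [base_ray] to 2, which is not an
    eigenvalue of [H_0]. *)
Lemma nplus_base X : in_nplus X -> X *m base_ray = 0.
Proof.
move=> [_ HX]; set y := X *m base_ray.
have Ey : H0 R n *m y = y + y.
  have HX2 : H0 R n *m X = X + X *m H0 R n by rewrite -[X in X + _]HX subrK.
  by rewrite /y mulmxA HX2 mulmxDl -mulmxA H0_base.
clearbody y; have E0 := congr1 (fun z : col => z ord0 0) Ey.
have E1 := congr1 (fun z : col => z ord_max 0) Ey.
rewrite /= H0_ord0 !mxE in E0; rewrite /= H0_ord_max !mxE in E1.
apply: col_ext => [||j]; rewrite [RHS]mxE.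
- lra.
- lra.
have := congr1 (fun z : col => z (mid j) 0) Ey.
by rewrite /= H0_mid !mxE; lra.
Qed.

(** [X] raises the eigenvalue 0 of [H_0] on tangent vectors to 1, whose
    eigenspace is spanned by [base_ray]. *)
Lemma nplus_tangent X v : in_nplus X ->
  exists c, X *m tangent v = c *: base_ray.
Proof.
move=> [_ HX]; set y := X *m tangent v.
have Ey : H0 R n *m y = y.
  have HX2 : H0 R n *m X = X + X *m H0 R n by rewrite -[X in X + _]HX subrK.
  by rewrite /y mulmxA HX2 mulmxDl -mulmxA H0_tangent mulmx0 addr0.
clearbody y; exists (y ord0 0); have [b0 b1 bj] := base_rayE.
apply: col_ext => [||j]; rewrite [RHS]mxE ?b0 ?b1 ?bj ?mulr1 ?mulr0//.
  by rewrite -[in LHS]Ey H0_ord_max.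
by rewrite -[in LHS]Ey H0_mid.
Qed.

Lemma expN_base X : in_nplus X -> expN X *m base_ray = base_ray.
Proof.
move=> nX; rewrite /expN !mulmxDl mul1mx -scalemxAl -mulmxA nplus_base//.
by rewrite mulmx0 scaler0 !addr0.
Qed.

Lemma expN_tangent X v : in_nplus X ->
  exists c, expN X *m tangent v = tangent v + c *: base_ray.
Proof.
move=> nX; have [c Ec] := nplus_tangent v nX; exists c.
rewrite /expN !mulmxDl mul1mx -scalemxAl -mulmxA Ec -scalemxAr nplus_base//.
by rewrite !scaler0 addr0.
Qed.

Lemma expH0_base t : expH0 n t *m base_ray = expR t *: base_ray.
Proof.
rewrite /expH0; move: H0_base; move: (H0 R n) => h hb.
rewrite !mulmxDl mul1mx -!scalemxAl -mulmxA !hb.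
by rewrite -[X in X + _ + _]scale1r -!scalerDl; congr (_ *: _); field.
Qed.

Lemma expH0_tangent t v : expH0 n t *m tangent v = tangent v.
Proof.
rewrite /expH0; move: (H0_tangent v); move: (H0 R n) => h hv.
rewrite !mulmxDl mul1mx -!scalemxAl -mulmxA !hv mulmx0.
by rewrite !scaler0 !addr0.
Qed.

Let blockE (B : 'M[R]_n) y : (\sum_(j < n) \sum_(k < n) B j k *: delta_mx (mid j) (mid k)) *m y
   = tangent (\row_j \sum_(k < n) B j k * y (mid k) 0).
Proof.
rewrite mulmx_suml /tangent; apply: eq_bigr => j _.
rewrite mulmx_suml mxE scaler_suml; apply: eq_bigr => k _.
rewrite -scalemxAl -scalerA; congr (_ *: _).
apply/matrixP => a b; rewrite (ord1 b) !mxE (bigD1 (mid k))//= big1 => [|l /negPf lk].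
  by rewrite !mxE !eqxx !andbT addr0 mulrC.
by rewrite !mxE lk andbF mul0r.
Qed.

Lemma Melt_base eps B : Melt eps B *m base_ray = eps *: base_ray :> col.
Proof.
have [_ _ bj] := base_rayE.
rewrite /Melt; move: H0_base; move: (H0 R n) => h hb.
rewrite mulmxDl -scalemxAl -mulmxA !hb blockE.
rewrite (_ : \row_j _ = 0) ?/tangent ?big1 ?addr0// => [j _|].
  by rewrite mxE scale0r.
by apply/rowP => j; rewrite !mxE big1// => k _; rewrite bj mulr0.
Qed.

Lemma Melt_tangent eps B v : Melt eps B *m tangent v = tangent (v *m B^T).
Proof.
rewrite /Melt; move: (H0_tangent v); move: (H0 R n) => h hv.
rewrite mulmxDl -scalemxAl -mulmxA hv mulmx0 scaler0 add0r blockE.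
congr tangent; apply/rowP => j; rewrite !mxE; apply: eq_bigr => k _.
by rewrite tangent_mid mxE mulrC.
Qed.

Lemma parabolic_base g eps B t X : in_nplus X ->
  g *m Melt eps B *m expH0 n t *m expN X *m base_ray
  = (eps * expR t) *: (g *m base_ray).
Proof.
move=> nX; rewrite -!mulmxA expN_base// expH0_base -!scalemxAr Melt_base.
by rewrite -scalemxAr scalerA mulrC.
Qed.

(** The action of the parabolic subgroup on the tangent space of the cone modulo
    the base ray; the multiple of the base ray will not matter for [theta]. *)
Lemma parabolic_tangent g eps B t X v : in_nplus X -> exists c,
  g *m Melt eps B *m expH0 n t *m expN X *m tangent v
  = g *m tangent (v *m B^T) + c *: (g *m base_ray).
Proof.
move=> nX; have [c Ec] := expN_tangent v nX; exists (c * (expR t * eps)).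
rewrite -!mulmxA Ec !mulmxDr expH0_tangent Melt_tangent; congr (_ + _).
by rewrite -!scalemxAr expH0_base -!scalemxAr Melt_base -!scalemxAr !scalerA mulrA -mulmxDr.
Qed.

Lemma nminus_alg_mul x y : nminus_alg x *m y
  = (\sum_j x 0 j * y (mid j) 0) *: opp_ray + (y ord0 0 + y ord_max 0) *: tangent x.
Proof.
have delta_mul (a b : 'I_n.+2) : delta_mx a b *m y = y b 0 *: delta_mx a 0.
  apply/matrixP => k l; rewrite (ord1 l) !mxE (bigD1 b)//= big1 => [|k' /negPf kb].
    by rewrite !mxE !eqxx !andbT addr0 mulrC.
  by rewrite !mxE kb andbF mul0r.
rewrite /nminus_alg mulmx_suml scaler_suml /tangent scaler_sumr -big_split.
apply: eq_bigr => j _ /=; rewrite -scalemxAl !mulmxDl mulNmx !delta_mul /opp_ray.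
by apply/matrixP => a b; rewrite !mxE; ring.
Qed.

Lemma opp_rayE : [/\ opp_ray ord0 0 = -1, opp_ray ord_max 0 = 1
  & forall j, opp_ray (mid j) 0 = 0].
Proof.
by split=> [||j]; rewrite !mxE ?eqxx ?mid_neq0 ?mid_neq_max /= ?mulr0n ?mulr1n ?subr0 ?sub0r.
Qed.

Definition dotv (u v : V) : R := \sum_j u 0 j * v 0 j.

Let nminus_alg_opp x : nminus_alg x *m opp_ray = 0.
Proof.
have [q0 q1 qj] := opp_rayE.
rewrite nminus_alg_mul q0 q1 addNr scale0r addr0 big1 ?scale0r// => j _.
by rewrite qj mulr0.
Qed.

Let nminus_alg_tangent x v : nminus_alg x *m tangent v = dotv x v *: opp_ray.
Proof.
rewrite nminus_alg_mul tangent_ord0 tangent_ord_max addr0 scale0r addr0.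
by congr (_ *: _); apply: eq_bigr => j _; rewrite tangent_mid.
Qed.

Lemma nminus_base x : nminus x *m base_ray
  = base_ray + 2%:R *: tangent x + dotv x x *: opp_ray.
Proof.
have [b0 b1 bj] := base_rayE.
have Eb : nminus_alg x *m base_ray = 2%:R *: tangent x.
  rewrite nminus_alg_mul b0 b1 big1 ?scale0r ?add0r// => j _.
  by rewrite bj mulr0.
rewrite /nminus /expN !mulmxDl mul1mx -scalemxAl -mulmxA Eb -scalemxAr.
rewrite nminus_alg_tangent !scalerA; congr (_ + _); congr (_ *: _).
by rewrite mulVf ?mul1r// pnatr_eq0.
Qed.

Lemma nminus_tangent x v : nminus x *m tangent v = tangent v + dotv x v *: opp_ray.
Proof.
rewrite /nminus /expN !mulmxDl mul1mx -scalemxAl -mulmxA nminus_alg_tangent.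
by rewrite -scalemxAr nminus_alg_opp !scaler0 addr0.
Qed.

(** Where the last coordinate vanishes the quadratic form is positive definite,
    and the image of [base_ray] is a nonzero null vector. *)
Lemma inG_base_neq0 g : inG g -> (g *m base_ray) ord_max 0 != 0.
Proof.
move=> Gg; set y := g *m base_ray; have [b0 b1 bj] := base_rayE.
have Jmul (z : col) k : (Jform R n *m z) k 0 = (if k == ord_max then -1 else 1) * z k 0.
  by rewrite mul_diag_mx !mxE.
apply/eqP => y0.
have Q : (base_ray^T *m (Jform R n *m base_ray)) = y^T *m (Jform R n *m y).
  by rewrite /y trmx_mul -!mulmxA; congr (_ *m _); rewrite [RHS]mulmxA [in RHS]mulmxA Gg.
have Q0 : (base_ray^T *m (Jform R n *m base_ray)) 0 0 = 0.
  rewrite mxE (bigD1 ord0)//= (bigD1 ord_max)//= big1 => [|k /andP[k0 k1]].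
    by rewrite !Jmul !mxE !eqxx /= !addr0 !add0r !mulr1 mul1r subrr.
  case: (ord_cases k) => [E|E|[j ->]]; first by rewrite E eqxx in k0.
    by rewrite E eqxx in k1.
  by rewrite mxE bj mul0r.
have y_eq0 : y = 0.
  apply/colP => k; rewrite [RHS]mxE; have [->//|kmax] := eqVneq k ord_max.
  move/eqP: Q0; rewrite Q mxE psumr_eq0 => [/allP /(_ k)|l _].
    rewrite mem_index_enum => /(_ isT); rewrite Jmul (negPf kmax) mxE mul1r.
    by rewrite mulf_eq0 orbb => /eqP.
  rewrite Jmul mxE; case: eqP => [->|_]; first by rewrite y0 mul0r.
  by rewrite mul1r -expr2 sqr_ge0.
have : Jform R n *m base_ray = 0.
  by rewrite -Gg -mulmxA -/y y_eq0 mulmx0.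
move=> /colP /(_ ord0); rewrite Jmul b0 mxE /= mulr1 => /eqP.
by rewrite oner_eq0.
Qed.

End LightCone.

(** * Test forms in the principal series *)

Section TestFormsInPrincipalSeries.
Variables (R : realType) (n : nat).
Local Notation C := (complex R).
Local Notation V := 'rV[R]_n.
Local Notation G := 'M[R]_n.+2.
Implicit Types (g X : G) (v x : V) (j : 'I_n) (k : 'I_n.+2).

Definition decay (N : nat) x : R := ((1 + dotv x x)^-1) ^+ N.

Let decay_base_gt0 x : 0 < 1 + dotv x x.
Proof.
by rewrite ltr_wpDr// sumr_ge0// => j _; rewrite -expr2 sqr_ge0.
Qed.

Lemma decay_elementary N : elementary setT (decay N).
Proof.
apply: elementaryX; apply: elementaryV => [|x _]; last by rewrite gt_eqF.
apply: elementaryD; first exact: elementary_cst.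
by apply: elementary_sum => j; apply: elementaryM; apply: elementary_coord.
Qed.

Definition decay_sf N : smoothfun V :=
  SmoothFun (elementary_smooth openT (decay_elementary N)).

Lemma decay_origin N : decay_sf N 0 = 1.
Proof.
rewrite /= /decay /dotv big1 ?addr0 ?invr1 ?expr1n// => j _.
by rewrite mxE mul0r.
Qed.

Variables (i : nat) (c : 'I_i -> 'I_n) (j1 j2 : 'I_n) (p q N M : nat).
Variables (lam : int) (alpha : nat).

Definition coord_form (s : seq V) : R := detform (fun b v => v 0 (c b)) s.

Local Notation base g k := ((g *m base_ray R n) k 0).
Local Notation tang g v k := ((g *m tangent v) k 0).

(** [nminus x] gives [eta = 1]; in general [x_j] is [base g (mid j) / (2 eta g)]. *)
Definition eta g : R := (base g ord0 + base g ord_max) / 2%:R.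

(** For [x_j = base g (mid j) / (2 eta g)] this is [eta^2 dx_j], which unlike
    [dx_j] is polynomial in [g].  Adding a multiple of [base_ray] to [tangent v]
    does not change it. *)
Definition theta g (b : 'I_i) v : R := eta g * tang g v (mid (c b))
  - base g (mid (c b)) * ((tang g v ord0 + tang g v ord_max) / 2%:R).

(** Homogeneous in the null vector [g base_ray], whose last coordinate is
    [1 + |x|^2] at [nminus x].  The power of its sign has no effect there and
    corrects the character of [eps]. *)
Definition cone_coef g : R :=
  Num.sg (base g ord_max) ^+ (N + p + q + M + i + alpha)
  * ((base g ord_max)^-1 ^+ N * (base g (mid j1) / 2%:R) ^+ p
  * (base g (mid j2) / 2%:R) ^+ q * eta g ^+ M).

Definition cone_form g (s : seq V) : C :=
  Complex (cone_coef g * detform (theta g) s) 0.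

Lemma theta_lin g b (z : R) u v : theta g b (z *: u + v) = z * theta g b u + theta g b v.
Proof. by rewrite /theta tangent_lin mulmxDr -scalemxAr !mxE; ring. Qed.

Lemma base_elementary U k : elementary U (fun g => base g k).
Proof.
rewrite (_ : (fun g => _) = fun g : G => \sum_l g k l * base_ray R n l 0); last first.
  by apply/funext => g; rewrite mxE.
apply: elementary_sum => l.
by apply: elementaryM; [exact: elementary_coord|exact: elementary_cst].
Qed.

Lemma tang_elementary U v k : elementary U (fun g => tang g v k).
Proof.
rewrite (_ : (fun g => _) = fun g : G => \sum_l g k l * tangent v l 0); last first.
  by apply/funext => g; rewrite mxE.
apply: elementary_sum => l.
by apply: elementaryM; [exact: elementary_coord|exact: elementary_cst].
Qed.

Lemma half_elementary U (f : G -> R) : elementary U f -> elementary U (fun g => f g / 2%:R).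
Proof. by move=> ef; apply: elementaryM => //; apply: elementary_cst. Qed.

Lemma eta_elementary U : elementary U eta.
Proof. by apply: half_elementary; apply: elementaryD; apply: base_elementary. Qed.

Lemma theta_elementary U b v : elementary U (fun g => theta g b v).
Proof.
rewrite (_ : (fun g => _) = fun g => eta g * tang g v (mid (c b))
  + (-1) * (base g (mid (c b)) * ((tang g v ord0 + tang g v ord_max) / 2%:R))); last first.
  by apply/funext => g; rewrite mulN1r.
apply: elementaryD.
  by apply: elementaryM; [exact: eta_elementary|exact: tang_elementary].
apply: elementaryM; first exact: elementary_cst.
apply: elementaryM; first exact: base_elementary.
by apply: half_elementary; apply: elementaryD; apply: tang_elementary.
Qed.

Lemma cone_form_smooth s : smooth_on_G (fun g => cone_form g s).
Proof.
move=> g0 Gg0; set z := Num.sg (base g0 ord_max).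
have g0n := inG_base_neq0 Gg0.
have zz : z * z = 1 by rewrite -expr2 sqr_sg g0n.
pose U : set G := [set h | 0 < z * base h ord_max].
have eU : elementary setT (fun h : G => z * base h ord_max).
  by apply: elementaryM; [exact: elementary_cst|exact: base_elementary].
have oU : open U.
  have cU : continuous (fun h : G => z * base h ord_max).
    by move=> h; apply: (elementary_continuous eU).
  rewrite (_ : U = (fun h : G => z * base h ord_max) @^-1` [set y | 0 < y])//.
  by apply: open_comp => [h _|]; [exact: cU|exact: open_gt].
have sgU h : U h -> Num.sg (base h ord_max) = z.
  rewrite /U /= => /gtr0_sg; rewrite sgrM.
  have -> : Num.sg z = z by rewrite /z sgr_id.
  by move=> E; rewrite -[LHS]mul1r -zz -mulrA E mulr1.
exists U, (fun h => Complex (z ^+ (N + p + q + M + i + alpha)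
  * ((base h ord_max)^-1 ^+ N * (base h (mid j1) / 2%:R) ^+ p
  * (base h (mid j2) / 2%:R) ^+ q * eta h ^+ M) * detform (theta h) s) 0).
split=> //; first by rewrite /U /= /z -normrEsg normr_gt0.
- apply: elementary_smooth => //; apply: elementaryM.
    apply: elementaryM; first exact: elementary_cst.
    apply: elementaryM; last by apply: elementaryX; apply: eta_elementary.
    apply: elementaryM; last first.
      by apply: elementaryX; apply: half_elementary; apply: base_elementary.
    apply: elementaryM; last first.
      by apply: elementaryX; apply: half_elementary; apply: base_elementary.
    apply: elementaryX; apply: elementaryV => [|h]; first exact: base_elementary.
    by rewrite /U /=; apply: contraTneq => ->; rewrite mulr0 ltxx.
  rewrite /detform; case: eqP => sk; last exact: elementary_cst.
  by apply: elementary_det => a b; apply: theta_elementary.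
by move=> h _ Uh; rewrite /cone_form /cone_coef sgU.
Qed.

Let cexp_int (t : R) : cexp (- (lam%:~R * Complex t 0)) = Complex (expR (- (lam%:~R * t))) 0 :> C.
Proof.
have -> : lam%:~R = Complex lam%:~R 0 :> C by rewrite -(rmorph_int (real_complex R)).
rewrite /cexp /=; have -> : - (lam%:~R * 0 + 0 * t) = 0 :> R by ring.
have -> : - (lam%:~R * t - 0 * 0) = - (lam%:~R * t) :> R by ring.
by rewrite cos0 sin0 mulr1 mulr0.
Qed.

(** Homogeneity of the sections: each [theta] counts for one, and the exponent
    [M] of [eta] provides room for negative [lam]. *)
Hypothesis degree : (p + q + M + i)%:Z + lam = N.

Lemma cone_coef_scale (eps t : R) : eps ^+ 2 = 1 ->
  Num.sg eps ^+ (N + p + q + M + i + alpha)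
  * ((eps * expR t)^-1 ^+ N * (eps * expR t) ^+ p * (eps * expR t) ^+ q
     * (eps * expR t) ^+ M) * (eps * expR t) ^+ i
  = eps ^+ alpha * expR (- (lam%:~R * t)).
Proof.
move=> eps2.
have epsV : eps^-1 = eps.
  have e0 : eps != 0 by apply: contra_eqN eps2 => /eqP ->; rewrite expr0n /= eq_sym oner_eq0.
  by apply: (mulfI e0); rewrite divff// -expr2 eps2.
have sgeps : Num.sg eps = eps.
  have /eqP : (eps - 1) * (eps + 1) = 0 by rewrite -subr_sqr eps2 expr1n subrr.
  rewrite mulf_eq0 subr_eq0 addr_eq0 => /orP[]/eqP ->; first exact: sgr1.
  by rewrite sgrN1.
have eps_even l : eps ^+ (l + l) = 1 by rewrite addnn -mul2n exprM eps2 expr1n.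
have -> : expR (- (lam%:~R * t)) = (expR t)^-1 ^+ N * expR t ^+ (p + q + M + i).
  have -> : lam = N%:Z - (p + q + M + i)%:Z by lia.
  set K := (p + q + M + i)%N.
  have -> : - ((N%:Z - K%:Z)%:~R * t) = N%:R * (- t) + K%:R * t :> R.
    by rewrite intrB -!pmulrn; ring.
  by rewrite expRD !expRM_natl expRN.
rewrite sgeps invfM epsV !exprMn !exprD.
have -> : eps ^+ N * eps ^+ p * eps ^+ q * eps ^+ M * eps ^+ i * eps ^+ alpha
   * ((eps ^+ N * (expR t)^-1 ^+ N) * (eps ^+ p * expR t ^+ p) * (eps ^+ q * expR t ^+ q)
     * (eps ^+ M * expR t ^+ M)) * (eps ^+ i * expR t ^+ i)
  = eps ^+ (N + N) * eps ^+ (p + p) * eps ^+ (q + q) * eps ^+ (M + M) * eps ^+ (i + i)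
    * eps ^+ alpha
    * ((expR t)^-1 ^+ N * (expR t ^+ p * expR t ^+ q * expR t ^+ M * expR t ^+ i)).
  by rewrite !exprD; ring.
by rewrite !eps_even !mul1r.
Qed.

Lemma cone_form_equivariant g (eps : R) (B : 'M[R]_n) (t : R) X s :
  eps ^+ 2 = 1 -> in_nplus X ->
  cone_form (g *m Melt eps B *m expH0 n t *m expN X) s
  = Complex (eps ^+ alpha) 0 * cexp (- (lam%:~R * Complex t 0))
    * cone_form g [seq v *m B^T | v <- s].
Proof.
move=> eps2 nX; rewrite cexp_int; set g' := g *m _ *m _ *m _.
set z := eps * expR t.
have Eb k : base g' k = z * base g k by rewrite /g' parabolic_base// [LHS]mxE.
have Eeta : eta g' = z * eta g by rewrite /eta !Eb; field.
have Et b v : theta g' b v = z * theta g b (v *m B^T).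
  rewrite /theta; have [d Ed] := parabolic_tangent g eps B t v nX.
  have {}Ed k : tang g' v k = tang g (v *m B^T) k + d * base g k.
    by rewrite Ed [LHS]mxE [X in _ + X = _]mxE.
  by rewrite !Ed !Eb Eeta /eta; field.
have -> : cone_form g' s
    = Complex (z ^+ i * cone_coef g' * detform (theta g) [seq v *m B^T | v <- s]) 0.
  rewrite /cone_form (detform_scale (L := fun v => v *m B^T) s Et).
  by congr Complex; ring.
have -> : z ^+ i * cone_coef g' = eps ^+ alpha * expR (- (lam%:~R * t)) * cone_coef g.
  rewrite -(cone_coef_scale t eps2) /cone_coef !Eb Eeta -/z !sgrM.
  rewrite (gtr0_sg (expR_gt0 t)) mulr1 [(z * base g ord_max)^-1]invfM.
  by rewrite -![z * _ / 2%:R]mulrA !exprMn; ring.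
rewrite /cone_form; apply/eqP; rewrite eq_complex /=; apply/andP; split; apply/eqP; ring.
Qed.

Lemma cone_form_nminus x s : cone_form (nminus x) s
  = Complex (x 0 j1 ^+ p * x 0 j2 ^+ q * decay N x * coord_form s) 0.
Proof.
have [b0 b1 bj] := base_rayE R n; have [q0 q1 qj] := opp_rayE R n.
have Eb k : base (nminus x) k
    = base_ray R n k 0 + 2%:R * tangent x k 0 + dotv x x * opp_ray R n k 0.
  by rewrite nminus_base [LHS]mxE [X in X + _ = _]mxE [X in _ + X + _ = _]mxE
    [X in _ + X = _]mxE.
have Et v k : tang (nminus x) v k = tangent v k 0 + dotv x v * opp_ray R n k 0.
  by rewrite nminus_tangent [LHS]mxE [X in _ + X = _]mxE.
have E0 : base (nminus x) ord0 = 1 - dotv x x.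
  by rewrite Eb b0 q0 tangent_ord0; ring.
have E1 : base (nminus x) ord_max = 1 + dotv x x.
  by rewrite Eb b1 q1 tangent_ord_max; ring.
have Ej j : base (nminus x) (mid j) = 2%:R * x 0 j.
  by rewrite Eb bj qj tangent_mid; ring.
have Eeta : eta (nminus x) = 1 by rewrite /eta E0 E1; field.
have Eth b v : theta (nminus x) b v = v 0 (c b).
  by rewrite /theta Eeta !Et q0 q1 qj tangent_mid tangent_ord0 tangent_ord_max; field.
have half_double (z : R) : 2%:R * z / 2%:R = z by field.
rewrite /cone_form /cone_coef E1 (gtr0_sg (decay_base_gt0 x)) expr1n mul1r Eeta expr1n.
rewrite !Ej !half_double /decay /coord_form (_ : theta (nminus x) = fun b v => v 0 (c b)).
  by congr Complex; ring.
by apply/funext => b; apply/funext => v; rewrite Eth.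
Qed.

Lemma cone_form_principal : principal_series i lam%:~R alpha cone_form.
Proof.
rewrite /principal_series /=; split=> [g Gg|s|g eps B t X Gg eps2 BB nX s].
- by apply: detform_alternating => b z u v; apply: theta_lin.
- exact: cone_form_smooth.
- exact: cone_form_equivariant.
Qed.

Definition coord_form_C s : C := Complex (coord_form s) 0.

Definition test_form : seq V -> smoothfun V :=
  tens coord_form_C (mono (xmul j1) (xmul j2) p q (decay_sf N)).

Let iter_xmul j (F : smoothfun V) (l : nat) x :
  iter l (xmul j) F x = Complex (x 0 j ^+ l) 0 * F x.
Proof.
elim: l => [|l IHl]; first by rewrite expr0 mul1r.
rewrite iterS [LHS]/(coordmul j (iter l (xmul j) F) x) /coordmul IHl mulrA exprS.
by congr (_ * _); apply/eqP; rewrite eq_complex /=; apply/andP; split; apply/eqP; ring.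
Qed.

Lemma test_formE s x : test_form s x
  = Complex (x 0 j1 ^+ p * x 0 j2 ^+ q * decay N x * coord_form s) 0.
Proof.
rewrite /test_form /tens sfunZ /mono !iter_xmul /=.
by apply/eqP; rewrite eq_complex /=; apply/andP; split; apply/eqP; ring.
Qed.

Lemma test_form_flatI : flatI i lam%:~R alpha (fun x s => test_form s x).
Proof.
split.
  split=> [x|s]; last exact: (sfunP (test_form s)).
  have -> : (fun s => test_form s x)
    = (fun s => Complex ((x 0 j1 ^+ p * x 0 j2 ^+ q * decay N x) * coord_form s) 0).
    by apply/funext => s; rewrite test_formE.
  by apply: detform_alternating => b z u v; rewrite !mxE.
exists cone_form; first exact: cone_form_principal.
by move=> x s; rewrite cone_form_nminus test_formE.
Qed.

End TestFormsInPrincipalSeries.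

(** * The eight compositions *)

Section HyperplaneRestriction.
Variables (R : realType) (m : nat).
Local Notation n := m.+2.
Local Notation C := (complex R).
Local Notation V := 'rV[R]_n.
Local Notation S := (smoothfun V).
Local Notation incl := (@hyperplane_incl R n).
Local Notation nu := (normal_vec R n).
Local Notation e := (@tvec R m.+1).
Local Notation eb := (@basis_vec R n).
Local Notation D := (@sderive_lin R V).
Local Notation DC := (@sderiveC R V).
Local Notation SB := (@sum_basis_vec R m.+1).
Local Notation geg := (geg D e nu).
Local Notation opd := (op_down D e nu eb).
Local Notation ops := (op_same D e nu eb).
Local Notation ed := (ed D).
Local Notation cdb := (cd D eb).
Local Notation cdt := (cd D e).
Local Notation jets_eq := (jets_eq D (fun F : S => F 0)).
Local Notation xt t := (xmul (widen_ord (leqnSn m.+1) t)).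
Local Notation xn := (xmul (ord_max : 'I_n)).
Local Notation one := (decay_sf R n 0).
Local Notation M t p q := (mono (xt t) xn p q one).
Local Notation I i lam := (@flatI R n i lam%:~R i).
Local Notation gv := (geg_value R).
Implicit Types (W X : seq V -> S) (F : S) (u v : V) (s r : seq V) (t : 'I_m.+1)
  (p q : nat) (o : bool) (mu kappa : C).

Lemma basis_coord t (k : 'I_n) : e t 0 k = (nat_of_ord k == t)%:R.
Proof. by rewrite tvecE mxE eqxx /= -val_eqE. Qed.

Lemma normal_coord (k : 'I_n) : nu 0 k = (nat_of_ord k == m.+1)%:R.
Proof. by rewrite mxE. Qed.

Lemma incl0 : incl 0 = 0.
Proof. by apply/rowP => j; rewrite !mxE; case: insub => //= k; rewrite mxE. Qed.

Section CoordinateForm.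
Variables (i : nat) (c : 'I_i -> 'I_n).

Lemma coord_form_eq0 v r : (forall b, v 0 (c b) = 0) -> coord_form_C c (v :: r) = 0.
Proof.
move=> v0; rewrite /coord_form_C /coord_form /detform; case: eqP => // si.
case: i c v0 si => // i' c' v0 si; rewrite (expand_det_row _ ord0) big1// => b _.
by rewrite mxE /= v0 mul0r.
Qed.

Lemma coord_form_eq1 s : size s = i ->
  (forall a b : 'I_i, nth 0 s a 0 (c b) = (a == b)%:R) -> coord_form_C c s = 1.
Proof.
move=> si s1; rewrite /coord_form_C /coord_form /detform si eqxx.
rewrite (_ : \matrix_(_, _) _ = 1%:M) ?det1//.
by apply/matrixP => a b; rewrite !mxE s1.
Qed.

Lemma coord_form_antisym s r u v :
  coord_form_C c (s ++ u :: v :: r) = - coord_form_C c (s ++ v :: u :: r).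
Proof.
apply: (@alternating_antisym R n i).
have -> : coord_form_C c
    = (fun s => Complex (1 * detform (fun b (v : V) => v 0 (c b)) s) 0).
  by apply/funext => s'; rewrite mul1r.
by apply: detform_alternating => b z u' v'; rewrite !mxE.
Qed.

End CoordinateForm.

(** The indices of [dx_1 /\ .. /\ dx_i] and of [dx_n /\ dx_1 /\ .. /\ dx_(i-1)]. *)
Definition tang_idx i (b : 'I_i) : 'I_n := inord b.
Definition norm_idx i (b : 'I_i) : 'I_n :=
  if nat_of_ord b == 0%N then ord_max else inord b.-1.
Definition idx_range (l k : nat) : seq 'I_m.+1 := [seq inord b | b <- iota l k].
Definition first_vecs (k : nat) : seq V := map e (idx_range 0 k).

Lemma tang_idx_val i (b : 'I_i) : (i <= m.+1)%N -> nat_of_ord (@tang_idx i b) = b.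
Proof. by move=> im; rewrite inordK//; have := ltn_ord b; lia. Qed.

Lemma norm_idx_val i (b : 'I_i) : (i <= m.+2)%N ->
  nat_of_ord (@norm_idx i b) = if nat_of_ord b == 0%N then m.+1 else b.-1.
Proof.
move=> im; rewrite /norm_idx; case: ifP => //= b0; rewrite inordK//.
by have := ltn_ord b; lia.
Qed.

Lemma first_vecs_nth k (a : nat) (l : 'I_n) : (a < k)%N -> (k <= m.+1)%N ->
  nth 0 (first_vecs k) a 0 l = (nat_of_ord l == a)%:R.
Proof.
move=> ak km; rewrite /first_vecs -map_comp (nth_map 0%N) ?size_iota// nth_iota// basis_coord add0n.
by rewrite inordK//; apply: leq_trans km.
Qed.

Lemma size_first_vecs k : size (first_vecs k) = k.
Proof. by rewrite !size_map size_iota. Qed.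

Lemma first_vecsS k : first_vecs k.+1 = e ord0 :: map e (idx_range 1 k).
Proof.
rewrite /first_vecs /idx_range /=; congr (e _ :: _).
by apply: val_inj; rewrite /= inordK.
Qed.

Section Tangential.
Variable i : nat.
Local Notation phi := (coord_form_C (@tang_idx i)).

Lemma tang_phi_nu r : (i <= m.+1)%N -> phi (nu :: r) = 0.
Proof.
move=> im; apply: coord_form_eq0 => b; rewrite normal_coord tang_idx_val//.
by rewrite ltn_eqF//; apply: leq_trans im.
Qed.

Lemma tang_phi_max r : (i <= m)%N -> phi (e ord_max :: r) = 0.
Proof.
move=> im; apply: coord_form_eq0 => b; rewrite basis_coord tang_idx_val ?leqW//.
by rewrite ltn_eqF//; apply: leq_trans im.
Qed.

Lemma tang_phi_first : (i <= m.+1)%N -> phi (first_vecs i) = 1.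
Proof.
move=> im; apply: coord_form_eq1 => [|a b]; first exact: size_first_vecs.
by rewrite first_vecs_nth// tang_idx_val// eq_sym.
Qed.

End Tangential.

Section Normal.
Variable i : nat.
Local Notation phi := (coord_form_C (@norm_idx i.+1)).

Lemma norm_phi_max r : (i <= m)%N -> phi (e ord_max :: r) = 0.
Proof.
move=> im; apply: coord_form_eq0 => b; rewrite basis_coord norm_idx_val//.
  case: ifP => [_|/eqP b0] /=; first by rewrite gtn_eqF.
  by have := ltn_ord b => bi; rewrite (_ : (_ == _) = false)//; apply/eqP; lia.
by lia.
Qed.

Lemma norm_phi_first : (i <= m.+1)%N -> phi (nu :: first_vecs i) = 1.
Proof.
move=> im; apply: coord_form_eq1 => [|a b]; first by rewrite /= size_first_vecs.
case: a => -[|a] ai; rewrite /= -val_eqE /= ?normal_coord ?first_vecs_nth//.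
  rewrite norm_idx_val//; case: b => -[|b] bi /=; first by rewrite eqxx.
  by rewrite ltn_eqF//; lia.
rewrite norm_idx_val//; case: b => -[|b] bi /=; last by rewrite eqSS eq_sym.
by rewrite gtn_eqF//; lia.
Qed.

End Normal.

(** Reduction of nonvanishing to a computation with polynomial coefficients:
    multiplying a monomial of degree [p + q] by a power of [1 + |x|^2] puts it
    in the principal series without changing its jet of that order at 0. *)
Lemma vanishes_on_mono (A : dform R n -> dform R n.-1) (O : (seq V -> S) -> seq V -> S)
    i (c : 'I_i -> 'I_n) t p q (lam : int) (alpha : nat) (js : seq 'I_m.+1) :
  (forall W, A (toform W) = Rest (toform (O W))) ->
  (forall W X, jets_eq (p + q) W X -> jets_eq 0 (O W) (O X)) ->
  vanishes_on (flatI i lam%:~R alpha) A ->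
  O (tens (coord_form_C c) (M t p q)) (map e js) 0 = 0.
Proof.
move=> AO jetO van.
(* The factor [eta ^+ K], which is 1 in the flat picture, makes [N] nonnegative. *)
pose K := absz lam; pose N := absz ((p + q + K + i)%N%:Z + lam).
have deg : (p + q + K + i)%:Z + lam = N by rewrite /N /K; lia.
have := van _ (test_form_flatI R c (widen_ord (leqnSn m.+1) t) ord_max alpha deg)
  0 (map (@basis_vec R m.+1) js).
have -> : (fun x s' => test_form c (widen_ord (leqnSn m.+1) t) ord_max p q N s' x)
  = toform (test_form c (widen_ord (leqnSn m.+1) t) ord_max p q N) by [].
rewrite AO /Rest /toform incl0 -map_comp => <-; symmetry.
set W1 := tens _ _; set W2 := test_form _ _ _ _ _ _.
suff J : jets_eq (p + q) W1 W2 by exact/esym/(jet_eq0 (jetO _ _ J (map e js))).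
apply: jets_tens => [//|].
apply: (@jet_mono R S V D (fun F => F 0) _ _ (xt t) xn
  (fun v => Complex (v 0 (widen_ord (leqnSn m.+1) t)) 0)
  (fun v => Complex (v 0 ord_max) 0)) => [//|//|F|F|v F|v F|].
- exact: xmul_origin.
- exact: xmul_origin.
- exact: sderive_xmul.
- exact: sderive_xmul.
- by rewrite !decay_origin.
Qed.

Let ct t v : C := Complex (v 0 (widen_ord (leqnSn m.+1) t)) 0.
Let cn v : C := Complex (v 0 ord_max) 0.

Let ct_e t j : ct t (e j) = (j == t)%:R.
Proof. by rewrite /ct basis_coord /= [j == t]eq_sym -val_eqE /=; case: (_ == _). Qed.
Let ct_nu t : ct t nu = 0.
Proof. by rewrite /ct normal_coord /= ltn_eqF. Qed.
Let cn_e j : cn (e j) = 0.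
Proof. by rewrite /cn basis_coord /= gtn_eqF. Qed.
Let cn_nu : cn nu = 1.
Proof. by rewrite /cn normal_coord /= eqxx. Qed.
Let D_one v : D v one = 0.
Proof.
apply: sfunI; apply/funext => x; rewrite /= /cderive.
have -> : re_fun (fun x : V => Complex (decay 0 x) 0) = cst 1 by [].
have -> : im_fun (fun x : V => Complex (decay 0 x) 0) = cst 0 by [].
by rewrite !derive_cst.
Qed.

Let D_xt t v F : D v (xt t F) = ct t v *: F + xt t (D v F).
Proof. exact: sderive_xmul. Qed.
Let D_xn v F : D v (xn F) = cn v *: F + xn (D v F).
Proof. exact: sderive_xmul. Qed.
Let xtZ t (c : C) F : xt t (c *: F) = c *: xt t F. Proof. exact: xmulZ. Qed.
Let xnZ (c : C) F : xn (c *: F) = c *: xn F. Proof. exact: xmulZ. Qed.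
Let ct_t t : ct t (e t) = 1. Proof. by rewrite ct_e eqxx. Qed.
Let ct_neq t j : j != t -> ct t (e j) = 0.
Proof. by rewrite ct_e => /negPf ->. Qed.
Let one0 : one 0 = 1. Proof. exact: decay_origin. Qed.

Lemma mono_Dt t p q : D (e t) (M t p q) = p%:R *: M t p.-1 q.
Proof. exact: (D_mono_t (@D_xt t) D_xn D_one (@xtZ t) xnZ (ct_t t) cn_e). Qed.

Lemma mono_dep t p q : depends_on_t D e t (M t p q).
Proof. exact: (depends_mono (@D_xt t) D_xn D_one (@xtZ t) xnZ (@ct_neq t) cn_e). Qed.

Lemma mono_Dnu t p q : D nu (M t p q) = q%:R *: M t p q.-1.
Proof. exact: (D_mono_nu (@D_xt t) D_xn D_one (@xtZ t) xnZ (ct_nu t) cn_nu). Qed.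

Lemma mono_lapt t p q : lap D e (M t p q) = (p * p.-1)%:R *: M t p.-2 q.
Proof.
exact: (lapt_mono (@D_xt t) D_xn D_one (@xtZ t) xnZ (ct_t t) (@ct_neq t) cn_e).
Qed.

Lemma mono_lapb t p o : lap D eb (M t p o) = (p * p.-1)%:R *: M t p.-2 o.
Proof.
rewrite (lap_basis D SB) mono_lapt !mono_Dnu linearZ /= mono_Dnu.
by case: o; rewrite ?scale0r ?scaler0 addr0.
Qed.

Lemma mono_geg t mu (l : int) (b : nat) o : l = (b.*2 + o)%N ->
  geg mu l (M t b.*2 o) 0 = geg_value R b o.
Proof.
move=> ->.
exact: (E_geg_mono (E := fun F : S => F 0) DC (fun _ _ => erefl) (fun _ _ => erefl)
  (fun F => xmul_origin _ F) (fun F => xmul_origin _ F) (@D_xt t) D_xn D_one one0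
  (@xtZ t) xnZ (ct_t t) (@ct_neq t) (ct_nu t) cn_e cn_nu).
Qed.

Lemma mono0 t : M t 0 0 0 = 1. Proof. exact: one0. Qed.

Lemma flatI_toform i lam alpha w : flatI i lam alpha w ->
  exists2 W : seq V -> S, w = toform W & antisym W /\ (forall s, size s != i -> W s = 0).
Proof. by move=> [/smooth_forms_toform]. Qed.

Section Operators.
Variables (i a : nat) (u : C) (W : seq V -> S).

Let mu : C := u + i%:R - (n%:R - 1) / 2%:R.

Lemma Dt_down_zero : Dt_down i u 0 (toform W) = Rest (toform (fun s => W (nu :: s))).
Proof. by []. Qed.

Lemma Dt_same_zero : Dt_same i u 0 (toform W) = Rest (toform W).
Proof. by []. Qed.

Lemma Dt_down_mid : (0 < a)%N -> i != n -> Dt_down i u a (toform W)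
  = Rest (toform (opd mu ((u + 2%:R * i%:R - n%:R) / 2%:R) a W)).
Proof. by rewrite /Dt_down lt0n => /negPf -> /negPf ->; rewrite D_down_toform. Qed.

Lemma Dt_same_mid : (0 < a)%N -> (0 < i)%N -> Dt_same i u a (toform W)
  = Rest (toform (ops mu ((u + a%:R) / 2%:R) a W)).
Proof. by rewrite /Dt_same !lt0n => /negPf -> /negPf ->; rewrite D_same_toform. Qed.

Lemma Dt_down_top : (0 < a)%N -> Dt_down n u a (toform W)
  = Rest (toform (fun s => geg (u + (n%:R + 1) / 2%:R) a (W (nu :: s)))).
Proof.
rewrite /Dt_down lt0n => /negPf ->; rewrite eqxx.
by rewrite (contract_toform nu W) coefwise_toform.
Qed.

Lemma Dt_same_bot : (0 < a)%N -> Dt_same 0 u a (toform W)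
  = Rest (toform (fun s => geg (u - (n%:R - 1) / 2%:R) a (W s))).
Proof. by rewrite /Dt_same lt0n => /negPf ->; rewrite coefwise_toform. Qed.

End Operators.

Lemma Dt_up_toform (u : int) W : Dt_up u (toform W)
  = Rest (toform (fun s => geg (u%:~R - (n%:R - 1) / 2%:R) (- u) (ed W s))).
Proof. by rewrite /Dt_up ext_d_toform coefwise_toform. Qed.

Lemma Dt_down2_toform i (u : int) W : Dt_down2 i u (toform W)
  = Rest (toform (fun s => geg (u%:~R + (n%:R + 1) / 2%:R) (- u + n%:Z - 2 * i%:Z)
                    (cdb W (nu :: s)))).
Proof.
rewrite /Dt_down2 codiff_toform (contract_toform nu (cdb W)).
by rewrite coefwise_toform.
Qed.

Let addE (F G : S) : (F + G) 0 = F 0 + G 0. Proof. by []. Qed.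
Let scaleE (c : C) (F : S) : (c *: F) 0 = c * F 0. Proof. by []. Qed.

Lemma jets_down k mu kappa a W X : (0 < a)%N -> jets_eq (a + k) W X ->
  jets_eq k (opd mu kappa a W) (opd mu kappa a X).
Proof. exact: (jets_op_down e nu eb addE scaleE). Qed.

Lemma jets_same k mu kappa a W X : (0 < a)%N -> jets_eq (a + k) W X ->
  jets_eq k (ops mu kappa a W) (ops mu kappa a X).
Proof. exact: (jets_op_same e nu eb addE scaleE). Qed.

Lemma jets_d k W X : jets_eq k.+1 W X -> jets_eq k (ed W) (ed X).
Proof. exact: (jets_ed addE scaleE). Qed.

Lemma jets_cdb k W X : jets_eq k.+1 W X -> jets_eq k (cdb W) (cdb X).
Proof. exact: (jets_cd addE scaleE). Qed.

Lemma jets_cdt k W X : jets_eq k.+1 W X -> jets_eq k (cdt W) (cdt X).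
Proof. exact: (jets_cd addE scaleE). Qed.

Lemma jets_geg k mu (a : nat) W X : jets_eq (a + k) W X ->
  jets_eq k (fun s => geg mu a (W s)) (fun s => geg mu a (X s)).
Proof. by move=> WX s; exact: (jet_geg e nu addE scaleE mu (WX s)). Qed.

Lemma jets_iota k W X : jets_eq k W X ->
  jets_eq k (fun s => W (nu :: s)) (fun s => X (nu :: s)).
Proof. by move=> WX s; apply: WX. Qed.

Lemma parity (a : nat) : exists b o, a = (b.*2 + nat_of_bool o)%N.
Proof. by exists a./2, (odd a); rewrite addnC odd_double_half. Qed.

Lemma geg_scale mu l c F : geg mu l (c *: F) = c *: geg mu l F.
Proof. exact: (gegZ DC). Qed.

Lemma natr_eq_of_mul (c : C) (x y : nat) :
  c != 0 -> c * (x%:R - y%:R) = 0 -> x = y.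
Proof.
by move=> c0 /eqP; rewrite mulf_eq0 (negPf c0) subr_eq0 eqr_nat => /eqP.
Qed.

Lemma down_d_vanish a i : [/\ ~~ odd n, (2 * i < n - 2)%N & a = (n - 2 * i - 2)%N] ->
  vanishes_on (I i i%:Z) (Dt_down i.+1 0 a \o @ext_d R n).
Proof.
move=> [evn lt_i def_a] w /flatI_toform[W -> _] x s.
have [c ac] : exists c, a = c.*2.+2 by exists (a./2.-1); lia.
rewrite /= ext_d_toform Dt_down_mid; [|lia|by apply/eqP; lia].
have mE : m%:R = 2%:R * i%:R + 2%:R * c%:R + 2%:R :> C.
  by rewrite (_ : m = (2 * i + 2 * c + 2)%N) ?(natrD, natrM)//; lia.
have muE : 0 + i.+1%:R - (n%:R - 1) / 2%:R = 1 / 2%:R - c.+1%:R :> C.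
  by rewrite -[m.+2]addn2 natrD mE -!natr1; field.
have kE : (0 + 2%:R * i.+1%:R - n%:R) / 2%:R = - c.+1%:R :> C.
  by rewrite -[m.+2]addn2 natrD mE -!natr1; field.
by rewrite muE kE ac /Rest /toform (op_down_ed DC SB).
Qed.

(** For [i < n - 1] the form is [dx_1 .. dx_i] with the coefficient
    [x_t^(a + 1)] for odd [a] and [x_t^a x_n] for even [a], with [t] outside of
    the form.  In the even case the two terms add up to a multiple of
    [2 (i + 1) + a - n]. *)
Lemma down_d_vanish_inv a i : (i <= n - 1)%N ->
  vanishes_on (I i i%:Z) (Dt_down i.+1 0 a \o @ext_d R n) ->
  [/\ ~~ odd n, (2 * i < n - 2)%N & a = (n - 2 * i - 2)%N].
Proof.
move=> lei; have im : (i <= m.+1)%N by lia.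
have phi1 := @tang_phi_first i im.
have phi_nu r := @tang_phi_nu i r im.
have [->|a0] := posnP a => van.
  have : ed (tens (coord_form_C (@tang_idx i)) (M ord0 0 1)) (nu :: first_vecs i) 0 = 0.
    apply: (@vanishes_on_mono _ (fun W s => ed W (nu :: s)) i (@tang_idx i) ord0
      0 1 i%:Z i (idx_range 0 i) _ _ van) => [W|W X WX].
      by rewrite /= ext_d_toform Dt_down_zero.
    by apply: jets_iota; apply: jets_d.
  rewrite (test_ed_nu D _ phi_nu phi1) mono_Dnu sfunZ mono0 mulr1 => /eqP.
  by rewrite oner_eq0.
have [i_n|i_n] := eqVneq i.+1 n.
  have [b [c def_a]] := parity a.
  have : geg (0 + (n%:R + 1) / 2%:R) a
    (ed (tens (coord_form_C (@tang_idx i)) (M ord0 b.*2 c.+1)) (nu :: first_vecs i)) 0 = 0.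
    apply: (@vanishes_on_mono _
      (fun W s => geg (0 + (n%:R + 1) / 2%:R) a (ed W (nu :: s))) i
      (@tang_idx i) ord0 b.*2 c.+1 i%:Z i (idx_range 0 i) _ _ van) => [W|W X WX].
      by rewrite /= ext_d_toform i_n Dt_down_top.
    apply: jets_geg; apply: (@jets_iota _ (ed W) (ed X)); apply: jets_d.
    by rewrite addn0 def_a -addnS.
  rewrite (test_ed_nu D _ phi_nu phi1) mono_Dnu geg_scale sfunZ mono_geg ?def_a//.
  by move=> /eqP; rewrite mulf_eq0 pnatr_eq0 /= (negPf (geg_value_neq0 R _ _)).
have i_m : (i <= m)%N by lia.
have phi_t r := @tang_phi_max i r i_m.
set mu : C := 0 + i.+1%:R - (n%:R - 1) / 2%:R.
set kappa : C := (0 + 2%:R * i.+1%:R - n%:R) / 2%:R.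
have test p q : (p + q = a.+1)%N -> opd mu kappa a
    (ed (tens (coord_form_C (@tang_idx i)) (M ord_max p q))) (first_vecs i) 0 = 0.
  move=> pq; apply: (@vanishes_on_mono _ (fun W => opd mu kappa a (ed W)) i
    (@tang_idx i) ord_max p q i%:Z i (idx_range 0 i) _ _ van).
    by move=> W; rewrite /= ext_d_toform Dt_down_mid.
  by move=> W X; rewrite pq => WX; apply: jets_down => //; apply: jets_d; rewrite addn0.
have testE p o : (p.+2 + o = a.+1)%N ->
    gamma mu a * ((p.+2 * p.+1)%:R * geg (mu + 1) (a%:Z - 1) (M ord_max p o) 0)
    + kappa * (o%:R * geg mu a (M ord_max p.+2 false) 0) = 0.
  move=> po; have := test p.+2 o po.
  rewrite (test_down_ed DC SB (@mono_dep _ _ _) phi_nu phi_t phi1) mono_lapb mono_Dnu.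
  by rewrite !geg_scale sfunD !sfunZ; case: o {po}; rewrite // !mul0r.
have [b [c def_a]] := parity a.
case: c def_a => def_a.
  have /testE : (b.*2.+2 + false = a.+1)%N by lia.
  rewrite mul0r mulr0 addr0 (@mono_geg _ _ _ b false); last by lia.
  rewrite /gamma (_ : odd a) ?mul1r; last by lia.
  by move=> /eqP; rewrite mulf_eq0 (negPf (geg_value_neq0 R _ _)) pnatr_eq0.
case: b def_a => [|b] def_a; first by lia.
have /testE : (b.*2.+2 + true = a.+1)%N by lia.
rewrite (@mono_geg _ _ _ b true); last by lia.
rewrite (@mono_geg _ _ _ b.+1 false); last by lia.
rewrite geg_value1 geg_valueS /gamma (_ : odd a = false); last by lia.
move: (gv b false) (geg_value_neq0 R b false) => g g0 E.
have : (i.+1.*2 + a = n)%N.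
  apply: (@natr_eq_of_mul (2%:R * b.*2.+1%:R * g * (b.*2.+3%:R / 2%:R))).
    by rewrite !mulf_eq0 !negb_or !invr_eq0 !pnatr_eq0 g0.
  rewrite -[RHS]E /mu /kappa def_a addn0 !doubleS -!mul2n natrD !natrM -!natr1 !natrM.
  by field.
by move=> ?; split; [apply/negP => ?|..]; lia.
Qed.

Lemma down_d_eq_same : ~~ odd n -> n <> 2%N ->
  agree_on (I (n - 2)./2 (n - 2)./2%:Z) (Dt_down n./2 0 0 \o @ext_d R n)
    (Dt_same (n - 2)./2 0 1).
Proof.
move=> evn n2 w /flatI_toform[W -> _] x s.
rewrite /= ext_d_toform Dt_down_zero Dt_same_mid //; last by lia.
rewrite /Rest /toform op_same1 iota_ed add0r mulrCA mulfV ?pnatr_eq0// mulr1.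
by rewrite scale1r addrC.
Qed.

Lemma same_d_vanish a i : (0 < a)%N ->
  vanishes_on (I i i%:Z) (Dt_same i.+1 0 a \o @ext_d R n).
Proof.
move=> a0 w /flatI_toform[W -> _] x s.
rewrite /= ext_d_toform Dt_same_mid// /Rest /toform !add0r.
by rewrite (op_same_ed DC SB).
Qed.

(** At [a = 0] the operator is the restriction, and [d (x_t dx_1 .. dx_i)]
    has no normal part. *)
Lemma same_d_vanish_inv a i : (i <= n - 2)%N ->
  vanishes_on (I i i%:Z) (Dt_same i.+1 0 a \o @ext_d R n) -> (0 < a)%N.
Proof.
move=> lei; have im : (i <= m)%N by lia.
case: a => // van.
have : ed (tens (coord_form_C (@tang_idx i)) (M ord_max 1 0))
    (e ord_max :: first_vecs i) 0 = 0.
  apply: (@vanishes_on_mono _ ed i (@tang_idx i) ord_max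
    1 0 i%:Z i (ord_max :: idx_range 0 i) _ _ van) => [W|W X WX].
    by rewrite /= ext_d_toform Dt_same_zero.
  exact: jets_d.
rewrite (test_ed_t D _ (fun r => tang_phi_max r im) (tang_phi_first (leqW im))).
by rewrite mono_Dt sfunZ mono0 mulr1 => /eqP; rewrite oner_eq0.
Qed.

Lemma same_d_eq_up i : agree_on (I i i%:Z) (Dt_same i.+1 0 0 \o @ext_d R n) (@Dt_up R n 0).
Proof.
move=> w /flatI_toform[W -> _] x s.
by rewrite /= ext_d_toform Dt_same_zero Dt_up_toform /Rest /toform oppr0 geg0.
Qed.

Lemma mono_Dt2 t p q :
  D (e t) (D (e t) (M t p.+2 q)) = (p.+2%:R * p.+1%:R) *: M t p q.
Proof.
have DZ c F : D (e t) (c *: F) = c *: D (e t) F by exact: linearZ.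
by rewrite mono_Dt DZ mono_Dt scalerA.
Qed.

Let parE (i : nat) : (n%:Z - 2 * i%:Z + 2)%:~R = n%:R - 2%:R * i%:R + 2%:R :> C.
Proof. by rewrite !(intrD, intrM, intrN) -!pmulrn. Qed.

Let natr_pred (i : nat) : (0 < i)%N -> i.-1%:R = i%:R - 1 :> C.
Proof. by case: i => // i _; rewrite -natr1 addrK. Qed.

Lemma same_codiff_vanish a i :
  [/\ ~~ odd n, (n + 2 < 2 * i)%N & a = (2 * i - n - 2)%N] ->
  vanishes_on (I i (n%:Z - i%:Z))
    (Dt_same i.-1 (n%:Z - 2 * i%:Z + 2)%:~R a \o @codiff R n).
Proof.
move=> [evn lt_i def_a] w /flatI_toform[W -> [aW _]] x s.
have [c ac] : exists c, a = c.*2.+2 by exists (a./2.-1); lia.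
rewrite /= codiff_toform Dt_same_mid; [|lia|lia].
have iE : 2%:R * i%:R = n%:R + 2%:R * c%:R + 4%:R :> C.
  by rewrite -natrM (_ : (2 * i = n + 2 * c + 4)%N) ?(natrD, natrM)//; lia.
rewrite (_ : (_ + a%:R) / 2%:R = 0); last first.
  by rewrite parE iE ac -!natr1 -mul2n natrM; field.
rewrite /Rest /toform (op_same_cd DC)// /gamma (_ : odd a = false); last by lia.
rewrite parE natr_pred; last by lia.
rewrite (_ : i%:R = (2%:R * i%:R) / 2%:R); last by field.
by rewrite iE ac -!natr1 -mul2n natrM; field.
Qed.

(** The form is [dx_n dx_1 .. dx_(i-1)]; for [i = 1] the operator is the scalar
    [geg], and [N] of the coefficient is detected.  For [i > 1], [t] is the first
    index of the form: for even [a > 0] the coefficient [x_t^a x_n] gives a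
    multiple of [n + 2 + a - 2 i], for odd [a] the coefficient is
    [x_t^(a + 1)]. *)
Lemma same_codiff_vanish_inv a i : (1 <= i <= n)%N ->
  vanishes_on (I i (n%:Z - i%:Z))
    (Dt_same i.-1 (n%:Z - 2 * i%:Z + 2)%:~R a \o @codiff R n) ->
  [/\ ~~ odd n, (n + 2 < 2 * i)%N & a = (2 * i - n - 2)%N].
Proof.
case: i => // i /andP[_ lein]; rewrite [i.+1.-1]/= => van.
have im : (i <= m.+1)%N by lia.
have aphi := @coord_form_antisym i.+1 (@norm_idx i.+1).
have phi1 := norm_phi_first im.
have [b [c def_a]] := parity a.
case: i im lein van aphi phi1 => [|i] im lein; set u : C := (_ + 2)%:~R => van aphi phi1.
  set phi := coord_form_C _ in aphi phi1.
  have phi_t r : phi (e ord_max :: r) = 0 by apply: norm_phi_max.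
  have cdbE p q := test_cdb_normal SB (@mono_dep ord_max p q) phi1 phi_t.
  have [a0|a0] := posnP a.
    subst a; have : cdb (tens phi (M ord_max 0 1)) (first_vecs 0) 0 = 0.
      apply: (@vanishes_on_mono _ cdb 1 (@norm_idx 1) ord_max 0 1 _ 1
        (idx_range 0 0) _ _ van) => [W|W X WX].
        by rewrite a0 /= codiff_toform Dt_same_zero.
      exact: jets_cdb.
    rewrite cdbE mono_Dnu sfunN sfunZ mono0 mulr1 => /eqP.
    by rewrite oppr_eq0 oner_eq0.
  have : geg (u - (n%:R - 1) / 2%:R) a
      (cdb (tens phi (M ord_max b.*2 c.+1)) (first_vecs 0)) 0 = 0.
    apply: (@vanishes_on_mono _ (fun W s => geg (u - (n%:R - 1) / 2%:R) a (cdb W s))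
      1 (@norm_idx 1) ord_max b.*2 c.+1 _ 1 (idx_range 0 0) _ _ van) => [W|W X WX].
      by rewrite /= codiff_toform Dt_same_bot.
    by apply: jets_geg; apply: jets_cdb; rewrite addn0 def_a -addnS.
  rewrite cdbE mono_Dnu (gegN DC) geg_scale sfunN sfunZ mono_geg ?def_a//.
  by move=> /eqP; rewrite oppr_eq0 mulf_eq0 pnatr_eq0 /= (negPf (geg_value_neq0 R _ _)).
rewrite first_vecsS in phi1; set phi := coord_form_C _ in aphi phi1.
have [a0|a0] := posnP a.
  have : cdb (tens phi (M ord0 0 1)) (e ord0 :: map e (idx_range 1 i)) 0 = 0.
    apply: (@vanishes_on_mono _ cdb i.+2 (@norm_idx i.+2) ord0 0 1 _ i.+2
      (ord0 :: idx_range 1 i) _ _ van) => [W|W X WX].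
      by rewrite a0 /= codiff_toform Dt_same_zero.
    exact: jets_cdb.
  rewrite (test_cdb SB aphi (@mono_dep _ _ _) phi1) mono_Dnu sfunN sfunZ mono0.
  by rewrite mulr1 => /eqP; rewrite oppr_eq0 oner_eq0.
set mu : C := u + i.+1%:R - (n%:R - 1) / 2%:R.
set kappa : C := (u + a%:R) / 2%:R.
have testE p o : (p.+2 + o = a.+1)%N ->
    gamma (mu - 1 / 2%:R) a * ((p.+2%:R * p.+1%:R) * geg mu (a%:Z - 1) (M ord0 p o) 0)
    + kappa * (o%:R * geg mu a (M ord0 p.+2 false) 0) = 0.
  move=> po.
  have : ops mu kappa a (cdb (tens phi (M ord0 p.+2 o)))
      (e ord0 :: map e (idx_range 1 i)) 0 = 0.
    apply: (@vanishes_on_mono _ (fun W => ops mu kappa a (cdb W)) i.+2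
      (@norm_idx i.+2) ord0 p.+2 o _ i.+2 (ord0 :: idx_range 1 i) _ _ van) => [W|W X].
      by rewrite /= codiff_toform Dt_same_mid.
    by rewrite po => WX; apply: jets_same => //; apply: jets_cdb; rewrite addn0.
  have E := test_same_cd DC SB aphi (@mono_dep ord0 p.+2 o) phi1 mu kappa a.
  rewrite {}E mono_Dt2 mono_Dnu !geg_scale sfunN sfunD !sfunZ => /eqP.
  by rewrite oppr_eq0 => /eqP; case: o {po}; rewrite // !mul0r.
case: c def_a => def_a.
  have /testE : (b.*2.+2 + false = a.+1)%N by lia.
  rewrite mul0r mulr0 addr0 (@mono_geg _ _ _ b false); last by lia.
  rewrite /gamma (_ : odd a) ?mul1r; last by lia.
  by move=> /eqP; rewrite mulf_eq0 (negPf (geg_value_neq0 R _ _)) mulf_eq0 !pnatr_eq0.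
case: b def_a => [|b] def_a; first by lia.
have /testE : (b.*2.+2 + true = a.+1)%N by lia.
rewrite (@mono_geg _ _ _ b true); last by lia.
rewrite (@mono_geg _ _ _ b.+1 false); last by lia.
rewrite geg_value1 geg_valueS /gamma (_ : odd a = false); last by lia.
move: (gv b false) (geg_value_neq0 R b false) => g g0 E.
have : (n + 2 + a = 2 * i.+2)%N.
  apply: (@natr_eq_of_mul (2%:R * b.*2.+1%:R * g * (b.*2.+3%:R / 2%:R))).
    by rewrite !mulf_eq0 !negb_or !invr_eq0 !pnatr_eq0 g0.
  rewrite -[RHS]E /mu /kappa /u parE def_a addn0 !doubleS -!mul2n !natrD !natrM.
  by rewrite -!natr1 !natrM; field.
by move=> ?; split; [apply/negP => ?|..]; lia.
Qed.

Lemma same_codiff_eq_oppdown : ~~ odd n -> n <> 2%N ->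
  agree_on (I (n + 2)./2 (n%:Z - (n + 2)./2%:Z)) (Dt_same n./2 0 0 \o @codiff R n)
    (opp_op (Dt_down (n + 2)./2 (- 2%:R) 1)).
Proof.
move=> evn n2 w /flatI_toform[W -> _] x s.
rewrite /= /opp_op codiff_toform Dt_same_zero Dt_down_mid //; last by apply/eqP; lia.
rewrite /Rest /toform op_down1.
rewrite (_ : _ / 2%:R = 0) ?mulr0 ?scale0r ?addr0 ?sfunN ?opprK//.
by rewrite -natrM (_ : (2 * (n + 2)./2 = n + 2)%N) ?natrD; [field|lia].
Qed.

Lemma down_codiff_vanish a i : (2 <= i <= n)%N -> (0 < a)%N ->
  vanishes_on (I i (n%:Z - i%:Z))
    (Dt_down i.-1 (n%:Z - 2 * i%:Z + 2)%:~R a \o @codiff R n).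
Proof.
move=> lein a0 w /flatI_toform[W -> [aW _]] x s.
rewrite /= codiff_toform Dt_down_mid//; last by apply/eqP; lia.
rewrite (_ : (_ + _ - n%:R) / 2%:R = 0) /Rest /toform ?(op_down_cd DC)//.
by rewrite parE natr_pred; [field|lia].
Qed.

Lemma down_codiff_vanish_inv a i : (2 <= i <= n)%N ->
  vanishes_on (I i (n%:Z - i%:Z))
    (Dt_down i.-1 (n%:Z - 2 * i%:Z + 2)%:~R a \o @codiff R n) -> (0 < a)%N.
Proof.
case: i => [//|[//|i]] lein; case: a => // van.
have im : (i.+1 <= m.+1)%N by lia.
have phi1 := @norm_phi_first i.+1 im; rewrite first_vecsS in phi1.
have : cdb (tens (coord_form_C (@norm_idx i.+2)) (M ord0 1 0))
    (nu :: map e (idx_range 1 i)) 0 = 0.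
  apply: (@vanishes_on_mono _ (fun W s => cdb W (nu :: s)) i.+2 (@norm_idx i.+2)
    ord0 1 0 _ i.+2 (idx_range 1 i) _ _ van) => [W|W X WX].
    by rewrite /= codiff_toform Dt_down_zero.
  by apply: jets_iota; apply: jets_cdb.
rewrite (test_cdb_nu SB (@coord_form_antisym _ _) (@mono_dep _ _ _) phi1).
by rewrite mono_Dt sfunZ mono0 mulr1 => /eqP; rewrite oner_eq0.
Qed.

Lemma down_codiff_eq_down2 i : agree_on (I i (n%:Z - i%:Z))
  (Dt_down i.-1 (n%:Z - 2 * i%:Z + 2)%:~R 0 \o @codiff R n)
  (@Dt_down2 R n i (n%:Z - 2 * i%:Z)).
Proof.
move=> w /flatI_toform[W -> _] x s.
rewrite /= codiff_toform Dt_down_zero Dt_down2_toform /Rest /toform.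
by rewrite (_ : - _ + _ - _ = 0) ?geg0//; lia.
Qed.

Let isum (a : nat) : (- a%:Z)%:~R = - a%:R :> C.
Proof. by rewrite intrN -pmulrn. Qed.

Lemma ext_d_Rest_toform W : ext_d (Rest (toform W)) = Rest (toform (ed W)).
Proof. by rewrite ext_d_Rest ext_d_toform. Qed.

(** For [a = 0] the extreme case of the definition also describes the operator,
    as [geg _ 0] is the identity. *)
Lemma Dt_down_geg i (a : nat) (u : C) W : a = 0%N \/ i = n -> Dt_down i u a (toform W)
  = Rest (toform (fun s => geg (u + (n%:R + 1) / 2%:R) a (W (nu :: s)))).
Proof.
have [->|a0 [a0'|->]] := posnP a; [|by rewrite a0' in a0|exact: Dt_down_top].
rewrite Dt_down_zero => _; congr (Rest (toform _)).
by apply/funext => s; rewrite geg0.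
Qed.

Lemma Dt_same_geg i (a : nat) (u : C) W : a = 0%N \/ i = 0%N -> Dt_same i u a (toform W)
  = Rest (toform (fun s => geg (u - (n%:R - 1) / 2%:R) a (W s))).
Proof.
have [->|a0 [a0'|->]] := posnP a; [|by rewrite a0' in a0|exact: Dt_same_bot].
rewrite Dt_same_zero => _; congr (Rest (toform _)).
by apply/funext => s; rewrite geg0.
Qed.

Lemma d_down_vanish a i : [/\ odd n, (n + 1 < 2 * i)%N & a = (2 * i - n - 1)%N] ->
  (i <= n - 1)%N -> vanishes_on (I i (i%:Z - a%:Z - 1))
    (@ext_d R n.-1 \o Dt_down i (- a%:R - 1) a).
Proof.
move=> [on lt_i def_a] lei w /flatI_toform[W -> _] x s.
rewrite /= Dt_down_mid; [|lia|by apply/eqP; lia].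
rewrite ext_d_Rest_toform /Rest /toform (ed_op_down DC).
have iE : 2%:R * i%:R = n%:R + 1 + a%:R :> C.
  by rewrite -natrM (_ : (2 * i = n + 1 + a)%N) ?natrD//; lia.
have i2 : i%:R = (2%:R * i%:R) / 2%:R :> C by field.
rewrite (_ : (_ - n%:R) / 2%:R = 0); last by rewrite iE; field.
rewrite (_ : gamma _ a = 0); first by rewrite oppr0 !scale0r addr0.
rewrite /gamma (_ : odd a = false); last by lia.
by rewrite i2 iE; field.
Qed.

(** For even [a] only the [kappa] term contributes on
    [x_t^(a + 1) dx_n dx_1 .. dx_(i-1)] with [t] outside of the form, and it is a
    multiple of [2 i - (n + 1 + a)].  For odd [a] only the middle term
    contributes on [x_t^(a + 1) dx_1 .. dx_i] with [t] its first index, and its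
    coefficient [gamma] is 1. *)
Lemma d_down_vanish_inv a i : (1 <= i <= n - 1)%N ->
  vanishes_on (I i (i%:Z - a%:Z - 1)) (@ext_d R n.-1 \o Dt_down i (- a%:R - 1) a) ->
  [/\ odd n, (n + 1 < 2 * i)%N & a = (2 * i - n - 1)%N].
Proof.
case: i => // k lek; set u : C := _ - 1 => van.
have km : (k <= m)%N by lia.
have [b [c def_a]] := parity a.
have i_n : k.+1 != n by apply/eqP; lia.
set mu : C := u + k.+1%:R - (n%:R - 1) / 2%:R.
set kappa : C := (u + 2%:R * k.+1%:R - n%:R) / 2%:R.
case: c def_a => def_a.
  have aphi := @coord_form_antisym k.+1 (@tang_idx k.+1).
  have phi_nu r := @tang_phi_nu k.+1 r km.
  have phi1 := @tang_phi_first k.+1 km; rewrite first_vecsS in phi1.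
  set phi := coord_form_C _ in aphi phi_nu phi1.
  have : ed (opd mu kappa a (tens phi (M ord0 b.*2.+2 0)))
      (e ord0 :: map e (idx_range 1 k)) 0 = 0.
    apply: (@vanishes_on_mono _ (fun W => ed (opd mu kappa a W)) k.+1
      (@tang_idx k.+1) ord0 b.*2.+2 0 _ k.+1 (ord0 :: idx_range 1 k) _ _ van) => [W|W X WX].
      by rewrite /= Dt_down_mid ?ext_d_Rest_toform//; lia.
    apply: jets_d; apply: jets_down; first by lia.
    by rewrite (_ : (a + 1 = b.*2.+2 + 0)%N)//; lia.
  have E := test_ed_down_odd DC SB aphi (@mono_dep ord0 b.*2.+2 0) phi_nu phi1 mu kappa a.
  rewrite {}E mono_Dt2 geg_scale !sfunZ (@mono_geg _ _ _ b false); last by lia.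
  rewrite /gamma (_ : odd a); last by lia.
  move: (gv b false) (geg_value_neq0 R b false) => g g0 /eqP.
  by rewrite !mulf_eq0 (negPf g0) !pnatr_eq0 oner_eq0.
have aphi := @coord_form_antisym k.+1 (@norm_idx k.+1).
have phi_t r : coord_form_C (@norm_idx k.+1) (e ord_max :: r) = 0 by apply: norm_phi_max.
have phi1 := @norm_phi_first k (leqW km).
set phi := coord_form_C _ in aphi phi_t phi1.
have [a0|a0] := posnP a.
  have : ed (fun s => tens phi (M ord_max 1 0) (nu :: s))
      (e ord_max :: first_vecs k) 0 = 0.
    apply: (@vanishes_on_mono _ (fun W => ed (fun s => W (nu :: s))) k.+1
      (@norm_idx k.+1) ord_max 1 0 _ k.+1 (ord_max :: idx_range 0 k) _ _ van) => [W|W X WX].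
      by rewrite a0 /= ext_d_Rest_toform.
    by apply: jets_d; apply: jets_iota.
  rewrite (test_ed_iota D aphi _ phi1 phi_t) mono_Dt sfunZ mono0 mulr1 => /eqP.
  by rewrite oner_eq0.
have : ed (opd mu kappa a (tens phi (M ord_max b.*2.+1 0)))
    (e ord_max :: first_vecs k) 0 = 0.
  apply: (@vanishes_on_mono _ (fun W => ed (opd mu kappa a W)) k.+1
    (@norm_idx k.+1) ord_max b.*2.+1 0 _ k.+1 (ord_max :: idx_range 0 k) _ _ van) => [W|W X WX].
    by rewrite /= Dt_down_mid ?ext_d_Rest_toform.
  apply: jets_d; apply: jets_down => //.
  by rewrite (_ : (a + 1 = b.*2.+1 + 0)%N)//; lia.
have nuF : D nu (M ord_max b.*2.+1 0) = 0 by rewrite mono_Dnu scale0r.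
have E := test_ed_down DC SB aphi (@mono_dep ord_max b.*2.+1 0) phi1 phi_t nuF mu kappa a.
rewrite {}E mono_Dt geg_scale !sfunZ (@mono_geg _ _ _ b false); last by lia.
move: (gv b false) (geg_value_neq0 R b false) => g g0 E.
have : (2 * k.+1 = n + 1 + a)%N.
  apply: (@natr_eq_of_mul (b.*2.+1%:R * g / 2%:R)).
    by rewrite !mulf_eq0 !negb_or !invr_eq0 !pnatr_eq0 g0.
  by rewrite -[RHS]E /kappa /u !natrD natrM; field.
by move=> ?; split; lia.
Qed.

Lemma d_down_eq_oppsame : odd n ->
  agree_on (I (n + 1)./2 ((n + 1)./2%:Z - 1)) (@ext_d R n.-1 \o Dt_down (n + 1)./2 (- 1) 0)
    (opp_op (Dt_same (n + 1)./2 (- 1) 1)).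
Proof.
move=> on w /flatI_toform[W -> _] x s.
have: (0 < (n + 1)./2)%N by lia.
move: (n + 1)./2 => i i0; rewrite /= /opp_op Dt_down_zero ext_d_Rest_toform Dt_same_mid//.
by rewrite /Rest /toform op_same1 addNr mul0r mulr0 scale0r addr0 sfunN opprK.
Qed.

Lemma d_same_vanish a i : (0 < a)%N -> (1 <= i)%N ->
  vanishes_on (I i (i%:Z - a%:Z)) (@ext_d R n.-1 \o Dt_same i (- a%:R) a).
Proof.
move=> a0 i0 w /flatI_toform[W -> _] x s.
rewrite /= Dt_same_mid// ext_d_Rest_toform /Rest /toform (ed_op_same DC).
by rewrite addNr mul0r scale0r.
Qed.

(** In the excluded cases the operator is a scalar one, so that [d] is detected
    by a form without [dx_t] and with a coefficient of odd degree in [x_t]. *)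
Lemma d_same_vanish_inv a i : (i <= n - 2)%N ->
  vanishes_on (I i (i%:Z - a%:Z)) (@ext_d R n.-1 \o Dt_same i (- a%:R) a) ->
  (0 < a)%N /\ (1 <= i <= n - 2)%N.
Proof.
move=> lei van; have im : (i <= m)%N by lia.
have [ai|] : (a = 0 \/ i = 0)%N \/ (0 < a)%N /\ (1 <= i <= n - 2)%N; [by lia| |by []].
have [b [c def_a]] := parity a.
set mu : C := - a%:R - (n%:R - 1) / 2%:R.
have : ed (fun s => geg mu a (tens (coord_form_C (@tang_idx i)) (M ord_max b.*2.+1 c) s))
    (e ord_max :: first_vecs i) 0 = 0.
  apply: (@vanishes_on_mono _ (fun W => ed (fun s => geg mu a (W s))) i
    (@tang_idx i) ord_max b.*2.+1 c _ i (ord_max :: idx_range 0 i) _ _ van) => [W|W X WX].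
    by rewrite /= Dt_same_geg// ext_d_Rest_toform.
  by apply: jets_d; apply: jets_geg; rewrite addn1 def_a.
rewrite (ed_geg DC) (test_ed_t D _ (fun r => tang_phi_max r im) (tang_phi_first (leqW im))).
rewrite mono_Dt geg_scale sfunZ mono_geg ?def_a// => /eqP.
by rewrite mulf_eq0 pnatr_eq0 (negPf (geg_value_neq0 R _ _)).
Qed.

Lemma d_same_eq_up a i : a = 0%N \/ i = 0%N ->
  agree_on (I i (i%:Z - a%:Z)) (@ext_d R n.-1 \o Dt_same i (- a%:R) a) (@Dt_up R n (- a%:Z)).
Proof.
move=> ai w /flatI_toform[W -> _] x s.
by rewrite /= Dt_same_geg// ext_d_Rest_toform Dt_up_toform isum opprK /Rest /toform (ed_geg DC).
Qed.

Let uE7 (i a : nat) : (n%:Z - 2 * i%:Z - a%:Z - 1)%:~R = n%:R - 2%:R * i%:R - a%:R - 1 :> C.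
Proof. by rewrite !(intrD, intrM, intrN) -!pmulrn. Qed.

(** For [i = 0] the composition vanishes for lack of forms of degree [-1];
    otherwise [mu], [kappa] and [a] are those of [cdt_op_same]. *)
Lemma codiff_same_vanish a i : [/\ odd n, (2 * i < n - 1)%N & a = (n - 2 * i - 1)%N] ->
  vanishes_on (I i (n%:Z - i%:Z - a%:Z - 1))
    (@codiff R n.-1 \o Dt_same i (n%:Z - 2 * i%:Z - a%:Z - 1)%:~R a).
Proof.
move=> [on lt_i def_a] w /flatI_toform[W -> [aW sW]] x s.
have [i0|i0] := posnP i.
  subst i; rewrite /= Dt_same_bot; last by lia.
  rewrite codiff_Rest /Rest /toform (cdt_geg DC) /cd big1 ?oppr0 ?(gegF0 DC)// => j _.
  by rewrite sW// linear0.
have [c ac] : exists c, a = c.*2.+2 by exists (a./2.-1); lia.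
have nE : n%:R = 2%:R * i%:R + a%:R + 1 :> C.
  by rewrite -[1]/(1%:R) -natrM -!natrD; congr (_%:R); lia.
have aE : a%:R = 2%:R * c.+1%:R :> C by rewrite -natrM; congr (_%:R); lia.
rewrite /= Dt_same_mid; [|lia|lia].
rewrite codiff_Rest uE7.
rewrite (_ : (_ + a%:R) / 2%:R = c.+1%:R); last by rewrite nE aE; field.
rewrite (_ : _ + i%:R - _ = - c.+1%:R); last by rewrite nE aE; field.
by rewrite ac /Rest /toform (cdt_op_same DC SB).
Qed.

(** For odd [a] only the middle term contributes on
    [x_t^(a + 1) dx_n dx_1 .. dx_(i-1)] with [t] outside of the form.  For even
    [a > 0] the outer terms contribute on [x_t^(a + 1) dx_1 .. dx_i] with [t] its
    first index, and give a multiple of [2 i + 1 + a - n]. *)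
Lemma codiff_same_vanish_inv a i : (1 <= i <= n - 1)%N ->
  vanishes_on (I i (n%:Z - i%:Z - a%:Z - 1))
    (@codiff R n.-1 \o Dt_same i (n%:Z - 2 * i%:Z - a%:Z - 1)%:~R a) ->
  [/\ odd n, (2 * i < n - 1)%N & a = (n - 2 * i - 1)%N].
Proof.
case: i => // k lek; rewrite uE7; set u : C := _ - 1 => van.
have km : (k <= m)%N by lia.
have [b [c def_a]] := parity a.
set mu : C := u + k.+1%:R - (n%:R - 1) / 2%:R.
set kappa : C := (u + a%:R) / 2%:R.
case: c def_a => def_a.
  have aphi := @coord_form_antisym k.+1 (@norm_idx k.+1).
  have phi_t r : coord_form_C (@norm_idx k.+1) (e ord_max :: r) = 0 by apply: norm_phi_max.
  have phi1 := @norm_phi_first k (leqW km).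
  set phi := coord_form_C _ in aphi phi_t phi1.
  have : cdt (ops mu kappa a (tens phi (M ord_max b.*2.+2 0))) (first_vecs k) 0 = 0.
    apply: (@vanishes_on_mono _ (fun W => cdt (ops mu kappa a W)) k.+1
      (@norm_idx k.+1) ord_max b.*2.+2 0 _ k.+1 (idx_range 0 k) _ _ van) => [W|W X WX].
      by rewrite /= Dt_same_mid ?codiff_Rest//; lia.
    apply: jets_cdt; apply: jets_same; first by lia.
    by rewrite (_ : (a + 1 = b.*2.+2 + 0)%N)//; lia.
  have nuF : D nu (M ord_max b.*2.+2 0) = 0 by rewrite mono_Dnu scale0r.
  have E := test_cdt_same_normal DC SB aphi (@mono_dep ord_max b.*2.+2 0) phi1 phi_t nuF mu kappa a.
  rewrite {}E mono_lapt geg_scale !sfunZ (@mono_geg _ _ _ b false); last by lia.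
  rewrite /gamma (_ : odd a); last by lia.
  move: (gv b false) (geg_value_neq0 R b false) => g g0 /eqP.
  by rewrite !mulf_eq0 (negPf g0) !pnatr_eq0 oner_eq0.
have aphi := @coord_form_antisym k.+1 (@tang_idx k.+1).
have phi_nu r := @tang_phi_nu k.+1 r km.
have phi1 := @tang_phi_first k.+1 km; rewrite first_vecsS in phi1.
set phi := coord_form_C _ in aphi phi_nu phi1.
case: b def_a => [|b] def_a.
  have : cdt (tens phi (M ord0 1 0)) (map e (idx_range 1 k)) 0 = 0.
    apply: (@vanishes_on_mono _ cdt k.+1
      (@tang_idx k.+1) ord0 1 0 _ k.+1 (idx_range 1 k) _ _ van) => [W|W X WX].
      by rewrite def_a /= Dt_same_zero codiff_Rest.
    exact: jets_cdt.
  rewrite (test_cdt (@mono_dep ord0 1 0) phi1) mono_Dt sfunN sfunZ mono0 mulr1.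
  by move=> /eqP; rewrite oppr_eq0 oner_eq0.
have : cdt (ops mu kappa a (tens phi (M ord0 b.*2.+3 0))) (map e (idx_range 1 k)) 0 = 0.
  apply: (@vanishes_on_mono _ (fun W => cdt (ops mu kappa a W)) k.+1
    (@tang_idx k.+1) ord0 b.*2.+3 0 _ k.+1 (idx_range 1 k) _ _ van) => [W|W X WX].
    by rewrite /= Dt_same_mid ?codiff_Rest//; lia.
  apply: jets_cdt; apply: jets_same; first by lia.
  by rewrite (_ : (a + 1 = b.*2.+3 + 0)%N)//; lia.
have E := test_cdt_same DC SB aphi (@mono_dep ord0 b.*2.+3 0) phi_nu phi1 mu kappa a.
have lZ c F : lap D e (c *: F) = c *: lap D e F.
  exact: (invariantZ _ _ (invariant_lap DC e)).
rewrite {}E mono_Dt lZ mono_lapt scalerA !geg_scale sfunD sfunN !sfunZ.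
rewrite (@mono_geg _ _ _ b false); last by lia.
rewrite (@mono_geg _ _ _ b.+1 false); last by lia.
rewrite geg_valueS.
move: (gv b false) (geg_value_neq0 R b false) => g g0 E.
have : (2 * k.+1 + 1 + a = n)%N.
  apply: (@natr_eq_of_mul (b.*2.+3%:R * b.*2.+1%:R * g)).
    by rewrite !mulf_eq0 !negb_or !pnatr_eq0 g0.
  rewrite -[RHS]E /kappa /u def_a addn0 !doubleS -!mul2n !natrD !natrM -!natr1 !natrM.
  by field.
by move=> ?; split; lia.
Qed.

Lemma codiff_same_eq_oppdown : odd n ->
  agree_on (I (n - 1)./2 (n%:Z - (n - 1)./2%:Z - 1)) (@codiff R n.-1 \o Dt_same (n - 1)./2 0 0)
    (opp_op (Dt_down (n - 1)./2 0 1)).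
Proof.
move=> on w /flatI_toform[W -> _] x s.
rewrite /= /opp_op Dt_same_zero codiff_Rest Dt_down_mid//; last by apply/eqP; lia.
rewrite /Rest /toform op_down1 (cd_basis D SB).
rewrite (_ : 2%:R * _ = - 1); last first.
  rewrite add0r -natrM (_ : n%:R = (2 * (n - 1)./2)%:R + 1) ?natr1; first by field.
  by congr (_%:R); lia.
by rewrite scaleN1r opprB addrAC subrr add0r sfunN opprK.
Qed.

Let uE8 (i a : nat) : (n%:Z - 2 * i%:Z - a%:Z)%:~R = n%:R - 2%:R * i%:R - a%:R :> C.
Proof. by rewrite !(intrD, intrM, intrN) -!pmulrn. Qed.

Lemma codiff_down_vanish a i : (0 < a)%N -> (2 <= i <= n - 1)%N ->
  vanishes_on (I i (n%:Z - i%:Z - a%:Z))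
    (@codiff R n.-1 \o Dt_down i (n%:Z - 2 * i%:Z - a%:Z)%:~R a).
Proof.
move=> a0 lei w /flatI_toform[W -> [aW _]] x s.
rewrite /= Dt_down_mid//; last by apply/eqP; lia.
rewrite codiff_Rest uE8 (_ : (_ - n%:R) / 2%:R = - (a%:R / 2%:R)); last by field.
by rewrite /Rest /toform (cdt_op_down DC SB).
Qed.

(** In the excluded cases the operator is [iota] followed by a scalar one, so
    that it is enough to detect the codifferential of a form with [dx_n dx_t]. *)
Lemma codiff_down_vanish_inv a i : (2 <= i <= n)%N ->
  vanishes_on (I i (n%:Z - i%:Z - a%:Z))
    (@codiff R n.-1 \o Dt_down i (n%:Z - 2 * i%:Z - a%:Z)%:~R a) ->
  (0 < a)%N /\ (2 <= i <= n - 1)%N.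
Proof.
move=> lei; rewrite uE8; set u : C := _ - a%:R => van.
have [ai|] : (a = 0%N \/ i = n) \/ (0 < a)%N /\ (2 <= i <= n - 1)%N; [by lia| |by []].
case: i lei @u van ai => [|[|k]]// lek u van ai.
have [b [c def_a]] := parity a.
have aphi := @coord_form_antisym k.+2 (@norm_idx k.+2).
have phi1 := @norm_phi_first k.+1 lek; rewrite first_vecsS in phi1.
set phi := coord_form_C _ in aphi phi1.
set mu : C := u + (n%:R + 1) / 2%:R.
have : cdt (fun s => geg mu a (tens phi (M ord0 b.*2.+1 c) (nu :: s)))
    (map e (idx_range 1 k)) 0 = 0.
  apply: (@vanishes_on_mono _ (fun W => cdt (fun s => geg mu a (W (nu :: s)))) k.+2
    (@norm_idx k.+2) ord0 b.*2.+1 c _ k.+2 (idx_range 1 k) _ _ van) => [W|W X WX].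
    by rewrite /= Dt_down_geg// codiff_Rest.
  apply: jets_cdt; apply: (@jets_geg _ _ _ (fun s => W (nu :: s)) (fun s => X (nu :: s))).
  by apply: jets_iota; rewrite addn1 def_a.
have aT := antisym_tens aphi (M ord0 b.*2.+1 c).
rewrite (cdt_iota DC SB _ _ _ aT) (test_cdb_nu SB aphi (@mono_dep ord0 b.*2.+1 c) phi1).
rewrite mono_Dt geg_scale sfunN sfunZ mono_geg ?def_a// => /eqP.
by rewrite oppr_eq0 mulf_eq0 pnatr_eq0 (negPf (geg_value_neq0 R _ _)).
Qed.

Lemma codiff_down_eq_oppdown2 a i : a = 0%N \/ i = n ->
  agree_on (I i (n%:Z - i%:Z - a%:Z))
    (@codiff R n.-1 \o Dt_down i (n%:Z - 2 * i%:Z - a%:Z)%:~R a)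
    (opp_op (@Dt_down2 R n i (n%:Z - 2 * i%:Z - a%:Z))).
Proof.
move=> ai w /flatI_toform[W -> [aW _]] x s.
rewrite /= /opp_op Dt_down_geg// codiff_Rest Dt_down2_toform /Rest /toform (cdt_iota DC SB)//.
by rewrite sfunN (_ : - _ + _ - _ = a%:Z)//; lia.
Qed.

End HyperplaneRestriction.

Theorem theorem13p18 (R : realType) (n : nat) (hn : (2 <= n)%N) :
  let I (i : nat) (lam : int) := @flatI R n i lam%:~R i in
  (* (1) *)
  [/\ (forall a i : nat, (i <= n - 1)%N ->
         (vanishes_on (I i i%:Z) (Dt_down i.+1 0 a \o @ext_d R n) <->
          [/\ ~~ odd n, (2 * i < n - 2)%N & a = (n - 2 * i - 2)%N])) /\
      (~~ odd n -> n <> 2%N ->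
         let i := (n - 2)./2 in
         agree_on (I i i%:Z)
           (Dt_down n./2 0 0 \o @ext_d R n) (Dt_same i 0 1)),
  (* (2) *)
      (forall a i : nat, (i <= n - 2)%N ->
         (vanishes_on (I i i%:Z) (Dt_same i.+1 0 a \o @ext_d R n) <->
          (0 < a)%N)) /\
      (forall i : nat, (i <= n - 2)%N ->
         agree_on (I i i%:Z)
           (Dt_same i.+1 0 0 \o @ext_d R n) (@Dt_up R n 0)),
  (* (3) *)
      (forall a i : nat, (1 <= i <= n)%N ->
         (vanishes_on (I i (n%:Z - i%:Z))
            (Dt_same i.-1 (n%:Z - 2 * i%:Z + 2)%:~R a \o @codiff R n) <->
          [/\ ~~ odd n, (n + 2 < 2 * i)%N & a = (2 * i - n - 2)%N])) /\
      (~~ odd n -> n <> 2%N ->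
         let i := (n + 2)./2 in
         agree_on (I i (n%:Z - i%:Z))
           (Dt_same n./2 0 0 \o @codiff R n)
           (opp_op (Dt_down i (- 2%:R) 1))),
  (* (4) *)
      (forall a i : nat, (2 <= i <= n)%N ->
         (vanishes_on (I i (n%:Z - i%:Z))
            (Dt_down i.-1 (n%:Z - 2 * i%:Z + 2)%:~R a \o @codiff R n) <->
          (0 < a)%N)) /\
      (forall i : nat, (2 <= i <= n)%N ->
         agree_on (I i (n%:Z - i%:Z))
           (Dt_down i.-1 (n%:Z - 2 * i%:Z + 2)%:~R 0 \o @codiff R n)
           (@Dt_down2 R n i (n%:Z - 2 * i%:Z))) &
  [/\
  (* (5) *)
      (forall a i : nat, (1 <= i <= n - 1)%N ->
         (vanishes_on (I i (i%:Z - a%:Z - 1))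
            (@ext_d R n.-1 \o Dt_down i (- a%:R - 1) a) <->
          [/\ odd n, (n + 1 < 2 * i)%N & a = (2 * i - n - 1)%N])) /\
      (odd n ->
         let i := (n + 1)./2 in
         agree_on (I i (i%:Z - 1))
           (@ext_d R n.-1 \o Dt_down i (- 1) 0)
           (opp_op (Dt_same i (- 1) 1))),
  (* (6) *)
      (forall a i : nat, (i <= n - 2)%N ->
         (vanishes_on (I i (i%:Z - a%:Z))
            (@ext_d R n.-1 \o Dt_same i (- a%:R) a) <->
          (0 < a)%N /\ (1 <= i <= n - 2)%N)) /\
      (forall a i : nat, (i <= n - 2)%N -> a = 0%N \/ i = 0%N ->
         agree_on (I i (i%:Z - a%:Z))
           (@ext_d R n.-1 \o Dt_same i (- a%:R) a) (@Dt_up R n (- a%:Z))),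
  (* (7) *)
      (forall a i : nat, (i <= n - 1)%N ->
         let vanishing :=
           vanishes_on (I i (n%:Z - i%:Z - a%:Z - 1))
             (@codiff R n.-1
                \o Dt_same i (n%:Z - 2 * i%:Z - a%:Z - 1)%:~R a) in
         let condition :=
           [/\ odd n, (2 * i < n - 1)%N & a = (n - 2 * i - 1)%N] in
         (condition -> vanishing) /\ ((1 <= i)%N -> vanishing -> condition)) /\
      (odd n ->
         let i := (n - 1)./2 in
         agree_on (I i (n%:Z - i%:Z - 1))
           (@codiff R n.-1 \o Dt_same i 0 0)
           (opp_op (Dt_down i 0 1))) &
  (* (8) *)
      (forall a i : nat, (2 <= i <= n)%N ->
         (vanishes_on (I i (n%:Z - i%:Z - a%:Z))
            (@codiff R n.-1 \o Dt_down i (n%:Z - 2 * i%:Z - a%:Z)%:~R a) <->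
          (0 < a)%N /\ (2 <= i <= n - 1)%N)) /\
      (forall a i : nat, (2 <= i <= n)%N -> a = 0%N \/ i = n ->
         agree_on (I i (n%:Z - i%:Z - a%:Z))
           (@codiff R n.-1 \o Dt_down i (n%:Z - 2 * i%:Z - a%:Z)%:~R a)
           (opp_op (@Dt_down2 R n i (n%:Z - 2 * i%:Z - a%:Z))))]].
Proof.
case: n hn => [|[|m]]// _ I; split.
- split=> [a i lei|]; last exact: down_d_eq_same.
  by split; [exact: down_d_vanish_inv|exact: down_d_vanish].
- split=> [a i lei|i _]; last exact: same_d_eq_up.
  by split; [exact: same_d_vanish_inv|exact: same_d_vanish].
- split=> [a i lei|]; last exact: same_codiff_eq_oppdown.
  by split; [exact: same_codiff_vanish_inv|exact: same_codiff_vanish].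
- split=> [a i lei|i _]; last exact: down_codiff_eq_down2.
  by split; [exact: down_codiff_vanish_inv|exact: down_codiff_vanish].
- split.
  + split=> [a i lei|]; last exact: d_down_eq_oppsame.
    split; first exact: d_down_vanish_inv.
    by move=> cond; apply: d_down_vanish => //; case/andP: lei.
  + split=> [a i lei|a i _]; last exact: d_same_eq_up.
    split; first exact: d_same_vanish_inv.
    by move=> [a0 /andP[i0 _]]; apply: d_same_vanish.
  + split=> [a i lei vanishing condition|]; last exact: codiff_same_eq_oppdown.
    split; first exact: codiff_same_vanish.
    by move=> i0; apply: codiff_same_vanish_inv; rewrite i0.
  + split=> [a i lei|a i _]; last exact: codiff_down_eq_oppdown2.
    split; first exact: codiff_down_vanish_inv.
    by move=> [a0 lei']; apply: codiff_down_vanish.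
Qed.
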